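(* Let $\mathbb{P}=\mathbb{P}(V)$ and $\mathbb{P}'=\mathbb{P}(V')$ be projective spaces of dimensions $\geq 3$ associated to vector spaces $V,V'$ over division rings $K$ and $K'$ respectively, with $|K|\geq 4$ or $|K|=3=\mathrm{char}\,K'$. Let $X\subseteq\mathbb{P}$ be a locally affino-projective subgeometry with enough points. Any morphism of geometries $\varphi\colon X\to\mathbb{P}'$ whose image is not contained in a plane is the restriction of a unique partial projective morphism $\phi\colon\mathbb{P}\dashrightarrow\mathbb{P}'$ (that is, there is a unique partial projective morphism $\phi$ which is defined at every point of $X$ and satisfies $\phi|_X=\varphi$).
   Context: A geometry is a set $X$ (of points) with a family of subsets, called subspaces, such that: (G1) $\emptyset$, $X$ and every singleton $\{x\}$ are subspaces ($\{x\}$ is written $x$); (G2) any intersection of subspaces is a subspace; (G3) for a subspace $S$ and a point $x\notin S$ there is no subspace $S'$ with $S\subsetneq S'\subsetneq S\vee x$; (G4) for any subset $A\subseteq X$ and $x\in\overline{A}$ there is a finite subset $\{a_1,\dots,a_r\}\subseteq A$ with $x\in\overline{\{a_1,\dots,a_r\}}$. Here $\overline{A}$ is the least subspace containing $A$ and $\vee$ denotes the supremum of subspaces (closure of the union). A set $A$ is independent if $a\notin\overline{A\setminus a}$ for all $a\in A$; a basis of a subspace $S$ is an independent $A\subseteq S$ with $\overline{A}=S$; all bases of $S$ have the same cardinal, and $\dim S$ is this cardinal minus $1$. Lines and planes are the subspaces of dimension $1$ and $2$; a hyperplane is a maximal proper subspace. Any subset $A$ of a geometry $X$ is a geometry (a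 subgeometry of $X$) whose subspaces are the sets $S\cap A$ with $S$ a subspace of $X$. A morphism of geometries $\varphi\colon X\to X'$ is a map such that the preimage of every subspace of $X'$ is a subspace of $X$. For a subspace $E$ of a geometry $X$, the quotient $X/\!\!/E$ is the set of classes of $X-E$ under $x_1\equiv x_2\Leftrightarrow x_1\vee E=x_2\vee E$; its subspaces are the images of the subspaces $S$ of $X$ containing $E$; it is a geometry. If $X\subseteq\mathbb{P}$ is a subgeometry and $x\in X$, then $X/\!\!/x$ is identified with a subgeometry of $\mathbb{P}/\!\!/x$ through $[y]\mapsto[y]$. A geometry $X$ of dimension $\geq 2$ has enough points when every plane of $X$ has four points, no three of which are collinear (equivalently, the lines of $X/\!\!/x$ have at least three points for all $x\in X$). For a (left) vector space $V$ over a division ring, $\mathbb{P}(V)$ is the set of 1-dimensional vector subspaces of $V$, an irreducible projective space (every line has at least three points) whose subspaces are the subsets $\mathbb{P}(W)$ for vector subspaces $W\subseteq V$; $\dim\mathbb{P}(W)=\dim W-1$. For $x=\langle v\rangle\in\mathbb{P}(V)$ one has $\mathbb{P}(V)/\!\!/x=\mathbb{P}(V/\langle v\rangle)$. A subgeometry $X$ of an irreducible projective space $\mathbb{P}$ is affino-projective if there is a hyperplane $H$ of $\mathbb{P}$ such that $X\cup H=\mathbb{P}$. A subgeometry $X$ of an irreducible projective space $\mathbb{P}$ is locally affino-projective if for any point $x\in X$, $X/\!\!/x$ is an affino-projective subgeometry of $\mathbb{P}/\!\!/x$. A map $\Phi\colon V\to V'$ is semilinear if it is additive and there is a ring morphism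 $\sigma\colon K\to K'$ (not necessarily surjective) with $\Phi(\lambda v)=\sigma(\lambda)\Phi(v)$ for all $\lambda\in K$, $v\in V$. A semilinear map $\Phi$ induces a partially defined map $\phi\colon\mathbb{P}(V)\dashrightarrow\mathbb{P}(V')$, $\langle v\rangle\mapsto\langle\Phi(v)\rangle$, with domain $\mathbb{P}(V)-\mathbb{P}(\ker\Phi)$; such partial maps are called partial projective morphisms. *)

(* Defs.v *)
From HB Require Import structures.
From mathcomp Require Import all_boot all_order all_algebra.
From mathcomp Require Import all_classical.

Set Implicit Arguments.
Unset Strict Implicit.
Unset Printing Implicit Defensive.

Import GRing.Theory.
Local Open Scope classical_set_scope.
Local Open Scope card_scope.
Local Open Scope ring_scope.

(* [smallest F A], the intersection of the members of [F] containing [A], is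
   the closure of [A]; [A `<` B] is strict inclusion. *)
Record geometry_axioms (T : Type) (F : set (set T)) : Prop := {
  geometry_set0 : F set0 ;
  geometry_setT : F setT ;
  geometry_set1 : forall x, F [set x] ;
  geometry_bigcap : forall C : set (set T),
    C `<=` F -> F (\bigcap_(S in C) S) ;
  geometry_cover : forall S x, F S -> ~ S x ->
    ~ exists S', [/\ F S', S `<` S' & S' `<` smallest F (S `|` [set x])] ;
  geometry_finite : forall (A : set T) x, smallest F A x ->
    exists B : set T, [/\ finite_set B, B `<=` A & smallest F B x] }.

Record geometry := Geometry {
  point :> Type ;
  subspace : set (set point) ;
  geometryP : geometry_axioms subspace }.

Arguments subspace {g} _.

Section Geometry.
Variable G : geometry.
Implicit Types (A B S L H : set G) (x y z : G).

Definition closure A : set G := smallest subspace A.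

Definition join A B : set G := closure (A `|` B).

Definition independent A := forall a, A a -> ~ closure (A `\ a) a.

Definition basis S B := [/\ independent B, B `<=` S & closure B = S].

(* Dimensions may be infinite, so the dimension is given by two relations:
   [S] has a basis with [n + 1] elements, resp. with at least [n + 1]. *)
Definition has_dim S (n : nat) := exists2 B, basis S B & B #= `I_n.+1.

Definition dim_ge S (n : nat) := exists2 B, basis S B & `I_n.+1 #<= B.

Definition line L := subspace L /\ has_dim L 1.

Definition plane S := subspace S /\ has_dim S 2.

Definition hyperplane H :=
  [/\ subspace H, H <> setT &
      forall S, subspace S -> S <> setT -> H `<=` S -> S = H].

Definition collinear x y z := exists L, [/\ line L, L x, L y & L z].

Definition enough_points :=
  dim_ge [set: G] 2 /\
  forall S, plane S -> exists p : 'I_4 -> G,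
    [/\ injective p, forall i, S (p i) &
        forall i j k, i != j -> j != k -> i != k ->
          ~ collinear (p i) (p j) (p k)].

Definition affino_projective (X : set G) :=
  exists2 H, hyperplane H & X `|` H = setT.

End Geometry.

Arguments enough_points : clear implicits.

Definition geometry_morphism (G G' : geometry) (f : G -> G') :=
  forall S : set G', subspace S -> subspace (f @^-1` S).

Section GeometryTheory.
Variable G : geometry.
Implicit Types (A B S : set G) (x y : G).

Lemma subspace_closure A : subspace (closure A).
Proof. by apply: (geometry_bigcap (geometryP G)) => S []. Qed.

Lemma sub_closure A : A `<=` closure A.
Proof. exact: sub_gen_smallest. Qed.

Lemma closure_sub A S : subspace S -> A `<=` S -> closure A `<=` S.
Proof. exact: smallest_sub. Qed.

Lemma closure_mono A B : A `<=` B -> closure A `<=` closure B.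
Proof.
by move=> AB; apply: closure_sub (subspace_closure B) _ => x /AB; exact: sub_closure.
Qed.

Lemma exchange S x y : subspace S -> ~ S y ->
  closure (S `|` [set x]) y -> closure (S `|` [set y]) x.
Proof.
move=> sS Sy Sxy; apply: contrapT => nx.
have Sx : ~ S x by move=> Sx; apply: nx; apply: sub_closure; left.
apply: (geometry_cover (geometryP G) sS Sx).
exists (closure (S `|` [set y])); split.
- exact: subspace_closure.
- split; first by move=> z Sz; apply: sub_closure; left.
  by move=> h; apply: Sy; apply: h; apply: sub_closure; right.
- split.
    apply: closure_sub; first exact: subspace_closure.
    by move=> z [Sz|->//]; apply: sub_closure; left.
  by move=> h; apply: nx; apply: h; apply: sub_closure; right.
Qed.

End GeometryTheory.

Section Subgeometry.
Variables (G : geometry) (X : set G).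

Definition subgeometry_subspace : set (set X) :=
  [set (fun x : X => S (sval x)) | S in @subspace G].

Local Notation F := subgeometry_subspace.

Lemma subgeometry_smallest (A : set X) x :
  smallest F A x <-> closure (sval @` A) (sval x).
Proof.
split=> [h|h M [[S sS <-] AS]].
  apply: (h (fun y : X => closure (sval @` A) (sval y))); split.
    by exists (closure (sval @` A)) => //; exact: subspace_closure.
  by move=> y Ay; apply: sub_closure; exists y.
by apply: (closure_sub sS _ h) => _ [y Ay <-]; exact: AS.
Qed.

Lemma subgeometry_axioms : geometry_axioms F.
Proof.
have inj (x y : X) : sval x = sval y -> x = y by exact: val_inj.
split.
- by exists set0 => //; exact: geometry_set0 (geometryP G).
- by exists setT => //; exact: geometry_setT (geometryP G).
- move=> x; exists [set sval x]; first exact: geometry_set1 (geometryP G) _.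
  by apply/seteqP; split => y /= => [/inj|->].
- move=> C CF.
  exists (\bigcap_(S in [set S | subspace S /\ C (fun x : X => S (sval x))]) S).
    by apply: (geometry_bigcap (geometryP G)) => S [].
  apply/seteqP; split => x h M.
    by move=> CM; have [S sS SM] := CF _ CM; rewrite -SM; apply: h; rewrite /= SM.
  by move=> [sM CM]; apply: (h _ CM).
- move=> _ x [S0 sS0 <-] /= Sx [_ [[S1 sS1 <-] [S01 nS10] [S1x nx]]].
  set C0 := closure (sval @` [set y : X | S0 (sval y)]).
  have sC0 : subspace C0 by exact: subspace_closure.
  have C0S0 : C0 `<=` S0 by apply: closure_sub => // _ [y ? <-].
  have C0S1 : C0 `<=` S1 by apply: closure_sub => // _ [y ? <-]; exact: S01.
  have [z S1z S0z] : exists2 z : X, S1 (sval z) & ~ S0 (sval z).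
    apply: contrapT => nz; apply: nS10 => z S1z; apply: contrapT => S0z.
    by apply: nz; exists z.
  have C0z : ~ C0 (sval z) by move/C0S0.
  have C0xz : closure (C0 `|` [set sval x]) (sval z).
    have /subgeometry_smallest h := S1x _ S1z.
    apply: (closure_sub (subspace_closure _) _ h) => _ [y [S0y|->] <-].
      by apply: sub_closure; left; apply: sub_closure; exists y.
    by apply: sub_closure; right.
  have {}S1x : S1 (sval x).
    apply: (closure_sub sS1 _ (exchange sC0 C0z C0xz)) => y [|->//].
    exact: C0S1.
  apply: nx; apply: smallest_sub; first by exists S1.
  by move=> y [|->//]; exact: S01.
- move=> A x /subgeometry_smallest /(geometry_finite (geometryP G))[B [fB BA Bx]].
  exists ((fun y : X => sval y) @^-1` B); split.
  + by apply: finite_preimage => // y z _ _; exact: inj.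
  + by move=> y /= /BA[z Az /inj <-].
  + apply/subgeometry_smallest; apply: closure_mono Bx => b Bb.
    by have [z Az zb] := BA _ Bb; exists z => //=; rewrite zb.
Qed.

Definition subgeometry : geometry := Geometry subgeometry_axioms.

End Subgeometry.

Section Quotient.
Variables (G : geometry) (E : set G).

Definition quotient_class (x : G) : set G :=
  [set y | ~ E y /\ join [set y] E = join [set x] E].

Definition quotient_point : Type := set_type [set quotient_class x | x in ~` E].

(* The image in the quotient of a set [A] of points of [G], i.e. of [A - E]. *)
Definition quotient_image (A : set G) : set quotient_point :=
  [set c | exists x, [/\ A x, ~ E x & sval c = quotient_class x]].

Definition quotient_subspace : set (set quotient_point) :=
  [set quotient_image S | S in [set S | subspace S /\ E `<=` S]].

Hypothesis sE : subspace E.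
Local Notation F := quotient_subspace.

Lemma join_eq x y : ~ E y -> join [set x] E y -> join [set y] E = join [set x] E.
Proof.
rewrite /join => Ey xy; have yx : closure ([set y] `|` E) x.
  by rewrite setUC; apply: (exchange sE Ey); rewrite setUC.
apply/seteqP; split; apply: closure_sub; try exact: subspace_closure.
  by move=> z [->|Ez]; [exact: xy|apply: sub_closure; right].
by move=> z [->|Ez]; [exact: yx|apply: sub_closure; right].
Qed.

Lemma quotient_classE x y : ~ E y -> quotient_class x = quotient_class y ->
  join [set x] E = join [set y] E.
Proof.
move=> Ey xy; have : quotient_class y y by [].
by rewrite -xy => -[].
Qed.

Lemma quotient_surj (c : quotient_point) :
  exists2 x, ~ E x & sval c = quotient_class x.
Proof. by have := set_mem (svalP c) => -[x Ex <-]; exists x. Qed.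

Lemma quotient_mk x : ~ E x -> exists c : quotient_point, sval c = quotient_class x.
Proof.
move=> Ex.
have h : quotient_class x \in [set quotient_class x | x in ~` E].
  by rewrite inE; exists x.
by exists (exist (fun c => c \in _) _ h).
Qed.

Lemma quotient_imageP S c x : subspace S -> E `<=` S -> ~ E x ->
  sval c = quotient_class x -> quotient_image S c <-> S x.
Proof.
move=> sS ES Ex cx; split=> [[y [Sy Ey cy]]|Sx]; last by exists x.
have xy : join [set x] E = join [set y] E.
  by apply: quotient_classE => //; rewrite -cx.
have : join [set y] E x by rewrite -xy; apply: sub_closure; left.
by apply: closure_sub => // z [->//|]; exact: ES.
Qed.

Lemma quotient_inj (c d : quotient_point) : sval c = sval d -> c = d.
Proof. exact: val_inj. Qed.

Lemma quotient_axioms : geometry_axioms F.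
Proof.
split.
- exists E; first by split.
  by apply/seteqP; split=> // c [x []].
- exists setT; first by split=> //; exact: geometry_setT (geometryP G).
  by apply/seteqP; split=> // c _; have [x Ex cx] := quotient_surj c; exists x.
- move=> c; have [x Ex cx] := quotient_surj c.
  exists (join [set x] E).
    by split; [exact: subspace_closure|move=> z Ez; apply: sub_closure; right].
  apply/seteqP; split=> [d [y [xy Ey dy]]|_ ->].
    apply: quotient_inj; rewrite dy cx /quotient_class.
    by rewrite (join_eq Ey xy).
  by exists x; split=> //; apply: sub_closure; left.
- move=> C CF.
  exists (\bigcap_(S in [set S | [/\ subspace S, E `<=` S & C (quotient_image S)]]) S).
    split; first by apply: (geometry_bigcap (geometryP G)) => S [].
    by move=> z Ez S [_ ES _]; exact: ES.
  apply/seteqP; split => c.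
    move=> [x [h Ex cx]] M CM; have [S [sS ES] SM] := CF _ CM.
    by rewrite -SM; exists x; split=> //; apply: h; split=> //; rewrite SM.
  move=> h; have [x Ex cx] := quotient_surj c; exists x; split=> //.
  by move=> S [sS ES CS]; have /(quotient_imageP sS ES Ex cx) := h _ CS.
- move=> _ c [S [sS ES] <-] Sc [_ [[S' [sS' ES'] <-] [SS' nS'S] [S'c nc]]].
  have [x Ex cx] := quotient_surj c.
  have SsubS' : S `<=` S'.
    move=> z Sz; have [Ez|Ez] := pselect (E z); first exact: ES'.
    have [d dz] := quotient_mk Ez.
    by apply/(quotient_imageP sS' ES' Ez dz)/SS'; exists z.
  have [d [[y [S'y Ey dy]] Sd]] :
      exists d, quotient_image S' d /\ ~ quotient_image S d.
    apply: contrapT => nd; apply: nS'S => d S'd; apply: contrapT => Sd.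
    by apply: nd; exists d.
  have Sy : ~ S y by move=> Sy; apply: Sd; exists y.
  have sj := subspace_closure (S `|` [set x]).
  have Ej : E `<=` closure (S `|` [set x]).
    by move=> z Ez; apply: sub_closure; left; exact: ES.
  have S'd : quotient_image S' d by exists y.
  have jy : closure (S `|` [set x]) y.
    apply/(quotient_imageP sj Ej Ey dy).
    apply: (smallest_sub _ _ (S'c _ S'd)); first by exists (closure (S `|` [set x])).
    move=> e [[z [Sz Ez ez]]|->]; last first.
      by exists x; split=> //; apply: sub_closure; right.
    by exists z; split=> //; apply: sub_closure; left.
  have S'x : S' x.
    apply: (closure_sub sS' _ (exchange sS Sy jy)) => z [|->//].
    exact: SsubS'.
  apply: nc; apply: smallest_sub; first by exists S'.
  by move=> e [|->]; [exact: SS'|exists x].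
- move=> A c Ac; have [x Ex cx] := quotient_surj c.
  pose A0 := [set z | exists2 d, A d & sval d = quotient_class z /\ ~ E z] `|` E.
  have sA0 := subspace_closure A0.
  have EA0 : E `<=` closure A0 by move=> z Ez; apply: sub_closure; right.
  have : closure A0 x.
    apply/(quotient_imageP sA0 EA0 Ex cx).
    apply: (smallest_sub _ _ Ac); first by exists (closure A0).
    move=> d Ad; have [z Ez dz] := quotient_surj d; exists z; split=> //.
    by apply: sub_closure; left; exists d.
  move=> /(geometry_finite (geometryP G))[B0 [fB0 B0A0 B0x]].
  exists [set d | exists z, [/\ B0 z, ~ E z & sval d = quotient_class z]]; split.
  + apply: (@sub_finite_set _ _ ((fun d : quotient_point => sval d) @^-1` (quotient_class @` B0))).
      by move=> d [z [B0z _ dz]]; exists z => //=; rewrite dz.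
    apply: finite_preimage; last exact: finite_image.
    by move=> d e _ _; exact: quotient_inj.
  + move=> d [z [B0z Ez dz]]; have [[e Ae [ez _]]|//] := B0A0 _ B0z.
    by rewrite (_ : d = e) //; apply: quotient_inj; rewrite dz ez.
  + move=> _ [[M [sM EM] <-] BM]; apply/(quotient_imageP sM EM Ex cx).
    apply: (closure_sub sM _ B0x) => z B0z.
    have [Ez|Ez] := pselect (E z); first exact: EM.
    have [d dz] := quotient_mk Ez.
    by apply/(quotient_imageP sM EM Ez dz)/BM; exists z.
Qed.

Definition quotient : geometry := Geometry quotient_axioms.

End Quotient.

Definition point_quotient (G : geometry) (x : G) : geometry :=
  quotient (geometry_set1 (geometryP G) x).

(* [quotient_image X] is the quotient of [X] by [x], seen as a subgeometry of
   the quotient of [P] by [x]. *)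
Definition locally_affino_projective (P : geometry) (X : set P) :=
  forall x, X x ->
    affino_projective (quotient_image X : set (point_quotient x)).

Definition division_ring (K : unitRingType) :=
  forall a : K, a != 0 -> a \is a GRing.unit.

Section ProjectivePoints.
Variables (K : unitRingType) (V : lmodType K).

Definition vsubspace (W : set V) := submod_closed (mem W).

Definition vline (v : V) : set V := [set a *: v | a in [set: K]].

Definition proj_point : Type := set_type [set vline v | v in [set v | v != 0]].

Definition proj_sub (W : set V) : set proj_point := [set p | sval p `<=` W].

Definition proj_subspace : set (set proj_point) :=
  [set proj_sub W | W in vsubspace].

Lemma vline_mem (v : V) : v != 0 ->
  vline v \in [set vline v | v in [set v | v != 0]].
Proof. by move=> v0; rewrite inE; exists v. Qed.

Definition proj_pt (v : V) (v0 : v != 0) : proj_point :=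
  exist (fun l => l \in _) (vline v) (vline_mem v0).

Lemma vsubspaceP W : vsubspace W <->
  W 0 /\ forall a u v, W u -> W v -> W (a *: u + v).
Proof.
split=> [[W0 Wl]|[W0 Wl]]; split.
- by move: W0; rewrite !inE.
- by move=> a u v Wu Wv; apply: set_mem; apply: Wl; rewrite !inE.
- by rewrite !inE.
- by move=> a u v; rewrite !inE; exact: Wl.
Qed.

Lemma vline_id v : vline v v.
Proof. by exists 1 => //; rewrite scale1r. Qed.

Lemma vsubspace_vline v : vsubspace (vline v).
Proof.
apply/vsubspaceP; split; first by exists 0 => //; rewrite scale0r.
move=> a _ _ [b _ <-] [c _ <-]; exists (a * b + c) => //.
by rewrite scalerDl scalerA.
Qed.

Lemma proj_surj (p : proj_point) : exists v (v0 : v != 0), p = proj_pt v0.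
Proof.
have [v v0 vp] := set_mem (svalP p); exists v, v0.
by apply: val_inj.
Qed.

Lemma proj_subP W v (v0 : v != 0) : vsubspace W ->
  proj_sub W (proj_pt v0) <-> W v.
Proof.
move=> /vsubspaceP[W0 Wl]; split=> [h|Wv _ [a _ <-]].
  by apply: h; exact: vline_id.
by rewrite -[_ *: _]addr0; exact: Wl.
Qed.

Hypothesis dK : division_ring K.
Local Notation F := proj_subspace.

Lemma proj_axioms : geometry_axioms F.
Proof.
split.
- exists [set 0].
    by apply/vsubspaceP; split=> // a _ _ -> ->; rewrite scaler0 addr0.
  apply/seteqP; split=> // p; have [v [v0 ->]] := proj_surj p.
  by move=> /(_ v (vline_id v)) /eqP; rewrite (negbTE v0).
- exists setT; first by apply/vsubspaceP.
  by apply/seteqP; split.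
- move=> p; have [u [u0 ->]] := proj_surj p; exists (vline u).
    exact: vsubspace_vline.
  apply/seteqP; split=> [q|_ -> //]; have [v [v0 ->]] := proj_surj q.
  move=> /(proj_subP _ (vsubspace_vline u))[a _ av].
  have a0 : a != 0 by apply: contra_neq v0 => a0; rewrite -av a0 scale0r.
  apply: val_inj => /=; rewrite -av; apply/seteqP; split=> _ [b _ <-].
    by exists (b * a) => //; rewrite scalerA.
  by exists (b / a) => //; rewrite scalerA mulrVK //; exact: dK.
- move=> C CF.
  exists (\bigcap_(W in [set W | vsubspace W /\ C (proj_sub W)]) W).
    apply/vsubspaceP; split=> [W [/vsubspaceP[]]//|a u v hu hv W CW].
    have [/vsubspaceP[_ Wl] _] := CW.
    by apply: Wl; [exact: hu|exact: hv].
  apply/seteqP; split=> p h.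
    move=> M CM; have [W sW WM] := CF _ CM.
    by rewrite -WM => v pv; apply: (h v pv); split=> //; rewrite WM.
  by move=> v pv W [sW CW]; exact: (h _ CW).
- move=> _ p [W sW <-] Wp [_ [[W' sW' <-] [WW' nW'W] [W'p np]]].
  have [u [u0 pu]] := proj_surj p.
  have [/vsubspaceP [W0 Wl] /vsubspaceP [W'0 W'l]] := (sW, sW').
  have [q W'q Wq] : exists2 q, proj_sub W' q & ~ proj_sub W q.
    apply: contrapT => nq; apply: nW'W => q W'q; apply: contrapT => Wq.
    by apply: nq; exists q.
  have [v [v0 qv]] := proj_surj q.
  rewrite qv in W'q Wq.
  have W'v : W' v by apply/(proj_subP v0 sW').
  pose S := [set w | exists a, exists2 z, W z & w = a *: u + z].
  have sS : vsubspace S.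
    apply/vsubspaceP; split; first by exists 0, 0; rewrite // scale0r addr0.
    move=> a _ _ [b [z Wz ->]] [c [t Wt ->]].
    exists (a * b + c), (a *: z + t); first exact: Wl.
    by rewrite scalerDr scalerDl scalerA addrACA.
  have [a [z Wz vaz]] : S v.
    apply/(proj_subP v0 sS); apply: (smallest_sub _ _ (W'p _ W'q)).
      by exists S.
    move=> r [|->]; last first.
      by rewrite pu; apply/proj_subP => //; exists 1, 0; rewrite // scale1r addr0.
    have [w [w0 ->]] := proj_surj r => /(proj_subP w0 sW) Ww.
    by apply/proj_subP => //; exists 0, w; rewrite // scale0r add0r.
  have a0 : a != 0.
    apply/eqP => a0; apply: Wq; apply/proj_subP => //.
    by rewrite vaz a0 scale0r add0r.
  have W'z : W' z.
    have [->//|z0] := eqVneq z 0.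
    by apply/(proj_subP z0 sW')/WW'/proj_subP.
  apply: np; apply: smallest_sub; first by exists W'.
  move=> r [|->]; first exact: WW'.
  rewrite pu; apply/proj_subP => //.
  have -> : u = a^-1 *: ((-1) *: z + v) + 0.
    by rewrite addr0 vaz addrCA scaleN1r addNr addr0 scalerA mulVr ?scale1r //; exact: dK.
  by apply: (W'l) => //; exact: W'l.
- move=> A p Ap; have [v [v0 pv]] := proj_surj p.
  pose W := [set w : V | exists B, [/\ finite_set B, B `<=` A &
    forall W', vsubspace W' -> B `<=` proj_sub W' -> W' w]].
  have sW : vsubspace W.
    apply/vsubspaceP; split.
      by exists set0; split=> // W' /vsubspaceP[].
    move=> a x y [B [fB BA Bx]] [B' [fB' B'A B'y]].
    exists (B `|` B'); split; first by rewrite finite_setU.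
      by move=> z [/BA|/B'A].
    move=> W' sW' BW'; have /vsubspaceP[_ W'l] := sW'.
    apply: W'l; [apply: Bx => //|apply: B'y => //] => z Bz; apply: BW'.
      by left.
    by right.
  have [B [fB BA Bv]] : W v.
    apply/(proj_subP v0 sW); rewrite -pv.
    apply: (smallest_sub _ _ Ap); first by exists W.
    move=> q Aq w qw; exists [set q]; split; first exact: finite_set1.
      by move=> _ ->.
    by move=> W' sW' /(_ q erefl w qw).
  exists B; split=> // _ [[W' sW' <-] BW'].
  by rewrite pv; apply/proj_subP => //; exact: Bv.
Qed.

Definition projective_space : geometry := Geometry proj_axioms.

End ProjectivePoints.

Arguments projective_space {K} V dK.

Section PartialProjectiveMorphism.
Variables (K K' : unitRingType) (V : lmodType K) (V' : lmodType K').

Definition semilinear (Phi : V -> V') :=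
  (forall u v, Phi (u + v) = Phi u + Phi v) /\
  exists sigma : {rmorphism K -> K'},
    forall a v, Phi (a *: v) = sigma a *: Phi v.

(* Partially defined maps are encoded as option-valued maps. *)
Definition partial_projective_morphism
    (phi : proj_point V -> option (proj_point V')) :=
  exists2 Phi : V -> V', semilinear Phi &
    forall (v : V) (v0 : v != 0),
      (forall Phiv0 : Phi v != 0, phi (proj_pt v0) = Some (proj_pt Phiv0)) /\
      (Phi v = 0 -> phi (proj_pt v0) = None).

End PartialProjectiveMorphism.

(* Main.v *)
Require Import Defs.
From HB Require Import structures.
From mathcomp Require Import all_boot all_order all_algebra.
From mathcomp Require Import all_classical.

Set Implicit Arguments.
Unset Strict Implicit.
Unset Printing Implicit Defensive.

Import GRing.Theory.
Local Open Scope classical_set_scope.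
Local Open Scope card_scope.
Local Open Scope ring_scope.

(** Points are replaced by vectors: [f] lifts the morphism to the vectors of the
    points of [X], and the preimage of a subspace under [f] is the trace of a
    subspace.

    Quotient by a point [x] of [X], and by its image [f x].  The induced map is
    defined on the complement of a hyperplane, up to points that it sends nowhere
    because [f] sends them to [f x]; such a map is given below by vectors [F v],
    with [F v = 0] where it is undefined.  A fundamental theorem for these maps
    ([affino_projective_extension]) gives a semilinear map [Phi] with
    [f z = c Phi z] modulo [f x] for all [z] in [X].

    For this theorem fix an origin [o] and consider, for each direction [d] of
    the affine space, the images of the lines parallel to [d].  They are
    concurrent ([infinity_point]): with at least four scalars this is the
    converse of Desargues, applied to two triangles inscribed in three parallel
    lines whose sides meet on an axis inside the affine space; with three scalars
    the point at infinity is already determined by the three points of a line,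
    because the image has characteristic three as well.  The common point has a
    representative [D d] such that [F o + D d] represents the image of [o + d].
    Parallels joining [d] to [e] and [k d] to [k e] show that [D e - D d]
    represents the image of the direction [e - d] ([displacement_sub]), whence
    [D] is additive on independent directions.  The directions along which the
    image of [o] does not move are reached by additivity ([shiftD]), and [D]
    becomes semilinear on all directions ([exists_morphism]).

    For points [x], [y] of [X] with distinct images, the two local maps agree up
    to a factor modulo the line through [f x] and [f y], so they glue to a map
    into [V'], which is the fibre product of its quotients by [f x] and by [f y]
    ([glue]).  A third point [w], with [f w] off that line, shows that the glued
    map is right at every point of [X], and the same comparison of semilinear
    maps ([proportional_mod]) gives uniqueness.  The image not being contained in
    a plane is what makes all these quotients large enough. *)

(** * Identities in modules over a noncommutative ring *)

Section NoncommutativeModule.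
Variables (R : unitRingType) (V : lmodType R) (es : seq R) (ev : seq V).

(** The coefficients do not commute, so an identity in a module is decided by
    expanding both sides into signed words: scalar letters followed by a vector. *)
Inductive sexp :=
  | SAtom of nat | SZero | SOne | SAdd of sexp & sexp | SOpp of sexp
  | SMul of sexp & sexp.

Inductive vexp :=
  | VAtom of nat | VZero | VAdd of vexp & vexp | VOpp of vexp
  | VScale of sexp & vexp.

Fixpoint seval (e : sexp) : R :=
  match e with
  | SAtom n => nth 0 es n
  | SZero => 0
  | SOne => 1
  | SAdd a b => seval a + seval b
  | SOpp a => - seval a
  | SMul a b => seval a * seval b
  end.

Fixpoint veval (e : vexp) : V :=
  match e with
  | VAtom n => nth 0 ev n
  | VZero => 0
  | VAdd a b => veval a + veval b
  | VOpp a => - veval a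
  | VScale s a => seval s *: veval a
  end.

Fixpoint snorm (e : sexp) : seq (bool * seq nat) :=
  match e with
  | SAtom n => [:: (false, [:: n])]
  | SZero => [::]
  | SOne => [:: (false, [::])]
  | SAdd a b => snorm a ++ snorm b
  | SOpp a => [seq (~~ t.1, t.2) | t <- snorm a]
  | SMul a b => [seq (t.1 (+) u.1, t.2 ++ u.2) | t <- snorm a, u <- snorm b]
  end.

Fixpoint vnorm (e : vexp) : seq (bool * (seq nat * nat)) :=
  match e with
  | VAtom n => [:: (false, ([::], n))]
  | VZero => [::]
  | VAdd a b => vnorm a ++ vnorm b
  | VOpp a => [seq (~~ t.1, t.2) | t <- vnorm a]
  | VScale s a =>
      [seq (t.1 (+) u.1, (t.2 ++ u.2.1, u.2.2)) | t <- snorm s, u <- vnorm a]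
  end.

Definition word (w : seq nat) : R := foldr (fun n r => nth 0 es n * r) 1 w.

Definition smono (t : bool * seq nat) : R := (-1) ^+ t.1 * word t.2.

Definition vmono (t : bool * (seq nat * nat)) : V :=
  ((-1) ^+ t.1 * word t.2.1) *: nth 0 ev t.2.2.

Lemma word_cat w1 w2 : word (w1 ++ w2) = word w1 * word w2.
Proof. by elim: w1 => [|n w IH] /=; rewrite ?mul1r // IH mulrA. Qed.

Lemma signr_word (b1 b2 : bool) w1 w2 :
  (-1) ^+ (b1 (+) b2) * word (w1 ++ w2) =
  ((-1) ^+ b1 * word w1) * ((-1) ^+ b2 * word w2).
Proof.
rewrite signr_addb word_cat !mulrA; congr (_ * _); rewrite -!mulrA.
by congr (_ * _); case: b2; rewrite ?mulN1r ?mulrN1 ?mul1r ?mulr1.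
Qed.

Lemma snormE e : seval e = \sum_(t <- snorm e) smono t.
Proof.
elim: e => /= [n|||a -> b ->|a ->|a -> b ->].
- by rewrite big_seq1 /smono /= mulr1 mul1r.
- by rewrite big_nil.
- by rewrite big_seq1 /smono /= mulr1.
- by rewrite big_cat.
- rewrite big_map -sumrN; apply: eq_bigr => t _.
  by rewrite /smono; case: t => [[] w] /=; rewrite !(mul1r, mulN1r, opprK).
- rewrite mulr_suml big_allpairs_dep /=; apply: eq_bigr => t _.
  by rewrite mulr_sumr; apply: eq_bigr => u _; rewrite /smono signr_word.
Qed.

Lemma vnormE e : veval e = \sum_(t <- vnorm e) vmono t.
Proof.
elim: e => /= [n||a -> b ->|a ->|s a ->].
- by rewrite big_seq1 /vmono /= mulr1 scale1r.
- by rewrite big_nil.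
- by rewrite big_cat.
- rewrite big_map -sumrN; apply: eq_bigr => t _.
  by rewrite /vmono; case: t => [[] w] /=; rewrite !(mul1r, mulN1r, scaleNr, opprK).
- rewrite snormE scaler_suml big_allpairs_dep /=; apply: eq_bigr => t _.
  rewrite scaler_sumr; apply: eq_bigr => u _.
  by rewrite /vmono /= signr_word -/(smono t) scalerA.
Qed.

(** The first argument bounds the recursion; the length of the list suffices. *)
Fixpoint cancels n (l : seq (bool * (seq nat * nat))) : bool :=
  match l, n with
  | [::], _ => true
  | t :: l', n'.+1 =>
      ((~~ t.1, t.2) \in l') && cancels n' (rem (~~ t.1, t.2) l')
  | _ , _ => false
  end.

Lemma cancelsP n l : cancels n l -> \sum_(t <- l) vmono t = 0.
Proof.
elim: n l => [|n IH] [|t l] //=; rewrite ?big_nil // => /andP[tl /IH].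
rewrite big_cons (perm_big _ (perm_to_rem tl)) big_cons /= addrA => ->.
by rewrite addr0 /vmono; case: t {tl} => [[] w] /=;
  rewrite !(mul1r, mulN1r, scaleNr) (addNr, addrN).
Qed.

Lemma lmod_eq e1 e2 :
  (let l := vnorm (VAdd e1 (VOpp e2)) in cancels (size l) l) ->
  veval e1 = veval e2.
Proof.
by move=> /cancelsP h; apply: subr0_eq; rewrite -[_ - _]/(veval (VAdd e1 (VOpp e2))) vnormE.
Qed.

End NoncommutativeModule.

(** Reduces a consequence [x = y] of linear equations to an identity: [z] is the
    combination of the equations. *)
Lemma lincomb (M : zmodType) (x y z : M) : z = 0 -> x - y = z -> x = y.
Proof. by move=> -> /subr0_eq. Qed.

(** Identities in the ring itself are identities in its regular module. *)
Lemma regular_eq (R : unitRingType) (a b : R) :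
  a *: (1 : R^o) = b *: (1 : R^o) -> a = b.
Proof. by rewrite /GRing.scale /= !mulr1. Qed.

Ltac lindex x l :=
  lazymatch l with
  | x :: _ => constr:(O)
  | _ :: ?l' => let n := lindex x l' in constr:(S n)
  end.

Ltac ladd x l :=
  let rec mem l' := lazymatch l' with
    | x :: _ => constr:(true) | _ :: ?l'' => mem l'' | _ => constr:(false) end in
  lazymatch mem l with true => l | _ => constr:(x :: l) end.

Ltac satoms l e :=
  lazymatch e with
  | GRing.zero => l
  | GRing.one _ => l
  | GRing.add ?a ?b => let l := satoms l a in satoms l b
  | GRing.mul ?a ?b => let l := satoms l a in satoms l b
  | GRing.opp ?a => satoms l a
  | _ => ladd e l
  end.

Ltac vatoms l e :=
  lazymatch e with
  | GRing.zero => l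
  | GRing.add ?a ?b => let l := vatoms l a in vatoms l b
  | GRing.opp ?a => vatoms l a
  | GRing.scale _ ?a => vatoms l a
  | _ => ladd e l
  end.

Ltac vsatoms l e :=
  lazymatch e with
  | GRing.add ?a ?b => let l := vsatoms l a in vsatoms l b
  | GRing.opp ?a => vsatoms l a
  | GRing.scale ?s ?a => let l := satoms l s in vsatoms l a
  | _ => l
  end.

Ltac sreify l e :=
  lazymatch e with
  | GRing.zero => constr:(SZero)
  | GRing.one _ => constr:(SOne)
  | GRing.add ?a ?b => let a := sreify l a in let b := sreify l b in constr:(SAdd a b)
  | GRing.mul ?a ?b => let a := sreify l a in let b := sreify l b in constr:(SMul a b)
  | GRing.opp ?a => let a := sreify l a in constr:(SOpp a)
  | _ => let n := lindex e l in constr:(SAtom n)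
  end.

Ltac vreify ls lv e :=
  lazymatch e with
  | GRing.zero => constr:(VZero)
  | GRing.add ?a ?b =>
      let a := vreify ls lv a in let b := vreify ls lv b in constr:(VAdd a b)
  | GRing.opp ?a => let a := vreify ls lv a in constr:(VOpp a)
  | GRing.scale ?s ?a =>
      let s := sreify ls s in let a := vreify ls lv a in constr:(VScale s a)
  | _ => let n := lindex e lv in constr:(VAtom n)
  end.

Ltac scalar_in e :=
  match e with
  | context [GRing.scale ?s _] => s
  end.

Ltac lmod :=
  intros;
  lazymatch goal with
  | |- @eq ?V ?x ?y =>
    let s := scalar_in (x = y) in
    let R := type of s in
    let ls := vsatoms constr:(@nil R) x in
    let ls := vsatoms ls y in
    let lv := vatoms constr:(@nil V) x in
    let lv := vatoms lv y in
    let e1 := vreify ls lv x in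
    let e2 := vreify ls lv y in
    exact: (@lmod_eq _ _ ls lv e1 e2 isT)
  end.

Ltac ringnc := apply: regular_eq; lmod.

(** * Spans and independence *)

Section Spans.
Variables (K : unitRingType) (dK : division_ring K) (V : lmodType K).
Implicit Types (W : set V) (a b c v w : V) (l m : seq V) (s t r : K).

Lemma vsub0 W : vsubspace W -> W 0.
Proof. by case/vsubspaceP. Qed.

Lemma vsubL W s v w : vsubspace W -> W v -> W w -> W (s *: v + w).
Proof. by case/vsubspaceP => _; exact. Qed.

Lemma vsubD W v w : vsubspace W -> W v -> W w -> W (v + w).
Proof. by move=> sW Wv Ww; rewrite -[v]scale1r; exact: vsubL. Qed.

Lemma vsubZ W s v : vsubspace W -> W v -> W (s *: v).
Proof. by move=> sW Wv; rewrite -[_ *: _]addr0; apply: vsubL => //; exact: vsub0. Qed.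

Lemma vsubN W v : vsubspace W -> W v -> W (- v).
Proof. by move=> sW Wv; rewrite -scaleN1r; exact: vsubZ. Qed.

Lemma vsubB W v w : vsubspace W -> W v -> W w -> W (v - w).
Proof. by move=> sW Wv Ww; apply: vsubD => //; exact: vsubN. Qed.

Lemma vsubDl W v w : vsubspace W -> W w -> W (v + w) -> W v.
Proof. by move=> sW Ww Wvw; rewrite -(addrK w v); exact: vsubB. Qed.

Lemma vsubDr W v w : vsubspace W -> W v -> W (v + w) -> W w.
Proof. by move=> sW Wv; rewrite addrC; exact: vsubDl. Qed.

Lemma mulVx s : s != 0 -> s^-1 * s = 1.
Proof. by move=> /dK; exact: mulVr. Qed.

Lemma mulxV s : s != 0 -> s * s^-1 = 1.
Proof. by move=> /dK; exact: mulrV. Qed.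

Lemma invx_neq0 s : s != 0 -> s^-1 != 0.
Proof.
move=> s0; apply/eqP => i0; have := mulVx s0.
by rewrite i0 mul0r => /eqP; rewrite eq_sym oner_eq0.
Qed.

Lemma mulx_neq0 s t : s != 0 -> t != 0 -> s * t != 0.
Proof.
move=> s0; apply: contra_neq => st.
by rewrite -[t]mul1r -(mulVx s0) -mulrA st mulr0.
Qed.

Lemma mulx_eq1 s t : t != 0 -> s * t = 1 -> s = t^-1.
Proof. by move=> t0 st; rewrite -[LHS]mulr1 -(mulxV t0) mulrA st mul1r. Qed.

Lemma scaleKx s v : s != 0 -> s^-1 *: (s *: v) = v.
Proof. by move=> s0; rewrite scalerA mulVx // scale1r. Qed.

Lemma scalexK s v : s != 0 -> s *: (s^-1 *: v) = v.
Proof. by move=> s0; rewrite scalerA mulxV // scale1r. Qed.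

Lemma scalex_eq0 s v : s *: v = 0 -> v != 0 -> s = 0.
Proof.
move=> sv v0; apply/eqP; apply: contraNT v0 => s0.
by rewrite -(scaleKx v s0) sv scaler0.
Qed.

Lemma vsubZV W s v : vsubspace W -> s != 0 -> W (s *: v) -> W v.
Proof. by move=> sW s0 /(vsubZ s^-1 sW); rewrite scaleKx. Qed.

Lemma scalex_inj v s t : v != 0 -> s *: v = t *: v -> s = t.
Proof.
move=> v0 E; apply: subr0_eq; apply: (scalex_eq0 (v := v)) => //.
by rewrite scalerBl E subrr.
Qed.

(** Membership in the span of [a :: l] is the existence of a coefficient along [a],
    so that exchange is immediate. *)
Fixpoint lspan l : set V :=
  if l is a :: l' then [set v | exists s, lspan l' (v - s *: a)] else [set 0].
Arguments lspan : simpl never.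

Fixpoint lfree l : Prop := if l is a :: l' then ~ lspan l' a /\ lfree l' else True.

Fixpoint contains W l : Prop := if l is a :: l' then W a /\ contains W l' else True.

Lemma lfree_tl a l : lfree (a :: l) -> lfree l.
Proof. by case. Qed.

Lemma lfree_hd a l : lfree (a :: l) -> ~ lspan l a.
Proof. by case. Qed.

Lemma contains_sub W (W' : set V) l : W `<=` W' -> contains W l -> contains W' l.
Proof. by move=> WW'; elim: l => //= a l IH [/WW' ? /IH]. Qed.

Lemma contains_cat W l m : contains W (l ++ m) <-> contains W l /\ contains W m.
Proof. by elim: l => [|a l IH] /=; [tauto|rewrite IH; tauto]. Qed.

Lemma vsubspace_lspan l : vsubspace (lspan l).
Proof.
elim: l => [|a l IH]; apply/vsubspaceP; split => //.
- by move=> s v w -> ->; rewrite scaler0 addr0.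
- by exists 0; rewrite scale0r subrr; exact: vsub0.
- move=> s v w [t vt] [r wr]; exists (s * t + r).
  have -> : s *: v + w - (s * t + r) *: a = s *: (v - t *: a) + (w - r *: a).
    by lmod.
  exact: vsubL.
Qed.
Hint Resolve vsubspace_lspan : core.

Lemma lspan_hd a l : lspan (a :: l) a.
Proof. by exists 1; rewrite scale1r subrr; exact: vsub0. Qed.

Lemma lspan_tl a l v : lspan l v -> lspan (a :: l) v.
Proof. by move=> lv; exists 0; rewrite scale0r subr0. Qed.

Lemma lspan_min l W : vsubspace W -> contains W l -> lspan l `<=` W.
Proof.
move=> sW; elim: l => [_ v ->|a l IH [Wa Wl] v [s vs]]; first exact: vsub0.
by rewrite -(subrK (s *: a) v); apply: vsubD => //; [exact: IH|exact: vsubZ].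
Qed.

Lemma lspan_contains l : contains (lspan l) l.
Proof.
elim: l => //= a l IH; split; first exact: lspan_hd.
by apply: contains_sub IH => v; exact: lspan_tl.
Qed.

Lemma lspan_exchange a l v : lspan (a :: l) v -> ~ lspan l v -> lspan (v :: l) a.
Proof.
move=> [s lvs] nlv; have s0 : s != 0.
  by apply/eqP => s0; apply: nlv; rewrite s0 scale0r subr0 in lvs.
exists s^-1; have -> : a - s^-1 *: v = (- s^-1) *: (v - s *: a).
  by rewrite scalerBr !scaleNr scaleKx // opprK addrC.
exact: vsubZ.
Qed.

(** Steinitz replacement of one vector of [m] by [a], going through [m] until a
    vector is found that is needed to express [a]. *)
Lemma lspan_replace a l m : lspan (l ++ m) a -> ~ lspan l a ->
  exists m', (size m').+1 = size m /\ lspan (l ++ m) `<=` lspan (a :: l ++ m').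
Proof.
elim: m => [|b m IH]; first by rewrite cats0.
move=> lbm nla; have [lma|nlma] := pselect (lspan (l ++ m) a).
  have [m' [sm' sub]] := IH lma nla; exists (b :: m'); rewrite /= sm'; split=> //.
  have /contains_cat[cl [cb cm]] := lspan_contains (l ++ b :: m').
  apply: lspan_min => //; apply/contains_cat; split.
    by apply: contains_sub cl => v; exact: lspan_tl.
  split; first exact: lspan_tl.
  have /contains_cat[_ cm2] : contains (lspan (a :: l ++ m')) (l ++ m).
    by apply: contains_sub (lspan_contains _).
  apply: contains_sub cm2; apply: lspan_min => //; split; first exact: lspan_hd.
  apply/contains_cat; split; first by apply: contains_sub cl => v; exact: lspan_tl.
  by apply: contains_sub cm => v; exact: lspan_tl.
exists m; split=> //; have /contains_cat[cl cm] := lspan_contains (l ++ m).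
have b_in : lspan (a :: l ++ m) b.
  apply: lspan_exchange nlma; apply: lspan_min lbm => //; apply/contains_cat.
  split; first by apply: contains_sub cl => v; exact: lspan_tl.
  split; first exact: lspan_hd.
  by apply: contains_sub cm => v; exact: lspan_tl.
apply: lspan_min => //; apply/contains_cat; split.
  by apply: contains_sub cl => v; exact: lspan_tl.
by split=> //; apply: contains_sub cm => v; exact: lspan_tl.
Qed.

Lemma steinitz l m : lfree l -> contains (lspan m) l ->
  exists m', (size l + size m')%N = size m /\ lspan m `<=` lspan (l ++ m').
Proof.
elim: l => [|a l IH] /=; first by move=> _ _; exists m; split=> // v.
move=> [nla fl] [ma ml]; have [m1 [s1 sub1]] := IH fl ml.
have [m2 [s2 sub2]] := lspan_replace (sub1 _ ma) nla.
exists m2; split; first by rewrite -s1 -s2 addnS.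
exact: subset_trans sub1 sub2.
Qed.

Lemma lfree_size l m : lfree l -> contains (lspan m) l -> (size l <= size m)%N.
Proof. by move=> fl /(steinitz fl)[m' [<- _]]; rewrite leq_addr. Qed.

Lemma not_free_shrink m : ~ lfree m ->
  exists m', (size m' < size m)%N /\ lspan m `<=` lspan m'.
Proof.
elim: m => [|a m IH] //= nf; have [ma|nma] := pselect (lspan m a).
  exists m; split=> //; apply: lspan_min => //; split=> //; exact: lspan_contains.
have [m' [sm' sub]] : exists m', (size m' < size m)%N /\ lspan m `<=` lspan m'.
  by apply: IH => fm; apply: nf.
exists (a :: m'); split=> //; apply: lspan_min => //; split; first exact: lspan_hd.
apply: contains_sub (lspan_contains m) => v /sub; exact: lspan_tl.
Qed.

Lemma lfree_span l m : lfree l -> contains (lspan m) l -> (size m <= size l)%N ->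
  lspan m `<=` lspan l.
Proof.
move=> fl lm; have [[|b m'] [<- sub]] := steinitz fl lm.
  by rewrite cats0 in sub.
by rewrite /= addnS ltnNge leq_addr.
Qed.

(** The usual way below to show that vectors are independent: they generate a
    space containing as many vectors known to be independent. *)
Lemma lfree_gen l m : lfree l -> contains (lspan m) l -> (size m <= size l)%N -> lfree m.
Proof.
move=> fl lm sml; apply: contrapT => /not_free_shrink[m' [sm' sub]].
have := lfree_size fl (contains_sub sub lm).
by rewrite leqNgt (leq_trans sm' sml).
Qed.

Lemma lspan1P a v : lspan [:: a] v <-> exists s, v = s *: a.
Proof. by split=> -[s E]; exists s; [exact: subr0_eq|rewrite E /lspan /= subrr]. Qed.

Lemma lspan2P a b v : lspan [:: a; b] v <-> exists s t, v = s *: a + t *: b.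
Proof.
split=> [[s [t E]]|[s [t ->]]]; exists s, t.
  by apply: (lincomb E); lmod.
by rewrite /lspan /=; lmod.
Qed.

Lemma lspan3P a b c v :
  lspan [:: a; b; c] v <-> exists s t r, v = s *: a + t *: b + r *: c.
Proof.
split=> [[s [t [r E]]]|[s [t [r ->]]]]; exists s, t, r.
  by apply: (lincomb E); lmod.
by rewrite /lspan /=; lmod.
Qed.

Lemma lfree1P a : lfree [:: a] <-> a != 0.
Proof. by split=> [[/eqP]|/eqP]. Qed.

Lemma lfree2_coef a b s t :
  lfree [:: a; b] -> s *: a + t *: b = 0 -> s = 0 /\ t = 0.
Proof.
move=> [nab [/eqP b0 _]] E; have s0 : s = 0.
  apply/eqP; apply: contra_notT nab => s0; apply/lspan1P.
  exists (- (s^-1 * t)); apply: (lincomb (z := s^-1 *: (s *: a + t *: b))).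
    by rewrite E scaler0.
  by rewrite scalerDr scaleKx // scaleNr opprK scalerA.
by split=> //; move: E; rewrite s0 scale0r add0r => /scalex_eq0; exact.
Qed.

Lemma lfree3_coef a b c s t r : lfree [:: a; b; c] ->
  s *: a + t *: b + r *: c = 0 -> [/\ s = 0, t = 0 & r = 0].
Proof.
move=> [nabc fbc] E; have s0 : s = 0.
  apply/eqP; apply: contra_notT nabc => s0; apply/lspan2P.
  exists (- (s^-1 * t)), (- (s^-1 * r)).
  apply: (lincomb (z := s^-1 *: (s *: a + t *: b + r *: c))).
    by rewrite E scaler0.
  by rewrite !scalerDr scaleKx //; lmod.
by move: E; rewrite s0 scale0r add0r => /(lfree2_coef fbc)[].
Qed.

End Spans.
#[global] Hint Resolve vsubspace_lspan : core.
#[global] Arguments lspan {K V} l : simpl never.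

Ltac in_span := first [ apply: lspan_hd | apply: lspan_tl; in_span ].

(** * Points and lines of a projective space *)

Section LinearConfigurations.
Variables (K : unitRingType) (dK : division_ring K) (V : lmodType K).
Implicit Types (a b c u v w x y : V) (s t r : K).

Lemma lspan1Z a s : lspan [:: a] (s *: a).
Proof. by apply/lspan1P; exists s. Qed.

Lemma lspan2I a b v s t : v = s *: a + t *: b -> lspan [:: a; b] v.
Proof. by move=> ->; apply/lspan2P; exists s, t. Qed.

Lemma lspan3I a b c v s t r : v = s *: a + t *: b + r *: c -> lspan [:: a; b; c] v.
Proof. by move=> ->; apply/lspan3P; exists s, t, r. Qed.

(** If [x] and [y] were independent, they would span both lines. *)
Lemma lspan_meet a b c d x y : ~ lspan [:: a; b] c -> x != 0 ->
  lspan [:: a; b] x -> lspan [:: c; d] x ->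
  lspan [:: a; b] y -> lspan [:: c; d] y -> lspan [:: x] y.
Proof.
move=> nc x0 abx cdx aby cdy; apply: contrapT => nxy; apply: nc.
have fyx : lfree [:: y; x] by split=> //; apply/lfree1P.
have cd : contains (lspan [:: c; d]) [:: y; x] by [].
have := lfree_span dK fyx cd isT (lspan_hd c [:: d]).
by apply: lspan_min.
Qed.

Lemma lspan1_sym a b : b != 0 -> lspan [:: a] b -> lspan [:: b] a.
Proof.
move=> b0 /lspan1P[s bs]; apply/lspan1P; exists s^-1; rewrite bs scaleKx //.
by apply: contra_neq b0 => s0; rewrite bs s0 scale0r.
Qed.

(** Both vectors may be zero: the relation then says that two partial maps are
    undefined at the same place. *)
Definition same_line a b := lspan [:: a] b /\ lspan [:: b] a.

Lemma same_line_refl a : same_line a a.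
Proof. by split; exact: lspan_hd. Qed.

Lemma same_line_sym a b : same_line a b -> same_line b a.
Proof. by case. Qed.

Lemma same_line_trans b a c : same_line a b -> same_line b c -> same_line a c.
Proof.
move=> [ab ba] [bc cb]; split.
  by apply: (lspan_min _ _ bc) => //; split.
by apply: (lspan_min _ _ ba) => //; split.
Qed.

Lemma same_lineZ s a : s != 0 -> same_line (s *: a) a.
Proof.
move=> s0; split; last exact: lspan1Z.
by apply/lspan1P; exists s^-1; rewrite scaleKx.
Qed.

Lemma same_lineP a b : a != 0 -> same_line a b -> exists2 s, s != 0 & a = s *: b.
Proof.
move=> a0 [_ /lspan1P[s E]]; exists s => //.
by apply: contra_neq a0 => s0; rewrite E s0 scale0r.
Qed.

Lemma hyperplane_functional (W : set V) a : vsubspace W -> ~ W a ->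
  (forall v, exists s, W (v - s *: a)) ->
  exists g : V -> K, [/\ forall v, W (v - g v *: a),
    forall u v, g (u + v) = g u + g v, forall s v, g (s *: v) = s * g v &
    forall v s, W (v - s *: a) -> g v = s].
Proof.
move=> sW Wa /choice[g gP].
have uniq v s t : W (v - s *: a) -> W (v - t *: a) -> s = t.
  move=> Ws Wt; apply: subr0_eq; apply/eqP; apply: contrapT => /negP st.
  apply: Wa; apply: (vsubZV dK sW st).
  have -> : (s - t) *: a = (v - t *: a) - (v - s *: a) by lmod.
  exact: vsubB.
exists g; split=> // [u v|s v|v s Ws]; apply: uniq (gP _) _ => //.
  have -> : u + v - (g u + g v) *: a = (u - g u *: a) + (v - g v *: a) by lmod.
  exact: vsubD.
have -> : s *: v - (s * g v) *: a = s *: (v - g v *: a) by lmod.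
exact: vsubZ.
Qed.

(** Converse of Desargues: triangles in perspective from an axis are in
    perspective from a point.  With [C01 = a0 A0 + a1 A1 = b0 B0 + b1 B1], the
    centre is [a0 A0 - b0 B0 = - (a1 A1 - b1 B1)]; the collinearity of the three
    points of the axis puts it also on the third line. *)
Lemma desargues A0 A1 A2 B0 B1 B2 C01 C12 C02 :
  lfree [:: A0; A1; A2] -> lfree [:: B0; B1; B2] -> lfree [:: A0; B0] ->
  lspan [:: A0; A1] C01 -> lspan [:: B0; B1] C01 ->
  lspan [:: A1; A2] C12 -> lspan [:: B1; B2] C12 ->
  lspan [:: A0; A2] C02 -> lspan [:: B0; B2] C02 ->
  lspan [:: C01; C12] C02 ->
  ~ lspan [:: A1] C01 -> ~ lspan [:: A2] C12 -> C02 != 0 ->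
  exists x, [/\ x != 0, lspan [:: A0; B0] x, lspan [:: A1; B1] x
    & lspan [:: A2; B2] x].
Proof.
move=> fA fB fAB0 /lspan2P[a0 [a1 A01]] /lspan2P[b0 [b1 B01]].
move=> /lspan2P[a1' [a2 A12]] /lspan2P[b1' [b2 B12]].
move=> /lspan2P[p0 [p2 A02]] /lspan2P[q0 [q2 B02]] /lspan2P[s [t Cst]].
move=> nC01 nC12 C02n0.
have [_ sa _] : [/\ s * a0 - p0 = 0, s * a1 + t * a1' = 0 & t * a2 - p2 = 0].
  apply: (lfree3_coef dK fA); transitivity (C02 - C02); last by rewrite subrr.
  by rewrite {1}Cst A01 A12 A02; lmod.
have [_ sb _] : [/\ s * b0 - q0 = 0, s * b1 + t * b1' = 0 & t * b2 - q2 = 0].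
  apply: (lfree3_coef dK fB); transitivity (C02 - C02); last by rewrite subrr.
  by rewrite {1}Cst B01 B12 B02; lmod.
have a0n : a0 != 0.
  by apply/eqP => a00; apply: nC01; rewrite A01 a00 scale0r add0r; exact: lspan1Z.
have a1n' : a1' != 0.
  by apply/eqP => a10; apply: nC12; rewrite A12 a10 scale0r add0r; exact: lspan1Z.
have sn : s != 0.
  apply/eqP => s0; move: sa; rewrite s0 mul0r add0r => ta.
  have t0 : t = 0 by apply/eqP; apply: contraT => tn; have := mulx_neq0 dK tn a1n'; rewrite ta eqxx.
  by move: C02n0; rewrite Cst s0 t0 !scale0r addr0 eqxx.
have E1 : a0 *: A0 - b0 *: B0 = b1 *: B1 - a1 *: A1.
  by apply: (lincomb (z := C01 - C01)); [rewrite subrr|rewrite {1}A01 B01; lmod].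
have E2 : b1' *: B1 - a1' *: A1 = a2 *: A2 - b2 *: B2.
  apply: (lincomb (z := C12 - C12)); first by rewrite subrr.
  by rewrite {1}B12 A12; lmod.
exists (a0 *: A0 - b0 *: B0); split.
- apply/eqP => E; have [/eqP] : a0 = 0 /\ - b0 = 0.
    by apply: (lfree2_coef dK fAB0); rewrite scaleNr.
  by rewrite (negbTE a0n).
- by apply: (lspan2I (s := a0) (t := - b0)); lmod.
- by rewrite E1; apply: (lspan2I (s := - a1) (t := b1)); lmod.
- apply: (vsubZV dK (s := s)) => //.
  apply: (lspan2I (s := - t * a2) (t := t * b2)).
  rewrite E1; apply: (lincomb (z := (s * b1 + t * b1') *: B1 -
     (s * a1 + t * a1') *: A1 - t *: ((b1' *: B1 - a1' *: A1) - (a2 *: A2 - b2 *: B2)))).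
    by rewrite sa sb E2 subrr !scale0r scaler0 !subr0.
  by lmod.
Qed.

End LinearConfigurations.

(** * A map defined off a hyperplane *)

Section AffinoProjective.
Variables (K K' : unitRingType) (dK : division_ring K) (dK' : division_ring K').
Variables (V : lmodType K) (V' : lmodType K') (H Y : set V) (F : V -> V').
Hypothesis sH : vsubspace H.
Hypothesis Hmax : forall o, ~ H o -> forall v, exists t, H (v - t *: o).
Hypothesis YH : ~` H `<=` Y.
Hypothesis mor : forall W' : set V', vsubspace W' ->
  exists2 W : set V, vsubspace W & forall v, Y v -> (W' (F v) <-> W v).

(** The preimage of the span of the images is a subspace containing [l]. *)
Lemma F_lspan l v : Y v -> contains Y l -> lspan l v -> lspan (map F l) (F v).
Proof.
move=> Yv Yl lv; have [W sW FW] := mor (vsubspace_lspan (map F l)).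
apply/FW => //; apply: (lspan_min sW) lv.
have : contains (lspan (map F l)) (map F l) by exact: lspan_contains.
elim: l Yl (lspan _) FW => //= a l IH [Ya Yl] W' FW [/FW Wa Wl].
by split; [exact: Wa|exact: (IH Yl W')].
Qed.

Section Origin.
Variable o : V.
Hypothesis Ho : ~ H o.
Hypothesis Fo : F o != 0.

(** The vectors outside [H] are, up to scalars, those of the affine space [o + H]. *)
Definition img (h : V) : V' := F (o + h).

Lemma notH s h : s != 0 -> H h -> ~ H (s *: o + h).
Proof. by move=> s0 Hh /(vsubDl sH Hh) /(vsubZV dK sH s0). Qed.

Lemma notHo h : H h -> ~ H (o + h).
Proof. by move=> Hh /(vsubDl sH Hh). Qed.

Lemma Yo h : H h -> Y (o + h).
Proof. by move=> /notHo /YH. Qed.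

Lemma img0 : img 0 = F o.
Proof. by rewrite /img addr0. Qed.

Lemma img_line a b t h : H a -> H b -> h = a + t *: (b - a) ->
  lspan [:: img a; img b] (img h).
Proof.
move=> Ha Hb ->; have Hh : H (a + t *: (b - a)).
  by apply: (vsubD sH) => //; apply: (vsubZ _ sH); exact: (vsubB sH).
apply: (F_lspan (l := [:: o + a; o + b]) (Yo Hh)).
  by split; [exact: Yo|split=> //; exact: Yo].
by apply: (lspan2I (s := 1 - t) (t := t)); lmod.
Qed.

Lemma img_plane a b c t r h : H a -> H b -> H c ->
  h = a + t *: (b - a) + r *: (c - a) -> lspan [:: img a; img b; img c] (img h).
Proof.
move=> Ha Hb Hc ->; have Hh : H (a + t *: (b - a) + r *: (c - a)).
  by apply: (vsubD sH); [apply: (vsubD sH) => //|]; apply: (vsubZ _ sH); exact: (vsubB sH).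
apply: (F_lspan (l := [:: o + a; o + b; o + c]) (Yo Hh)).
  by split; [exact: Yo|split; [exact: Yo|split=> //; exact: Yo]].
by apply: (lspan3I (s := 1 - t - r) (t := t) (r := r)); lmod.
Qed.

(** A subspace containing [o] meets [o + H] in the translate of its directions. *)
Lemma affine_preimage (W' : set V') : vsubspace W' -> W' (F o) ->
  exists2 W : set V, vsubspace W & forall h, H h -> (W' (img h) <-> W h).
Proof.
move=> sW' W'o; have [W sW FW] := mor sW'; exists W => // h Hh.
have Wo : W o by apply/FW => //; exact: YH.
rewrite /img FW; last exact: Yo.
by split=> [/(vsubDr sW Wo)|Wh]; last exact: (vsubD sW).
Qed.

Lemma img_on_line e d r : H e -> H d -> lspan [:: img e; img (e + d)] (img (e + r *: d)).
Proof.
move=> He Hd; apply: (img_line (t := r)) => //; first exact: (vsubD sH).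
by lmod.
Qed.

Lemma img_line_gen e d s r : H e -> H d -> s != 0 ->
  lspan [:: img e; img (e + s *: d)] (img (e + r *: d)).
Proof.
move=> He Hd s0; apply: (img_line (t := r * s^-1)) => //.
  by apply: (vsubD sH) => //; exact: (vsubZ _ sH).
by rewrite [e + s *: d]addrC addrK scalerA -mulrA (mulVx dK) ?mulr1.
Qed.

Lemma img_line_gen2 e d s s' r : H e -> H d -> s != s' ->
  lspan [:: img (e + s *: d); img (e + s' *: d)] (img (e + r *: d)).
Proof.
move=> He Hd ss'; have s0 : s' - s != 0 by rewrite subr_eq0 eq_sym.
have Hs x : H (e + x *: d) by apply: (vsubD sH) => //; exact: (vsubZ _ sH).
apply: (img_line (t := (r - s) * (s' - s)^-1)) => //.
have -> : e + s' *: d - (e + s *: d) = (s' - s) *: d by lmod.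
by rewrite scalerA -mulrA (mulVx dK) // mulr1; lmod.
Qed.

(** A parallelogram: the lines through [e] and [f] in direction [d] are
    coplanar, so three points of the two lines span them both. *)
Lemma img_parallel e f d : H e -> H f -> H d ->
  lspan [:: img e; img (e + d); img f] (img (f + d)).
Proof.
move=> He Hf Hd; apply: (img_plane (t := 1) (r := 1)) => //; first exact: (vsubD sH).
by lmod.
Qed.

(** The three points on the right generate the same affine plane, and vectors that
    span a space of dimension three are independent when there are three of them. *)
Lemma img_skew e d f s r : H e -> H d -> H f -> s != 0 ->
  lfree [:: img e; img (e + d); img f] -> lfree [:: img e; img (e + s *: d); img (f + r *: d)].
Proof.
move=> He Hd Hf s0 fr; have Hs x : H (e + x *: d).
  by apply: (vsubD sH) => //; exact: (vsubZ _ sH).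
have Hr : H (f + r *: d) by apply: (vsubD sH) => //; exact: (vsubZ _ sH).
apply: (lfree_gen dK' fr) => //; split; first exact: lspan_hd.
split.
  apply: (img_plane (t := s^-1) (r := 0)) => //.
  by rewrite [e + s *: d]addrC addrK scaleKx // scale0r addr0.
split=> //; apply: (img_plane (t := - r * s^-1) (r := 1)) => //.
rewrite [e + s *: d]addrC addrK scalerA -mulrA (mulVx dK) // mulr1.
by lmod.
Qed.

(** The parallel through [f] spans the same plane together with [e]. *)
Lemma img_skew_parallel e d f : H e -> H d -> H f ->
  lfree [:: img e; img (e + d); img f] -> lfree [:: img e; img f; img (f + d)].
Proof.
move=> He Hd Hf fr; apply: (lfree_gen dK' fr) => //; split; first by in_span.
split; last by split=> //; in_span.
apply: (img_plane (a := e) (b := f) (c := f + d) (t := - 1) (r := 1)) => //.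
  exact: (vsubD sH).
by lmod.
Qed.

(** * Parallel lines have concurrent images *)

(** The point where a side of the triangle [o + e_i] meets the corresponding side
    of the moved triangle: the multiples [z (o + e)] and [z' (o + f)] are moved by
    the same multiple of [d], so their difference does not change. *)
Definition axis_point e f (z z' : K) : V' := F (z *: (o + e) - z' *: (o + f)).

Lemma axis_pointP e f d z z' s s' : H e -> H f -> H d ->
  z != 0 -> z' != 0 -> z != z' -> z * s = z' * s' ->
  [/\ lspan [:: img (e + s *: d); img (f + s' *: d)] (axis_point e f z z'),
      lspan [:: axis_point e f z z'; img (f + s' *: d)] (img (e + s *: d)) &
      lspan [:: axis_point e f z z'; img (e + s *: d)] (img (f + s' *: d))].
Proof.
move=> He Hf Hd z0 z0' zz' zs.
have Hs g x : H g -> Y (o + (g + x *: d)).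
  by move=> Hg; apply: Yo; apply: (vsubD sH) => //; exact: (vsubZ _ sH).
have YC : Y (z *: (o + e) - z' *: (o + f)).
  apply: YH; have -> : z *: (o + e) - z' *: (o + f) =
    (z - z') *: o + (z *: e - z' *: f) by lmod.
  apply: notH; first by rewrite subr_eq0.
  by apply: (vsubB sH); exact: (vsubZ _ sH).
have E : z *: (o + e) - z' *: (o + f) =
    z *: (o + (e + s *: d)) - z' *: (o + (f + s' *: d)).
  by apply: (lincomb (z := (z' * s' - z * s) *: d));
    [rewrite zs subrr scale0r|lmod].
split.
- apply: (F_lspan (l := [:: o + (e + s *: d); o + (f + s' *: d)])) => //.
    by split; [exact: Hs|split=> //; exact: Hs].
  by rewrite E; apply: (lspan2I (s := z) (t := - z')); lmod.
- apply: (F_lspan (l := [:: z *: (o + e) - z' *: (o + f); o + (f + s' *: d)])).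
  + exact: Hs.
  + by split=> //; split=> //; exact: Hs.
  + apply: (lspan2I (s := z^-1) (t := z^-1 * z')); rewrite E.
    rewrite -[LHS](scaleKx dK _ z0); lmod.
- apply: (F_lspan (l := [:: z *: (o + e) - z' *: (o + f); o + (e + s *: d)])).
  + exact: Hs.
  + by split=> //; split=> //; exact: Hs.
  + apply: (lspan2I (s := - z'^-1) (t := z'^-1 * z)); rewrite E.
    rewrite -[LHS](scaleKx dK _ z0'); lmod.
Qed.

Section Desargues.
Variables (d e0 e1 e2 : V) (z0 z1 z2 : K).
Hypotheses (Hd : H d) (He0 : H e0) (He1 : H e1) (He2 : H e2).
Hypotheses (z0n : z0 != 0) (z1n : z1 != 0) (z2n : z2 != 0).
Hypotheses (z01 : z0 != z1) (z02 : z0 != z2) (z12 : z1 != z2).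
Hypothesis f01 : lfree [:: img e0; img (e0 + d); img e1].
Hypothesis f12 : lfree [:: img e1; img (e1 + d); img e2].
Hypothesis fB : lfree [:: img e0; img e1; img e2].

Let A0 t := img (e0 + (z0^-1 * t) *: d).
Let A1 t := img (e1 + (z1^-1 * t) *: d).
Let A2 t := img (e2 + (z2^-1 * t) *: d).
Let C01 := axis_point e0 e1 z0 z1.
Let C12 := axis_point e1 e2 z1 z2.
Let C02 := axis_point e0 e2 z0 z2.

Let pointA e f (z z' t : K) (He : H e) (Hf : H f) (zn : z != 0) (zn' : z' != 0)
    (zz' : z != z') :
  [/\ lspan [:: img (e + (z^-1 * t) *: d); img (f + (z'^-1 * t) *: d)]
        (axis_point e f z z'),
      lspan [:: axis_point e f z z'; img (f + (z'^-1 * t) *: d)]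
        (img (e + (z^-1 * t) *: d)) &
      lspan [:: axis_point e f z z'; img (e + (z^-1 * t) *: d)]
        (img (f + (z'^-1 * t) *: d))].
Proof. by apply: axis_pointP => //; rewrite !mulrA !mulxV. Qed.

Let pointB e f (z z' : K) (He : H e) (Hf : H f) (zn : z != 0) (zn' : z' != 0)
    (zz' : z != z') :
  [/\ lspan [:: img e; img f] (axis_point e f z z'),
      lspan [:: axis_point e f z z'; img f] (img e) &
      lspan [:: axis_point e f z z'; img e] (img f)].
Proof.
have := @axis_pointP e f d z z' 0 0 He Hf Hd zn zn' zz'.
by rewrite !mulr0 !scale0r !addr0; exact.
Qed.

(** Each side of the first triangle is determined by [img e1] and a point of the
    axis, so the axis is a line that avoids [img e1]. *)
Lemma axis_free : lfree [:: img e1; C01; C12].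
Proof.
have [_ C0 _] := pointB He0 He1 z0n z1n z01.
have [_ _ C2] := pointB He1 He2 z1n z2n z12.
apply: (lfree_gen dK' fB) => //; split.
  by apply: (lspan_min _ _ C0) => //; split; [in_span|split=> //; in_span].
split; first by in_span.
by split=> //; apply: (lspan_min _ _ C2) => //; split; [in_span|split=> //; in_span].
Qed.

(** If the moved triangle is degenerate, its line contains two distinct points of the
    axis, hence is the axis. *)
Lemma moved_collinear (t : K) : t != 0 -> ~ lfree [:: A0 t; A1 t; A2 t] ->
  lspan [:: C01; C12] (A0 t) /\ lspan [:: C01; C12] (A1 t).
Proof.
move=> t0 nf; have s0 (z : K) : z != 0 -> z^-1 * t != 0.
  by move=> zn; apply: mulx_neq0 => //; exact: (invx_neq0 dK).
have fA12 : lfree [:: A1 t; A2 t].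
  exact: (lfree_tl (img_skew (z2^-1 * t) He1 Hd He2 (s0 _ z1n) f12)).
have A0in : lspan [:: A1 t; A2 t] (A0 t) by apply: contrapT => nA0; apply: nf.
have [C01in _ _] := pointA t He0 He1 z0n z1n z01.
have [C12in _ _] := pointA t He1 He2 z1n z2n z12.
have sub : lspan [:: A1 t; A2 t] `<=` lspan [:: C01; C12].
  have fC := lfree_tl axis_free.
  have cC : contains (lspan [:: A1 t; A2 t]) [:: C01; C12].
    split; last by split.
    by apply: (lspan_min _ _ C01in) => //; split=> //; split=> //; in_span.
  exact: (lfree_span dK' fC cC isT).
by split; apply: sub => //; in_span.
Qed.

(** If the triangles for [t = 1] and [t = k] were both degenerate, the axis would carry
    two points of each of the first two parallels, hence both of them. *)
Lemma moved_free (k : K) : k != 0 -> k != 1 -> exists2 t, t != 0 &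
  lfree [:: A0 t; A1 t; A2 t].
Proof.
move=> k0 k1; apply: contrapT => nt.
have [|A01 A11] := @moved_collinear 1 (oner_neq0 _).
  by move=> f1; apply: nt; exists 1 => //; exact: oner_neq0.
have [|A0k A1k] := @moved_collinear k k0; first by move=> fk; apply: nt; exists k.
have neq (z : K) : z != 0 -> z^-1 * 1 != z^-1 * k.
  move=> zn; apply: contra_neq k1 => E.
  by rewrite -[k]mul1r -(mulxV dK zn) -mulrA -E mulr1 mulxV.
have in_axis e (z : K) : z != 0 -> H e -> lspan [:: C01; C12] (img (e + (z^-1 * 1) *: d)) ->
    lspan [:: C01; C12] (img (e + (z^-1 * k) *: d)) ->
    forall r, lspan [:: C01; C12] (img (e + r *: d)).
  move=> zn He L1 Lk r.
  by apply: (lspan_min _ _ (img_line_gen2 r He Hd (neq z zn))).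
have c : contains (lspan [:: C01; C12]) [:: img e0; img (e0 + d); img e1].
  split; first by have := in_axis e0 z0 z0n He0 A01 A0k 0; rewrite scale0r addr0.
  split; first by have := in_axis e0 z0 z0n He0 A01 A0k 1; rewrite scale1r.
  by split=> //; have := in_axis e1 z1 z1n He1 A11 A1k 0; rewrite scale0r addr0.
by have := lfree_size dK' f01 c.
Qed.

(** The triangles [img e_i] and [A_i t] have their vertices on the three parallels
    and their sides meet on the axis. *)
Lemma desargues_concurrent (k : K) : k != 0 -> k != 1 ->
  exists x, [/\ x != 0, lspan [:: img e0; img (e0 + d)] x,
    lspan [:: img e1; img (e1 + d)] x & lspan [:: img e2; img (e2 + d)] x].
Proof.
move=> k0 k1; have [t t0 fA] := moved_free k0 k1.
have [A01 A01a A01b] := pointA t He0 He1 z0n z1n z01.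
have [A12 A12a _] := pointA t He1 He2 z1n z2n z12.
have [A02 A02a _] := pointA t He0 He2 z0n z2n z02.
have [B01 _ _] := pointB He0 He1 z0n z1n z01.
have [B12 _ _] := pointB He1 He2 z1n z2n z12.
have [B02 _ _] := pointB He0 He2 z0n z2n z02.
have s0 : z0^-1 * t != 0 by apply: mulx_neq0 => //; exact: (invx_neq0 dK).
have fAB : lfree [:: A0 t; img e0].
  have f := img_skew 0 He0 Hd He1 s0 f01; rewrite scale0r addr0 in f.
  apply: (lfree_tl (a := img e1)); apply: (lfree_gen dK' f) => //.
  by split; [in_span|split; [in_span|split=> //; in_span]].
have Cin : lspan [:: C01; C12] C02.
  have notHC e f z z' : H e -> H f -> z != z' ->
      Y (z *: (o + e) - z' *: (o + f)).
    move=> He Hf zz'; apply: YH.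
    have -> : z *: (o + e) - z' *: (o + f) =
      (z - z') *: o + (z *: e - z' *: f) by lmod.
    apply: notH; first by rewrite subr_eq0.
    by apply: (vsubB sH); exact: (vsubZ _ sH).
  apply: (F_lspan (l := [:: z0 *: (o + e0) - z1 *: (o + e1);
    z1 *: (o + e1) - z2 *: (o + e2)])).
  + exact: notHC.
  + by split; [exact: notHC|split=> //; exact: notHC].
  + by apply: (lspan2I (s := 1) (t := 1)); lmod.
have fA0 := lfree_hd fA; have fA1 := lfree_hd (lfree_tl fA).
have nC : C02 != 0.
  apply/eqP => C0; apply: fA0.
  apply: (lspan_min _ _ A02a) => //; rewrite -/C02 C0.
  by split; [exact: vsub0|split=> //; in_span].
have nC01 : ~ lspan [:: A1 t] C01.
  move=> C1; apply: fA0; apply: (lspan_min _ _ A01a) => //.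
  by split; [apply: (lspan_min _ _ C1) => //; split=> //; in_span|split=> //; in_span].
have nC12 : ~ lspan [:: A2 t] C12.
  move=> C1; apply: fA1; apply: (lspan_min _ _ A12a) => //.
  by split=> //; split=> //; in_span.
have [x [x0 x1 x2 x3]] :=
  desargues dK' fA fB fAB A01 B01 A12 B12 A02 B02 Cin nC01 nC12 nC.
have on_line e s : H e -> lspan [:: img (e + s *: d); img e] x ->
    lspan [:: img e; img (e + d)] x.
  move=> He; apply: lspan_min => //.
  by split; [exact: img_on_line|split=> //; in_span].
by exists x; split=> //; [move: x1|move: x2|move: x3]; exact: on_line.
Qed.
End Desargues.

(** Sliding the three points [e_i] along their lines makes their images
    independent: otherwise the third line would be the line joining the first
    point to each point of the second line. *)
Lemma free_transversal d e0 e1 e2 : H d -> H e0 -> H e1 -> H e2 ->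
  lfree [:: img e0; img (e0 + d); img e1] -> lfree [:: img e1; img (e1 + d); img e2] ->
  exists r s, lfree [:: img e0; img (e1 + r *: d); img (e2 + s *: d)].
Proof.
move=> Hd He0 He1 He2 f01 f12; apply: contrapT => nf.
have f01r r : lfree [:: img e0; img (e1 + r *: d)].
  have f := img_skew r He0 Hd He1 (oner_neq0 _) f01.
  apply: (lfree_tl (a := img (e0 + 1 *: d))); apply: (lfree_gen dK' f) => //.
  by split; [in_span|split; [in_span|split=> //; in_span]].
have in01 r s : lspan [:: img e0; img (e1 + r *: d)] (img (e2 + s *: d)).
  apply: contrapT => ns; apply: nf; exists r, s.
  apply: (lfree_gen dK' (l := [:: img (e2 + s *: d); img e0; img (e1 + r *: d)])) => //.
  by split; [in_span|split; [in_span|split=> //; in_span]].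
have f2 : lfree [:: img e2; img (e2 + d)].
  exact: lfree_tl (img_skew_parallel He1 Hd He2 f12).
have in2 r : lspan [:: img e2; img (e2 + d)] (img (e1 + r *: d)).
  have c : contains (lspan [:: img e0; img (e1 + r *: d)]) [:: img e2; img (e2 + d)].
    split; first by have := in01 r 0; rewrite scale0r addr0.
    by split=> //; have := in01 r 1; rewrite scale1r.
  by apply: (lfree_span dK' f2 c isT); in_span.
have c : contains (lspan [:: img e2; img (e2 + d)]) [:: img e1; img (e1 + d); img e2].
  split; first by have := in2 0; rewrite scale0r addr0.
  by split; [have := in2 1; rewrite scale1r|split=> //; in_span].
by have := lfree_size dK' f12 c.
Qed.

Lemma three_lines_concurrent (z0 z1 z2 : K) d e0 e1 e2 :
  z0 != 0 -> z1 != 0 -> z2 != 0 -> z0 != z1 -> z0 != z2 -> z1 != z2 ->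
  H d -> H e0 -> H e1 -> H e2 ->
  lfree [:: img e0; img (e0 + d); img e1] -> lfree [:: img e1; img (e1 + d); img e2] ->
  exists x, [/\ x != 0, lspan [:: img e0; img (e0 + d)] x,
    lspan [:: img e1; img (e1 + d)] x & lspan [:: img e2; img (e2 + d)] x].
Proof.
move=> z0n z1n z2n z01 z02 z12 Hd He0 He1 He2 f01 f12.
have [r [s fB]] := free_transversal Hd He0 He1 He2 f01 f12.
have Hsum e t : H e -> H (e + t *: d).
  by move=> He; apply: (vsubD sH) => //; exact: (vsubZ _ sH).
have f01' : lfree [:: img e0; img (e0 + d); img (e1 + r *: d)].
  by have := img_skew r He0 Hd He1 (oner_neq0 _) f01; rewrite scale1r.
have f12' : lfree [:: img (e1 + r *: d); img (e1 + r *: d + d); img (e2 + s *: d)].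
  apply: (lfree_gen dK' f12) => //; split.
    apply: (img_plane (t := - r) (r := 0)) => //; try exact: Hsum.
      by apply: (vsubD sH) => //; exact: Hsum.
    by lmod.
  split.
    apply: (img_plane (t := 1 - r) (r := 0)) => //; try exact: Hsum.
      by apply: (vsubD sH) => //; exact: Hsum.
    by lmod.
  split=> //; apply: (img_plane (t := - s) (r := 1)) => //; try exact: Hsum.
    by apply: (vsubD sH) => //; exact: Hsum.
  by lmod.
have [k k0 k1] : exists2 k : K, k != 0 & k != 1.
  by case: (eqVneq z0 1) => [z01'|]; [exists z1; rewrite // -z01' eq_sym|exists z0].
have on_line e t x : H e -> lspan [:: img (e + t *: d); img (e + t *: d + d)] x ->
    lspan [:: img e; img (e + d)] x.
  move=> He; apply: lspan_min => //; split; first exact: img_on_line.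
  split=> //; have -> : e + t *: d + d = e + (t + 1) *: d by lmod.
  exact: img_on_line.
have [x [x0 x1 x2 x3]] := desargues_concurrent Hd He0 (Hsum _ _ He1) (Hsum _ _ He2)
  z0n z1n z2n z01 z02 z12 f01' f12' fB k0 k1.
by exists x; split=> //; [move: x2|move: x3]; exact: on_line.
Qed.

(** A point of a line other than a given one has a representative with first
    coordinate one. *)
Lemma lspan_normalize (u v w : V') : lspan [:: u; v] w -> ~ lspan [:: v] w ->
  exists c, lspan [:: w] (u + c *: v) /\ lspan [:: u + c *: v] w.
Proof.
move=> /lspan2P[s [t E]] nw; have s0 : s != 0.
  by apply/eqP => s0; apply: nw; rewrite E s0 scale0r add0r; exact: lspan1Z.
have E' : w = s *: (u + (s^-1 * t) *: v).
  by rewrite E scalerDr scalerA mulrA mulxV // mul1r.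
exists (s^-1 * t); split; last by rewrite {1}E'; exact: lspan1Z.
by apply/lspan1P; exists s^-1; rewrite [in RHS]E' scaleKx.
Qed.

Section CharacteristicThree.
Hypotheses (K3 : 1 + 1 + 1 = 0 :> K) (K3' : 1 + 1 + 1 = 0 :> K').

(** In characteristic three the three points [o - d], [o], [o + d] of a line have
    representatives with sum zero, and the point at infinity is the difference of
    two of these. *)
Lemma opposite_lift d : H d -> ~ lspan [:: F o] (img d) ->
  exists p, [/\ lspan [:: img d] p, lspan [:: p] (img d),
    lspan [:: img (- d)] (F o + p) & lspan [:: F o + p] (img (- d))].
Proof.
move=> Hd nd; have HNd : H (- d) by exact: (vsubN sH).
have H0 : H 0 by exact: (vsub0 sH).
have on : lspan [:: F o; img d] (img (- d)).
  by rewrite -img0; apply: (img_line (t := - 1)) => //; lmod.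
have o_in : lspan [:: img (- d); img d] (F o).
  rewrite -img0; apply: (img_line (t := - 1)) => //.
  by apply: (lincomb (z := (1 + 1 + 1) *: d)); [rewrite K3 scale0r|lmod].
have d_in : lspan [:: F o; img (- d)] (img d).
  by rewrite -img0; apply: (img_line (t := - 1)) => //; lmod.
have n1 : ~ lspan [:: img d] (img (- d)).
  move=> L; apply: nd; apply: (lspan1_sym dK' Fo).
  by apply: (lspan_min _ _ o_in) => //; split=> //; split=> //; in_span.
have [c [c1 c2]] := lspan_normalize on n1.
exists (c *: img d); split=> //; first exact: lspan1Z.
apply/lspan1P; exists c^-1; rewrite scaleKx //; apply/eqP => c0.
apply: nd; apply: (lspan_min _ _ d_in) => //; split; first by in_span.
by move: c2; rewrite c0 scale0r addr0.
Qed.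

(** Coordinates of the affine plane of order three: up to scalars the images of
    [- d], [- e], [d + e] are [O + p], [O + q], [(O + p) + b (O + q)]; the lines of
    the plane give [b = (1 + b) ^ 2], that is [(b - 1) ^ 2 = 0], so [b = 1] and
    [p - O] is on the line through the images of [e] and [d + e]. *)
Lemma infinity_char3 d e p : H d -> H e -> lfree [:: img e; img d; F o] ->
  lspan [:: img d] p -> lspan [:: p] (img d) -> lspan [:: img (- d)] (F o + p) ->
  lspan [:: F o + p] (img (- d)) -> lspan [:: img e; img (e + d)] (p - F o).
Proof.
move=> Hd He fr dp pd mp pm; set O := F o in fr mp pm *.
have nd := lfree_hd (lfree_tl fr).
have ne : ~ lspan [:: F o] (img e).
  move=> L; apply: (lfree_hd fr); apply: (lspan_min _ _ L) => //.
  by split=> //; in_span.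
have [q [eq qe nq qn]] := opposite_lift He ne.
have H0 := vsub0 sH.
have [HNd HNe] : H (- d) /\ H (- e) by split; exact: (vsubN sH).
have K3d v : (1 + 1 + 1 : K) *: v = 0 by rewrite K3 scale0r.
pose P11 := img (e + d); pose P12 := img (d - e); pose P21 := img (e - d).
have HD : H (e + d) by exact: (vsubD sH).
have HB : H (d - e) by exact: (vsubB sH).
have HB' : H (e - d) by exact: (vsubB sH).
have fpq : lfree [:: O; p; q].
  apply: (lfree_gen dK' fr) => //; split.
    by apply: (lspan_min _ _ qe) => //; split=> //; in_span.
  split; last by split=> //; in_span.
  by apply: (lspan_min _ _ pd) => //; split=> //; in_span.
have L11 : lspan [:: img (- d); img (- e)] P11.
  apply: (img_line (t := - 1)) => //.
  by apply: (lincomb (z := (1 + 1 + 1) *: d)); [exact: K3d|lmod].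
have L12 : lspan [:: img (- d); img e] P12.
  apply: (img_line (t := - 1)) => //.
  by apply: (lincomb (z := (1 + 1 + 1) *: d)); [exact: K3d|lmod].
have L21 : lspan [:: img (- e); img d] P21.
  apply: (img_line (t := - 1)) => //.
  by apply: (lincomb (z := (1 + 1 + 1) *: e)); [exact: K3d|lmod].
have M12 : lspan [:: img d; P11] P12.
  by apply: (img_line (t := - 1)) => //; lmod.
have M21 : lspan [:: img e; P11] P21.
  by apply: (img_line (t := - 1)) => //; lmod.
have N21 : lspan [:: O; P12] P21.
  by rewrite /O -img0; apply: (img_line (t := - 1)) => //; lmod.
have n11 : ~ lspan [:: img (- e)] P11.
  move=> L; have : lspan [:: img (- e); P11] (img (- d)).
    apply: (img_line (t := - 1)) => //.
    by apply: (lincomb (z := (1 + 1 + 1) *: e)); [exact: K3d|lmod].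
  move=> L'; have {L'} L' : lspan [:: img (- e)] (img (- d)).
    by apply: (lspan_min _ _ L') => //; split; [in_span|split].
  have : lspan [:: O + q] (O + p).
    apply: (lspan_min _ _ mp) => //; split=> //.
    by apply: (lspan_min _ _ L') => //; split.
  move=> /lspan1P[s Es]; have [_ /eqP] : [/\ 1 - s = 0, 1 = 0 :> K' & - s = 0].
    apply: (lfree3_coef dK' fpq); transitivity (O + p - (O + p)); last by rewrite subrr.
    by rewrite {2}Es; lmod.
  by rewrite oner_eq0.
have n12 : ~ lspan [:: img e] P12.
  move=> L; have : lspan [:: img e; P12] (img (- d)).
    apply: (img_line (t := - 1)) => //.
    by apply: (lincomb (z := - ((1 + 1 + 1) *: e))); [rewrite K3d oppr0|lmod].
  move=> L'; have {L'} L' : lspan [:: img e] (img (- d)).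
    by apply: (lspan_min _ _ L') => //; split; [in_span|split].
  have : lspan [:: q] (O + p).
    apply: (lspan_min _ _ mp) => //; split=> //.
    by apply: (lspan_min _ _ L') => //; split.
  move=> /lspan1P[s Es]; have [/eqP] : [/\ 1 = 0 :> K', 1 = 0 :> K' & - s = 0].
    apply: (lfree3_coef dK' fpq); transitivity (O + p - (O + p)); last by rewrite subrr.
    by rewrite {2}Es; lmod.
  by rewrite oner_eq0.
have n21 : ~ lspan [:: img d] P21.
  move=> L; have : lspan [:: img d; P21] (img (- e)).
    apply: (img_line (t := - 1)) => //.
    by apply: (lincomb (z := - ((1 + 1 + 1) *: d))); [rewrite K3d oppr0|lmod].
  move=> L'; have {L'} L' : lspan [:: img d] (img (- e)).
    by apply: (lspan_min _ _ L') => //; split; [in_span|split].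
  have : lspan [:: p] (O + q).
    apply: (lspan_min _ _ nq) => //; split=> //.
    by apply: (lspan_min _ _ L') => //; split.
  move=> /lspan1P[s Es]; have [/eqP] : [/\ 1 = 0 :> K', - s = 0 & 1 = 0 :> K'].
    apply: (lfree3_coef dK' fpq); transitivity (O + q - (O + q)); last by rewrite subrr.
    by rewrite {2}Es; lmod.
  by rewrite oner_eq0.
have [b [b1 b2]] : exists b, lspan [:: P11] ((O + p) + b *: (O + q)) /\ lspan [:: (O + p) + b *: (O + q)] P11.
  apply: lspan_normalize.
    apply: (lspan_min _ _ L11) => //.
    split; last split=> //.
      by apply: (lspan_min _ _ pm) => //; split=> //; in_span.
    by apply: (lspan_min _ _ qn) => //; split=> //; in_span.
  by move=> L; apply: n11; apply: (lspan_min _ _ L) => //; split.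
have [c [c1 c2]] : exists c, lspan [:: P12] ((O + p) + c *: q) /\ lspan [:: (O + p) + c *: q] P12.
  apply: lspan_normalize.
    apply: (lspan_min _ _ L12) => //.
    split; last split=> //.
      by apply: (lspan_min _ _ pm) => //; split=> //; in_span.
    by apply: (lspan_min _ _ qe) => //; split=> //; in_span.
  by move=> L; apply: n12; apply: (lspan_min _ _ L) => //; split.
have [g [g1 g2]] : exists g, lspan [:: P21] ((O + q) + g *: p) /\ lspan [:: (O + q) + g *: p] P21.
  apply: lspan_normalize.
    apply: (lspan_min _ _ L21) => //.
    split; last split=> //.
      by apply: (lspan_min _ _ qn) => //; split=> //; in_span.
    by apply: (lspan_min _ _ pd) => //; split=> //; in_span.
  by move=> L; apply: n21; apply: (lspan_min _ _ L) => //; split.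
have {c1} /lspan2P[x [y E12]] : lspan [:: p; (O + p) + b *: (O + q)] (O + p + c *: q).
  apply: (lspan_min _ _ c1) => //; split=> //; apply: (lspan_min _ _ M12) => //.
  split; first by apply: (lspan_min _ _ pd) => //; split=> //; in_span.
  by split=> //; apply: (lspan_min _ _ b2) => //; split=> //; in_span.
have /lspan2P[x' [y' E21]] : lspan [:: q; (O + p) + b *: (O + q)] (O + q + g *: p).
  apply: (lspan_min _ _ g1) => //; split=> //; apply: (lspan_min _ _ M21) => //.
  split; first by apply: (lspan_min _ _ qe) => //; split=> //; in_span.
  by split=> //; apply: (lspan_min _ _ b2) => //; split=> //; in_span.
have /lspan2P[z [w E21']] : lspan [:: O; (O + p) + c *: q] (O + q + g *: p).
  apply: (lspan_min _ _ g1) => //; split=> //; apply: (lspan_min _ _ N21) => //.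
  split; first by in_span.
  by split=> //; apply: (lspan_min _ _ c2) => //; split=> //; in_span.
have [y1 _ yc] : [/\ y * (1 + b) - 1 = 0, x + y - 1 = 0 & y * b - c = 0].
  apply: (lfree3_coef dK' fpq); transitivity
    (O + p + c *: q - (O + p + c *: q)); last by rewrite subrr.
  by rewrite {1}E12; lmod.
have [y1' yg _] : [/\ y' * (1 + b) - 1 = 0, y' - g = 0 & x' + y' * b - 1 = 0].
  apply: (lfree3_coef dK' fpq); transitivity
    (O + q + g *: p - (O + q + g *: p)); last by rewrite subrr.
  by rewrite {1}E21; lmod.
have [_ wg wc] : [/\ z + w - 1 = 0, w - g = 0 & w * c - 1 = 0].
  apply: (lfree3_coef dK' fpq); transitivity
    (O + q + g *: p - (O + q + g *: p)); last by rewrite subrr.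
  by rewrite {1}E21'; lmod.
have {wg} wg := subr0_eq wg; have {wc} wc := subr0_eq wc.
have {yg} yg := subr0_eq yg; have {y1'} y1' := subr0_eq y1'.
have {yc} yc := subr0_eq yc; have {y1} y1 := subr0_eq y1.
have b1n : 1 + b != 0.
  by apply/eqP => b0; move: y1; rewrite b0 mulr0 => /esym /eqP; rewrite oner_eq0.
have yE := mulx_eq1 dK' b1n y1.
have gE := mulx_eq1 dK' b1n y1'; rewrite yg in gE.
have E : b = (1 + b) * (1 + b).
  have : (1 + b)^-1 * ((1 + b)^-1 * b) = 1 by rewrite -{1}gE -wg -yE yc wc.
  move=> /(congr1 (fun u => (1 + b) * ((1 + b) * u))).
  by rewrite /= mulr1 !(mulVKr (dK' b1n)).
have bb : b = 1.
  have sq : (b - 1) * (b - 1) = 0.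
    apply: (lincomb (z := ((1 + b) * (1 + b) - b) - (1 + 1 + 1) * b)).
      by rewrite -E K3' subrr mul0r subrr.
    by ringnc.
  apply: subr0_eq; apply/eqP; apply: contraT => bn.
  by have := mulx_neq0 dK' bn bn; rewrite sq eqxx.
move: b1; rewrite bb scale1r => b1.
have -> : p - O = O + p + (O + q) - q.
  apply: (lincomb (z := - ((1 + 1 + 1) *: O))); first by rewrite K3' scale0r oppr0.
  by lmod.
apply: (vsubB (vsubspace_lspan _)).
  by apply: (lspan_min _ _ b1) => //; split=> //; in_span.
by apply: (lspan_min _ _ eq) => //; split=> //; in_span.
Qed.
End CharacteristicThree.

Hypothesis rankF : forall a b, exists2 v, Y v & ~ lspan [:: a; b] (F v).
Hypothesis scalars :
  (exists z0 z1 z2 : K, [/\ z0 != 0, z1 != 0 & z2 != 0] /\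
     [/\ z0 != z1, z0 != z2 & z1 != z2]) \/
  (1 + 1 + 1 = 0 :> K /\ 1 + 1 + 1 = 0 :> K').

Lemma third_scalar : exists2 k : K, k != 0 & k != 1.
Proof.
case: scalars => [[z0 [z1 [z2 [[z0n z1n _] [z01 _ _]]]]]|[K3 _]].
  by case: (eqVneq z0 1) => [E|]; [exists z1; rewrite // -E eq_sym|exists z0].
exists (- 1); first by rewrite oppr_eq0 oner_eq0.
apply/eqP => E; move: K3; rewrite -{2}E addrN add0r.
by move=> /eqP; rewrite oner_eq0.
Qed.

(** Otherwise [F] would take its values in a span of two vectors, since every vector
    of [Y] is a combination of vectors outside [H]. *)
Lemma exists_outside a : exists2 e, H e & ~ lspan [:: a; F o] (img e).
Proof.
have [v Yv nv] := rankF a (F o); have [t Hvt] := Hmax Ho v.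
have [t0|t0] := eqVneq t 0.
  exists v => [|L]; first by rewrite t0 scale0r subr0 in Hvt.
  have Hv : H v by rewrite t0 scale0r subr0 in Hvt.
  have : lspan [:: img v; F o] (F v).
    apply: (F_lspan (l := [:: o + v; o])) => //.
      by split; [exact: Yo|split=> //; exact: YH].
    by apply: (lspan2I (s := 1) (t := - 1)); lmod.
  move=> /(lspan_min (vsubspace_lspan [:: a; F o])) L'; apply: nv; apply: L'.
  by split=> //; split=> //; in_span.
exists (t^-1 *: (v - t *: o)) => [|L]; first exact: (vsubZ _ sH).
have : lspan [:: img (t^-1 *: (v - t *: o))] (F v).
  apply: (F_lspan (l := [:: o + t^-1 *: (v - t *: o)])) => //.
    by split=> //; apply: Yo; exact: (vsubZ _ sH).
  by apply/lspan1P; exists t; rewrite scalerDr scalexK // addrC subrK.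
by move=> /(lspan_min (vsubspace_lspan [:: a; F o])) L'; apply: nv; apply: L'; split.
Qed.

(** The affine plane through [o] with directions [d] and [e] has a plane as image. *)
Definition indep d e := lfree [:: img e; img d; F o].

Lemma indepI d e : ~ lspan [:: F o] (img d) -> ~ lspan [:: img d; F o] (img e) -> indep d e.
Proof. by move=> nd ne; split=> //; split=> //; apply/lfree1P. Qed.

Lemma indep_n0 d e : indep d e -> ~ lspan [:: F o] (img d).
Proof. by move=> f; exact: lfree_hd (lfree_tl f). Qed.

Lemma indep_sym d e : indep d e -> indep e d.
Proof.
move=> f; apply: (lfree_gen dK' f) => //.
by split; [in_span|split; [in_span|split=> //; in_span]].
Qed.

Lemma indep_gen d e d' e' s t s' t' : H d' -> H e' ->
  d = s *: d' + t *: e' -> e = s' *: d' + t' *: e' -> indep d e -> indep d' e'.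
Proof.
move=> Hd' He' dE eE f; apply: (lfree_gen dK' f) => //.
have plane r u : lspan [:: img e'; img d'; F o] (img (r *: d' + u *: e')).
  have : lspan [:: img 0; img d'; img e'] (img (r *: d' + u *: e')).
    by apply: (img_plane (t := r) (r := u)) => //; [exact: vsub0|lmod].
  rewrite img0; apply: lspan_min => //.
  by split; [in_span|split; [in_span|split=> //; in_span]].
by rewrite eE dE; split=> //; split=> //; split=> //; in_span.
Qed.

Lemma exists_indep d : ~ lspan [:: F o] (img d) -> exists2 e, H e & indep d e.
Proof. by move=> nd; have [e He ne] := exists_outside (img d); exists e => //; exact: indepI. Qed.

(** A vector space is not the union of two proper subspaces. *)
Lemma exists_indep2 d e : ~ lspan [:: F o] (img d) -> ~ lspan [:: F o] (img e) ->
  exists f, [/\ H f, indep d f & indep e f].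
Proof.
move=> nd ne.
have [W1 sW1 W1P] := affine_preimage (vsubspace_lspan _) (lspan_tl (img d) (lspan_hd (F o) [::])).
have [W2 sW2 W2P] := affine_preimage (vsubspace_lspan _) (lspan_tl (img e) (lspan_hd (F o) [::])).
have [f1 Hf1 n1] := exists_outside (img d); have [f2 Hf2 n2] := exists_outside (img e).
have [L1|] := pselect (lspan [:: img e; F o] (img f1)); last first.
  by move=> ?; exists f1; split=> //; exact: indepI.
have [L2|] := pselect (lspan [:: img d; F o] (img f2)); last first.
  by move=> ?; exists f2; split=> //; exact: indepI.
have Hf : H (f1 + f2) by exact: vsubD.
exists (f1 + f2); split=> //; apply: indepI => // L.
  by apply: n1; apply/W1P => //; apply: (vsubDl sW1 (w := f2)); exact/W1P.
by apply: n2; apply/W2P => //; apply: (vsubDr sW2 (v := f1)); exact/W2P.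
Qed.

Lemma indep_skew d e : indep d e -> lfree [:: img 0; img (0 + d); img e].
Proof.
move=> f; apply: (lfree_gen dK' f) => //; rewrite add0r img0.
by split; [in_span|split; [in_span|split=> //; in_span]].
Qed.

(** In a plane whose image is a plane, parallels have no common image point. *)
Lemma off_line d e r : H d -> H e -> indep d e ->
  ~ lspan [:: img e; img (e + d)] (img (r *: d)).
Proof.
move=> Hd He f; apply: lfree_hd; apply: (lfree_gen dK' (indep_skew f)) => //.
have Hr : H (r *: d) by exact: vsubZ.
have Hed : H (e + d) by exact: vsubD.
have plane s : lspan [:: img (r *: d); img e; img (e + d)] (img (s *: d)).
  have : lspan [:: img e; img (e + d); img (r *: d)] (img (s *: d)).
    by apply: (img_plane (t := s - r) (r := 1)) => //; lmod.
  apply: lspan_min => //.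
  by split; [in_span|split; [in_span|split=> //; in_span]].
split; first by have := plane 0; rewrite scale0r.
split; first by have := plane 1; rewrite scale1r add0r.
by split=> //; in_span.
Qed.

(** In characteristic three [x] is read off the line through [o] alone.  Otherwise
    [x] is the intersection of this line with one parallel; the image of a further
    parallel either is the image of the latter, or passes through [x] by
    Desargues. *)
Lemma infinity_point d : H d -> ~ lspan [:: F o] (img d) ->
  exists x, [/\ x != 0, lspan [:: F o; img d] x &
    forall e, H e -> indep d e -> lspan [:: img e; img (e + d)] x].
Proof.
move=> Hd nd; have H0 := vsub0 sH.
case: scalars => [[z0 [z1 [z2 [[z0n z1n z2n] [z01 z02 z12]]]]]|[K3 K3']]; last first.
  have [p [dp pd mp pm]] := opposite_lift K3 Hd nd.
  exists (p - F o); split.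
  - by apply/eqP => /subr0_eq E; apply: nd; rewrite -E.
  - apply: (vsubB (vsubspace_lspan _)); last by in_span.
    by apply: (lspan_min _ _ dp) => //; split=> //; in_span.
  - by move=> e He f; exact: (infinity_char3 K3 K3').
have [e He f] := exists_indep nd; have Hed : H (e + d) by exact: vsubD.
have fl := img_skew_parallel H0 Hd He (indep_skew f).
have /lspan3P[a [b [c E]]] : lspan [:: img 0; img (0 + d); img e] (img (e + d)).
  exact: img_parallel.
have Ex : img (e + d) - c *: img e = a *: F o + b *: img d.
  by apply: (lincomb (z := img (e + d) - img (e + d)));
    [rewrite subrr|rewrite {3}E img0 add0r; lmod].
have Lx : lspan [:: img e; img (e + d)] (img (e + d) - c *: img e).
  by apply: (lspan2I (s := - c) (t := 1)); lmod.
have x0 : img (e + d) - c *: img e != 0.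
  apply/eqP => x0; have [_ /eqP] : - c = 0 /\ 1 = 0 :> K'.
    by apply: (lfree2_coef dK' (lfree_tl fl)); rewrite -[RHS]x0; lmod.
  by rewrite oner_eq0.
have L0x : lspan [:: F o; img d] (img (e + d) - c *: img e).
  by rewrite Ex; apply/lspan2P; exists a, b.
exists (img (e + d) - c *: img e); split=> // g Hg fg.
have flg := img_skew_parallel H0 Hd Hg (indep_skew fg).
have [Lg|nLg] := pselect (lspan [:: img e; img (e + d)] (img g)).
  have c2 : contains (lspan [:: img e; img (e + d)]) [:: img g; img (g + d)].
    split=> //; split=> //; apply: (lspan_min _ _ (img_parallel He Hg Hd)) => //.
    by split; [in_span|split; [in_span|split]].
  exact: (lfree_span dK' (lfree_tl flg) c2 isT).
have feg : lfree [:: img e; img (e + d); img g].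
  apply: (lfree_gen dK' (l := [:: img g; img e; img (e + d)])) => //.
    by split=> //; exact: lfree_tl fl.
  by split; [in_span|split; [in_span|split=> //; in_span]].
have [y [y0 Ly Ley Lgy]] := three_lines_concurrent z0n z1n z2n z01 z02 z12 Hd H0 He Hg
  (indep_skew f) feg.
rewrite img0 add0r in Ly.
have nPe : ~ lspan [:: F o; img d] (img e).
  move=> L; apply: (lfree_hd f); apply: (lspan_min _ _ L) => //.
  by split; [in_span|split=> //; in_span].
have := lspan_meet dK' nPe y0 Ly Ley L0x Lx.
by apply: lspan_min => //; split.
Qed.

(** * Displacements and their additivity *)

(** [D] is the displacement lifting the direction [d]: it represents the image of
    the point at infinity of [d], scaled so that [F o + D] represents the image of
    [o + d]. *)
Definition displacement d (D : V') :=
  [/\ lspan [:: img d] (F o + D), lspan [:: F o + D] (img d) &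
    forall e, H e -> indep d e -> lspan [:: img e; img (e + d)] D].

(** The point at infinity is on neither of [F o], [img d]: these are off the image of
    a parallel, which contains the point at infinity.  So it can be rescaled. *)
Lemma exists_displacement d : H d -> ~ lspan [:: F o] (img d) ->
  exists D, displacement d D.
Proof.
move=> Hd nd; have [x [x0 Lx xinf]] := infinity_point Hd nd.
have [e He f] := exists_indep nd; have xe := xinf e He f.
have not_x r : lspan [:: x] (img (r *: d)) -> False.
  move=> L; apply: (off_line (r := r) Hd He f).
  by apply: (lspan_min _ _ L) => //; split.
have nx : ~ lspan [:: img d] x.
  by move=> L; apply: (not_x 1); rewrite scale1r; exact: (lspan1_sym dK' x0 L).
have nx' : ~ lspan [:: F o] x.
  by move=> L; apply: (not_x 0); rewrite scale0r img0; exact: (lspan1_sym dK' x0 L).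
move: Lx => /lspan2P[s [t E]].
have s0 : s != 0.
  by apply/eqP => s0; apply: nx; rewrite E s0 scale0r add0r; exact: lspan1Z.
have t0 : t != 0.
  by apply/eqP => t0; apply: nx'; rewrite E t0 scale0r addr0; exact: lspan1Z.
have oD : F o + (- s^-1) *: x = (- (s^-1 * t)) *: img d.
  by rewrite E scalerDr scalerA mulNr (mulVx dK') //; lmod.
exists ((- s^-1) *: x); split.
- by rewrite oD; exact: lspan1Z.
- apply/lspan1P; exists (- (s^-1 * t))^-1; rewrite oD (scaleKx dK') // oppr_eq0.
  by apply: (mulx_neq0 dK') => //; exact: invx_neq0.
- move=> g Hg fg; apply: (vsubZ _ (vsubspace_lspan _)); exact: xinf.
Qed.

Lemma displacement_free d e Dd De : displacement d Dd -> displacement e De ->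
  indep d e -> lfree [:: F o; Dd; De].
Proof.
move=> [_ dD _] [_ eD _] f; apply: (lfree_gen dK' f) => //.
have sub D : lspan [:: F o; Dd; De] D -> forall x, lspan [:: F o + D] x ->
    lspan [:: F o; Dd; De] x.
  move=> LD x; apply: lspan_min => //; split=> //.
  by apply: (vsubD (vsubspace_lspan _)) => //; in_span.
split; first by apply: sub eD; in_span.
by split; [apply: sub dD; in_span|split=> //; in_span].
Qed.

Lemma displacement_on_line d D : displacement d D -> lspan [:: F o; img d] D.
Proof.
move=> [L _ _]; apply: (vsubDr (v := F o) (vsubspace_lspan _)); first by in_span.
by apply: (lspan_min _ _ L) => //; split=> //; in_span.
Qed.

Lemma displacement_n0 d D : ~ lspan [:: F o] (img d) -> displacement d D ->
  lfree [:: F o; D].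
Proof.
move=> nd [_ dD _]; have f : lfree [:: D; F o].
  split; last by apply/lfree1P.
  move=> L; apply: nd; apply: (lspan_min _ _ dD) => //; split=> //.
  by apply: (vsubD (vsubspace_lspan _)) => //; in_span.
by apply: (lfree_gen dK' f) => //; split; [in_span|split=> //; in_span].
Qed.

(** Both are on the image of the line through [o] and on that of one parallel, so they
    are proportional, and the scale is fixed by [img d]. *)
Lemma displacement_unique d D D' : H d -> ~ lspan [:: F o] (img d) ->
  displacement d D -> displacement d D' -> D = D'.
Proof.
move=> Hd nd dD dD'; have [e He f] := exists_indep nd.
have [_ _ De] := dD; have [L' _ De'] := dD'.
have fD := displacement_n0 nd dD.
have D0 : D != 0 by have /lfree1P := lfree_tl fD.
have nPe : ~ lspan [:: F o; img d] (img e).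
  move=> L; apply: (lfree_hd f); apply: (lspan_min _ _ L) => //.
  by split; [in_span|split=> //; in_span].
have /lspan1P[c E] := lspan_meet dK' nPe D0 (displacement_on_line dD) (De e He f)
  (displacement_on_line dD') (De' e He f).
have [_ L _] := dD.
have /lspan1P[k Ek] : lspan [:: F o + D] (F o + D').
  by apply: (lspan_min _ _ L') => //; split.
have [k1 ck] : 1 - k = 0 /\ c - k = 0.
  apply: (lfree2_coef dK' fD); transitivity (F o + D' - (F o + D')); last by rewrite subrr.
  by rewrite {2}Ek E; lmod.
by rewrite E (subr0_eq ck) -(subr0_eq k1) scale1r.
Qed.

(** [o + d + e] is on the parallel to [e] through [o + d] and on the parallel to [d]
    through [o + e]; these give two expressions, and the coefficients are compared. *)
Lemma image_sum d e Dd De : H d -> H e -> indep d e ->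
  displacement d Dd -> displacement e De ->
  exists2 s, s != 0 & img (d + e) = s *: (F o + Dd + De).
Proof.
move=> Hd He f dD eD; have f3 := displacement_free dD eD f.
have [Ld Ld' Dinf] := dD; have [Le Le' Einf] := eD.
have Lde := Einf d Hd (indep_sym f); have Led := Dinf e He f.
have key a b A B : lfree [:: F o; A; B] -> lspan [:: img a] (F o + A) ->
    lspan [:: F o + A] (img a) -> lspan [:: img a; img (a + b)] B ->
    exists s t, img (a + b) = s *: B + t *: (F o + A).
  move=> fAB La La' LB; apply/lspan2P.
  have nB : ~ lspan [:: img a] B.
    move=> L; have /lspan1P[s E] : lspan [:: F o + A] B.
      by apply: (lspan_min _ _ L) => //; split.
    have [_ _ /eqP] : [/\ - s = 0, - s = 0 & 1 = 0 :> K'].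
      apply: (lfree3_coef dK' fAB); transitivity (B - B); last by rewrite subrr.
      by rewrite {3}E; lmod.
    by rewrite oner_eq0.
  have LB' : lspan [:: img (a + b); img a] B.
    by apply: (lspan_min _ _ LB) => //; split; [in_span|split=> //; in_span].
  apply: (lspan_min _ _ (lspan_exchange dK' LB' nB)) => //.
  split; first by in_span.
  by split=> //; apply: (lspan_min _ _ La') => //; split=> //; in_span.
have [s [t E]] := key d e Dd De f3 Ld Ld' Lde.
have [s' [t' E']] : exists s t, img (d + e) = s *: Dd + t *: (F o + De).
  rewrite [d + e]addrC; apply: key => //; apply: (lfree_gen dK' f3) => //.
  by split; [in_span|split; [in_span|split=> //; in_span]].
have [tt ts st] : [/\ t - t' = 0, t - s' = 0 & s - t' = 0].
  apply: (lfree3_coef dK' f3); transitivity (img (d + e) - img (d + e));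
    last by rewrite subrr.
  by rewrite {1}E E'; lmod.
have EE : img (d + e) = t *: (F o + Dd + De).
  by rewrite E (subr0_eq st) -(subr0_eq tt); lmod.
exists t => //; apply/eqP => t0.
have := lfree_tl (lfree_tl (img_skew_parallel (vsub0 sH) Hd He (indep_skew f))).
by move=> /lfree1P; rewrite [e + d]addrC EE t0 scale0r eqxx.
Qed.

Lemma outside_scale d k : H d -> k != 0 -> ~ lspan [:: F o] (img d) ->
  ~ lspan [:: F o] (img (k *: d)).
Proof.
move=> Hd k0 nd L; apply: nd.
have := img_line_gen 1 (vsub0 sH) Hd k0; rewrite img0 !add0r scale1r.
by apply: lspan_min => //; split; [in_span|split].
Qed.

(** The lines of direction [k d] are those of direction [d]. *)
Lemma displacement_scale d D k : H d -> ~ lspan [:: F o] (img d) -> k != 0 ->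
  displacement d D -> exists s, displacement (k *: d) (s *: D).
Proof.
move=> Hd nd k0 dD; have Hkd : H (k *: d) by exact: vsubZ.
have nkd := outside_scale Hd k0 nd; have [D' kD'] := exists_displacement Hkd nkd.
have [e He f] := exists_indep nd.
have fk : indep (k *: d) e.
  by apply: (indep_gen Hkd He _ _ f (s := k^-1) (t := 0) (s' := 0) (t' := 1));
    rewrite ?scaleKx //; lmod.
have nPe : ~ lspan [:: F o; img d] (img e).
  move=> L; apply: (lfree_hd f); apply: (lspan_min _ _ L) => //.
  by split; [in_span|split=> //; in_span].
have D0 : D != 0 by have /lfree1P := lfree_tl (displacement_n0 nd dD).
have [_ _ Dinf] := dD; have [_ _ Dinf'] := kD'.
have /lspan1P[s E] : lspan [:: D] D'.
  apply: (lspan_meet dK' nPe D0 (displacement_on_line dD) (Dinf e He f)).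
    apply: (lspan_min _ _ (displacement_on_line kD')) => //; split; first by in_span.
    by split=> //; have := img_on_line k (vsub0 sH) Hd; rewrite img0 !add0r.
  apply: (lspan_min _ _ (Dinf' e He fk)) => //; split; first by in_span.
  by split=> //; exact: img_on_line.
by exists s; rewrite -E.
Qed.

(** [o + k d + k e] is on the line joining [o] to [o + d + e]. *)
Lemma displacement_same_scale d e Dd De k s t : H d -> H e -> indep d e -> k != 0 ->
  displacement d Dd -> displacement e De ->
  displacement (k *: d) (s *: Dd) -> displacement (k *: e) (t *: De) -> s = t.
Proof.
move=> Hd He f k0 dD eD kdD keD.
have [Hkd Hke] : H (k *: d) /\ H (k *: e) by split; exact: vsubZ.
have fk : indep (k *: d) (k *: e).
  apply: (indep_gen Hkd Hke _ _ f (s := k^-1) (t := 0) (s' := 0) (t' := k^-1)).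
    by rewrite scaleKx // scale0r addr0.
  by rewrite scaleKx // scale0r add0r.
have [u u0 Ek] := image_sum Hkd Hke fk kdD keD.
have [v v0 E] := image_sum Hd He f dD eD.
have := img_on_line k (vsub0 sH) (vsubD sH Hd He).
rewrite img0 !add0r scalerDr Ek E => /lspan2P[a [b Eab]].
have [_ us ut] : [/\ u - a - b * v = 0, u * s - b * v = 0 & u * t - b * v = 0].
  apply: (lfree3_coef dK' (displacement_free dD eD f)).
  transitivity (u *: (F o + s *: Dd + t *: De) - u *: (F o + s *: Dd + t *: De));
    last by rewrite subrr.
  by rewrite {2}Eab; lmod.
by apply: (mulrI (dK' u0)); rewrite (subr0_eq us) (subr0_eq ut).
Qed.

(** The lines joining [o + d] to [o + e] and [o + k d] to [o + k e] are parallel, so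
    [D] is on the images of both; the scalars multiplying [Dd] and [De] for [k] are
    equal and different from one, which leaves the multiples of [De - Dd]. *)
Lemma displacement_sub d e Dd De D : H d -> H e -> indep d e ->
  displacement d Dd -> displacement e De -> displacement (e - d) D ->
  lspan [:: De - Dd] D.
Proof.
move=> Hd He f dD eD [_ _ Dinf]; have [k k0 k1] := third_scalar.
have nd := indep_n0 f; have ne := indep_n0 (indep_sym f).
have [Hkd Hke] : H (k *: d) /\ H (k *: e) by split; exact: vsubZ.
have Hed : H (e - d) by exact: vsubB.
(* [s] is the scalar of [k], common to [d] and [e]. *)
have [s kdD] := displacement_scale Hd nd k0 dD.
have [t keD] := displacement_scale He ne k0 eD.
have st := displacement_same_scale Hd He f k0 dD eD kdD keD; rewrite -st {t st} in keD.
have [Ld Ld' _] := dD; have [Lkd Lkd' _] := kdD.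
have [_ Le' _] := eD; have [_ Lke' _] := keD.
have s1 : s != 1.
  apply/eqP => s1; apply: nd; apply: (lspan1_sym dK') => //.
  have := img_line_gen2 0 (vsub0 sH) Hd k1; rewrite !add0r scale1r scale0r img0.
  apply: lspan_min => //; split; last by split=> //; in_span.
  apply: (lspan_min _ _ Lkd') => //; split=> //; rewrite s1 scale1r; exact: Ld.
have f1 : indep (e - d) d.
  by apply: (indep_gen Hed Hd _ _ f (s := 0) (t := 1) (s' := 1) (t' := 1)); lmod.
have fk : indep (e - d) (k *: d).
  apply: (indep_gen Hed Hkd _ _ f (s := 0) (t := k^-1) (s' := 1) (t' := k^-1)).
    by rewrite scaleKx // scale0r add0r.
  by rewrite scaleKx // scale1r subrK.
have /lspan2P[a [b Eab]] : lspan [:: F o + Dd; F o + De] D.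
  have := Dinf d Hd f1; rewrite addrC subrK.
  by apply: lspan_min => //; split;
    [apply: (lspan_min _ _ Ld')|split=> //; apply: (lspan_min _ _ Le')] => //;
    split=> //; in_span.
have /lspan2P[a' [b' Eab']] : lspan [:: F o + s *: Dd; F o + s *: De] D.
  apply: (lspan_min _ _ (Dinf _ Hkd fk)) => //.
  have Lk : lspan [:: F o + s *: Dd; F o + s *: De] (img (k *: d)).
    by apply: (lspan_min _ _ Lkd') => //; split=> //; in_span.
  split=> //; split=> //.
  have := img_line_gen 1 Hkd Hed k0; rewrite scale1r.
  have -> : k *: d + k *: (e - d) = k *: e by lmod.
  apply: lspan_min => //; split=> //; split=> //.
  by apply: (lspan_min _ _ Lke') => //; split=> //; in_span.
have [ab aE bE] : [/\ a + b - (a' + b') = 0, a - a' * s = 0 & b - b' * s = 0].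
  apply: (lfree3_coef dK' (displacement_free dD eD f)).
  transitivity (D - D); last by rewrite subrr.
  by rewrite {1}Eab Eab'; lmod.
have ab0 : a + b = 0.
  have E : (a' + b') * (s - 1) = 0.
    apply: (lincomb (z := (a + b - (a' + b')) - (a - a' * s) - (b - b' * s))).
      by rewrite ab aE bE !subr0.
    by ringnc.
  rewrite (subr0_eq ab); apply/eqP; apply: contraT => n0.
  have s10 : s - 1 != 0 by rewrite subr_eq0.
  by have := mulx_neq0 dK' n0 s10; rewrite E eqxx.
apply/lspan1P; exists b; rewrite Eab.
by apply: (lincomb (z := (a + b) *: (F o + Dd))); [rewrite ab0 scale0r|lmod].
Qed.

(** Applied to [d] and [d + e], whose difference is [e], the previous lemma puts the
    displacement of [d + e] in [Dd + K' De]; the position of [img (d + e)] found in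
    [image_sum] fixes the scalar. *)
Lemma displacement_add d e Dd De : H d -> H e -> indep d e ->
  displacement d Dd -> displacement e De -> displacement (d + e) (Dd + De).
Proof.
move=> Hd He f dD eD; have Hde : H (d + e) by exact: vsubD.
have f1 : indep d (d + e).
  by apply: (indep_gen Hd Hde _ _ f (s := 1) (t := 0) (s' := - 1) (t' := 1)); lmod.
have [D' deD'] := exists_displacement Hde (indep_n0 (indep_sym f1)).
have eD2 : displacement (d + e - d) De by rewrite [d + e]addrC addrK.
have /lspan1P[c Ec] := displacement_sub Hd Hde f1 dD deD' eD2.
have [v v0 E] := image_sum Hd He f dD eD; have [L _ _] := deD'.
move: L; rewrite E => /lspan1P[c' Ec'].
have ED' : D' = (c' * v) *: (F o + Dd + De) - F o.
  by apply: (lincomb (z := F o + D' - (F o + D')));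
    [rewrite subrr|rewrite {2}Ec'; lmod].
have [cc _ c1] : [/\ c * (c' * v - 1) = 0, c * (c' * v - 1) = 0 &
    c * (c' * v) - 1 = 0].
  apply: (lfree3_coef dK' (displacement_free dD eD f)).
  transitivity (c *: (D' - Dd) - De); last by rewrite -Ec subrr.
  by rewrite ED'; lmod.
have c0 : c != 0.
  by apply/eqP => c0; move/subr0_eq/esym/eqP: c1; rewrite c0 mul0r oner_eq0.
have cv : c' * v = 1.
  apply: subr0_eq; apply/eqP; apply: contraT => n0.
  by have := mulx_neq0 dK' c0 n0; rewrite cc eqxx.
have -> // : Dd + De = D'.
by rewrite ED' cv scale1r -[F o + _ + _]addrA [F o + _]addrC addrK.
Qed.

(** * The semilinear map on directions *)

Section Extension.
Variable D : V -> V'.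
Hypothesis DP : forall d, H d -> ~ lspan [:: F o] (img d) -> displacement d (D d).

Local Notation good d := (~ lspan [:: F o] (img d)).

Lemma displacement_add_indep d e : H d -> H e -> indep d e -> D (d + e) = D d + D e.
Proof.
move=> Hd He f; have Hde : H (d + e) by exact: vsubD.
have nd := indep_n0 f; have ne := indep_n0 (indep_sym f).
have nde : good (d + e).
  apply: (indep_n0 (e := d)); apply: (indep_gen Hde Hd _ _ f
    (s := 0) (t := 1) (s' := 1) (t' := - 1)); by lmod.
apply: (displacement_unique Hde nde (DP Hde nde)).
exact: (displacement_add Hd He f (DP Hd nd) (DP He ne)).
Qed.

Lemma outside_add (W : set V') h d : vsubspace W -> W (F o) -> H h -> H d ->
  W (img h) -> ~ W (img d) -> ~ W (img (d + h)).
Proof.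
move=> sW Wo Hh Hd; have [U sU UP] := affine_preimage sW Wo.
move=> /UP-/(_ Hh) Uh nd /UP Udh; apply: nd; apply/UP => //.
by apply: (vsubDl sU Uh); apply: Udh; exact: vsubD.
Qed.

Lemma indep_add d e h : H e -> H h -> lspan [:: img d; F o] (img h) -> indep d e ->
  indep d (e + h).
Proof.
move=> He Hh Lh f; apply: indepI; first exact: indep_n0 f.
apply: (outside_add (W := lspan [:: img d; F o]) _ _ Hh) => //; first by in_span.
exact: lfree_hd f.
Qed.

(** Compare with a direction [f] independent of both: additivity computes the
    displacement of [x + h + f] in two ways. *)
Lemma displacement_shift h d e : H h -> H d -> H e -> lspan [:: F o] (img h) ->
  good d -> good e -> D (d + h) - D d = D (e + h) - D e.
Proof.
move=> Hh Hd He bh.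
suff key x f : H x -> H f -> indep x f -> D (x + h) - D x = D (f + h) - D f.
  move=> nd ne; have [f [Hf fd fe]] := exists_indep2 nd ne.
  by rewrite (key d f) // (key e f).
move=> Hx Hf fr; have fr1 := indep_add Hf Hh (lspan_tl (img x) bh) fr.
have fr2 := indep_sym (indep_add Hx Hh (lspan_tl (img f) bh) (indep_sym fr)).
have [Hxh Hfh] : H (x + h) /\ H (f + h) by split; exact: vsubD.
have E : D (x + h) + D f = D x + D (f + h).
  rewrite -displacement_add_indep // -displacement_add_indep //.
  by rewrite -addrA [h + f]addrC.
by rewrite -[D (x + h)](addrK (D f)) E -addrA -opprD [D f + D x]addrC
  opprD addrACA subrr add0r.
Qed.

Variable d0 : V.
Hypotheses (Hd0 : H d0) (nd0 : good d0).

(** Where [o + h] has the same image as [o], or none, no displacement is defined;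
    it is recovered from additivity. *)
Definition shift h : V' :=
  if pselect (lspan [:: F o] (img h)) then D (d0 + h) - D d0 else D h.

Lemma shift_good h : good h -> shift h = D h.
Proof. by rewrite /shift; case: pselect. Qed.

Lemma shift_bad h d : H h -> H d -> lspan [:: F o] (img h) -> good d ->
  D (d + h) = D d + shift h.
Proof.
move=> Hh Hd bh nd; rewrite /shift; case: pselect => [?|] //=.
by rewrite (displacement_shift Hh Hd0 Hd bh nd0 nd) [RHS]addrC subrK.
Qed.

Lemma good_add d h : H d -> H h -> good d -> lspan [:: F o] (img h) -> good (d + h).
Proof. move=> Hd Hh nd bh; apply: (outside_add (W := lspan [:: F o]) _ _ Hh) => //.
by in_span. Qed.

(** When [h] and [g] are not independent, add a third direction [f] independent of
    both and compute the value at [h + g + f] in two ways. *)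
Lemma shiftD h g : H h -> H g -> shift (h + g) = shift h + shift g.
Proof.
have mixed x y : H x -> H y -> good x -> lspan [:: F o] (img y) ->
    shift (x + y) = shift x + shift y.
  move=> Hx Hy nx by_; rewrite (shift_good nx) (@shift_good (x + y)) ?(shift_bad Hy Hx) //.
  exact: good_add.
move=> Hh Hg; have Hhg : H (h + g) by exact: vsubD.
have [bh|nh] := pselect (lspan [:: F o] (img h)); last first.
  have [bg|ng] := pselect (lspan [:: F o] (img g)); first exact: mixed.
  rewrite !(shift_good nh) !(shift_good ng).
  have [Lg|nLg] := pselect (lspan [:: img h; F o] (img g)); last first.
    have f := indepI nh nLg.
    rewrite -displacement_add_indep // shift_good //.
    apply: (indep_n0 (e := h)).
    by apply: (indep_gen Hhg Hh _ _ f (s := 0) (t := 1) (s' := 1) (t' := - 1)); lmod.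
  have [f [Hf fh fg]] := exists_indep2 nh ng.
  have Hgf : H (g + f) by exact: vsubD.
  have E : D (h + (g + f)) = D h + D g + D f.
    rewrite displacement_add_indep // ?(displacement_add_indep Hg Hf fg) ?addrA //.
    by rewrite addrC; exact: indep_add.
  apply: (addIr (D f)); rewrite -E addrA.
  have [bhg|nhg] := pselect (lspan [:: F o] (img (h + g))).
    rewrite [h + g + f]addrC (shift_bad Hhg Hf) // 1?addrC //.
    exact: indep_n0 (indep_sym fh).
  rewrite shift_good // (@displacement_add_indep (h + g) f) //.
  apply: indepI => // L; apply: (lfree_hd fh).
  apply: (lspan_min _ _ L) => //; split; last by split=> //; in_span.
  have := img_plane (a := 0) (b := h) (c := g) (t := 1) (r := 1) (h := h + g)
    (vsub0 sH) Hh Hg; rewrite img0 => /(_ _) LL.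
  apply: (lspan_min _ _ (LL _)) => //; last by lmod.
  by split; [in_span|split; [in_span|split]].
have [bg|ng] := pselect (lspan [:: F o] (img g)); last first.
  by rewrite addrC mixed // addrC.
have bhg : lspan [:: F o] (img (h + g)).
  have [U sU UP] := affine_preimage (vsubspace_lspan [:: F o]) (lspan_hd _ _).
  by apply/UP => //; apply: (vsubD sU); exact/UP.
apply: (addrI (D d0)); rewrite -(shift_bad Hhg) // !addrA.
rewrite -(shift_bad Hh Hd0) // -(shift_bad Hg) //; first exact: vsubD.
exact: good_add.
Qed.

Lemma shift0 : shift 0 = 0.
Proof.
have H0 := vsub0 sH; have := shiftD H0 H0; rewrite addr0 => E.
by apply: (addrI (shift 0)); rewrite -E addr0.
Qed.

Lemma shift_scale_good d k : H d -> good d -> exists s, shift (k *: d) = s *: shift d.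
Proof.
move=> Hd nd; have [->|k0] := eqVneq k 0.
  by exists 0; rewrite !scale0r shift0.
have [s kD] := displacement_scale Hd nd k0 (DP Hd nd); exists s.
have Hkd : H (k *: d) by exact: vsubZ.
have nkd := outside_scale Hd k0 nd.
by rewrite !shift_good // (displacement_unique Hkd nkd (DP Hkd nkd) kD).
Qed.

(** The scalar of [k] is the same for independent directions, hence for all directions
    that have a displacement, any two of which are independent of a third one. *)
Lemma exists_scale : exists sigma : K -> K',
  forall k h, H h -> shift (k *: h) = sigma k *: shift h.
Proof.
have /choice[sigma sP] : forall k, exists s, shift (k *: d0) = s *: shift d0.
  by move=> k; exact: shift_scale_good.
exists sigma => k h Hh; have [->|k0] := eqVneq k 0.
  have : shift d0 != 0.
    rewrite shift_good //; apply/lfree1P.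
    exact: lfree_tl (displacement_n0 nd0 (DP Hd0 nd0)).
  have := sP 0; rewrite !scale0r shift0 => /esym E D0.
  by rewrite (scalex_eq0 dK' E D0) scale0r.
have indepP d e s : H d -> H e -> indep d e -> shift (k *: d) = s *: shift d ->
    shift (k *: e) = s *: shift e.
  move=> Hd He f Es; have nd := indep_n0 f; have ne := indep_n0 (indep_sym f).
  have [t Et] := shift_scale_good k He ne; rewrite Et.
  have [Hkd Hke] : H (k *: d) /\ H (k *: e) by split; exact: vsubZ.
  have nkd := outside_scale Hd k0 nd; have nke := outside_scale He k0 ne.
  congr (_ *: _); apply/esym.
  apply: (displacement_same_scale Hd He f k0 (DP Hd nd) (DP He ne)).
    by rewrite -(shift_good nd) -Es shift_good //; exact: DP.
  by rewrite -(shift_good ne) -Et shift_good //; exact: DP.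
have goodP d : H d -> good d -> shift (k *: d) = sigma k *: shift d.
  move=> Hd nd; have [e [He f0 fd]] := exists_indep2 nd0 nd.
  exact: (indepP e d _ He Hd (indep_sym fd) (indepP d0 e _ Hd0 He f0 (sP k))).
have [bh|nh] := pselect (lspan [:: F o] (img h)); last exact: goodP.
have n0h := good_add Hd0 Hh nd0 bh; have H0h : H (d0 + h) by exact: vsubD.
apply: (addrI (shift (k *: d0))); rewrite -shiftD; try exact: vsubZ.
by rewrite -scalerDr goodP // shiftD // scalerDr sP.
Qed.

Lemma shift_neq0 : shift d0 != 0.
Proof.
rewrite shift_good //; apply/lfree1P.
exact: lfree_tl (displacement_n0 nd0 (DP Hd0 nd0)).
Qed.

Lemma exists_morphism : exists sigma : {rmorphism K -> K'},
  forall k h, H h -> shift (k *: h) = sigma k *: shift h.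
Proof.
have [s sP] := exists_scale.
have s1 : s 1 = 1.
  by apply: (scalex_inj dK' shift_neq0); rewrite -sP // !scale1r.
have sM a b : s (a * b) = s a * s b.
  apply: (scalex_inj dK' shift_neq0).
  by rewrite -sP // -!scalerA sP ?sP //; exact: vsubZ.
have sB a b : s (a - b) = s a - s b.
  apply: (scalex_inj dK' shift_neq0); apply: (addIr (s b *: shift d0)).
  rewrite -!sP // -shiftD; try exact: vsubZ.
  by rewrite -scalerDl subrK scalerBl -!sP // subrK.
pose m1 := GRing.isZmodMorphism.Build _ _ s sB.
pose m2 := GRing.isMonoidMorphism.Build _ _ s (s1, sM).
pose f : {rmorphism K -> K'} := HB.pack s m1 m2.
by exists f.
Qed.

(** * The extension of an affino-projective map *)

Variable sigma : {rmorphism K -> K'}.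
Hypothesis shiftZ : forall k h, H h -> shift (k *: h) = sigma k *: shift h.

Lemma sigma_neq0 k : k != 0 -> sigma k != 0.
Proof.
move=> k0; apply/eqP => s0; have := rmorph1 sigma.
by rewrite -(mulxV dK k0) rmorphM s0 mul0r => /esym/eqP; rewrite oner_eq0.
Qed.

Lemma image_good d : H d -> good d -> same_line (img d) (F o + shift d).
Proof. by move=> Hd nd; rewrite shift_good //; have [] := DP Hd nd. Qed.

(** The value at [d + h] is on the image of the line through [o] and [o + d], since
    adding [h] to [o] does not leave that line. *)
Lemma shift_bad_on_line h d : H h -> H d -> lspan [:: F o] (img h) -> good d ->
  lspan [:: F o; shift d] (shift h).
Proof.
move=> Hh Hd bh nd; have nhd := good_add Hd Hh nd bh.
have Hdh : H (d + h) by exact: vsubD.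
have [Ld _ _] := DP Hd nd; have [_ Ld' _] := DP Hd nd.
have : lspan [:: F o; img d] (D (d + h)).
  apply: (lspan_min _ _ (displacement_on_line (DP Hdh nhd))) => //.
  split; first by in_span.
  split=> //; have := img_plane (a := 0) (b := d) (c := h) (t := 1) (r := 1) (h := d + h)
    (vsub0 sH) Hd Hh; rewrite img0 => /(_ _) LL.
  apply: (lspan_min _ _ (LL _)) => //; last by lmod.
  split; [in_span|split; [in_span|split=> //]].
  by apply: (lspan_min _ _ bh) => //; split=> //; in_span.
rewrite (shift_bad Hh Hd) // (shift_good nd) => L.
apply: (vsubDr (v := D d) (vsubspace_lspan _)); first by in_span.
apply: (lspan_min _ _ L) => //; split; first by in_span.
split=> //; apply: (lspan_min _ _ Ld') => //; split=> //.
by apply: (vsubD (vsubspace_lspan _)); in_span.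
Qed.

(** By comparison with two independent directions, [shift h] is a multiple [a F o].
    On the line through [o + h] in direction [d0] the images of the points [d0] and
    [k d0] further are known; they coincide exactly when [1 + a = 0], which is the
    case where the map is undefined at [o + h]. *)
Lemma image_bad h : H h -> lspan [:: F o] (img h) -> same_line (img h) (F o + shift h).
Proof.
move=> Hh bh; have [e He f] := exists_indep nd0.
have ne := indep_n0 (indep_sym f).
have f3 : lfree [:: F o; shift d0; shift e].
  by rewrite !shift_good //; apply: displacement_free f; exact: DP.
have /lspan2P[a [b E]] := shift_bad_on_line Hh Hd0 bh nd0.
have /lspan2P[a' [b' E']] := shift_bad_on_line Hh He bh ne.
have [_ b0 _] : [/\ a - a' = 0, b = 0 & - b' = 0].
  apply: (lfree3_coef dK' f3); transitivity (shift h - shift h);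
    last by rewrite subrr.
  by rewrite {1}E E'; lmod.
have {E} E : F o + shift h = (1 + a) *: F o by rewrite E b0; lmod.
have [k k0 k1] := third_scalar.
have [Hkd Hhd] : H (k *: d0) /\ H (h + d0) by split; [exact: vsubZ|exact: vsubD].
have Hhkd : H (h + k *: d0) by exact: vsubD.
have nkd := outside_scale Hd0 k0 nd0.
have [m1 m1'] : same_line (img (h + d0)) ((1 + a) *: F o + shift d0).
  have n : good (h + d0) by rewrite addrC; exact: good_add.
  by have := image_good Hhd n; rewrite shiftD // addrA E.
have [mk mk'] : same_line (img (h + k *: d0)) ((1 + a) *: F o + sigma k *: shift d0).
  have n : good (h + k *: d0) by rewrite addrC; exact: good_add.
  by have := image_good Hhkd n; rewrite shiftD // addrA E shiftZ.
rewrite E; have [Ph0|Ph0] := eqVneq (img h) 0.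
  suff -> : 1 + a = 0 by rewrite Ph0 scale0r; exact: same_line_refl.
  have L : lspan [:: (1 + a) *: F o + shift d0]
      ((1 + a) *: F o + sigma k *: shift d0).
    apply: (lspan_min _ _ mk) => //; split=> //.
    apply: (lspan_min _ _ (img_on_line k Hh Hd0)) => //.
    by rewrite Ph0; split; [exact: vsub0|split].
  have /lspan1P[x Ex] := L.
  have [x1 x2 _] : [/\ (1 + a) - x * (1 + a) = 0, sigma k - x = 0 & 0 = 0 :> K'].
    apply: (lfree3_coef dK' f3); transitivity
      ((1 + a) *: F o + sigma k *: shift d0 - ((1 + a) *: F o + sigma k *: shift d0));
      last by rewrite subrr.
    by rewrite {2}Ex; lmod.
  apply/eqP; apply: contraT => a0.
  have s0 : sigma (1 - k) != 0 by apply: sigma_neq0; rewrite subr_eq0 eq_sym.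
  have := mulx_neq0 dK' s0 a0; rewrite rmorphB rmorph1 (subr0_eq x2).
  by rewrite mulrBl mul1r x1 eqxx.
have a0 : 1 + a != 0.
  apply: contra_neq Ph0 => a0.
  have L : lspan [:: shift d0] (img h).
    have kn : 1 != k by rewrite eq_sym.
    have := img_line_gen2 0 Hh Hd0 kn; rewrite scale0r addr0 scale1r.
    apply: lspan_min => //; split.
      by apply: (lspan_min _ _ m1') => //; rewrite a0 scale0r add0r; split=> //; in_span.
    split=> //; apply: (lspan_min _ _ mk') => //; rewrite a0 scale0r add0r.
    by split=> //; exact: lspan1Z.
  move: L bh => /lspan1P[x ->] /lspan1P[y Exy].
  have [_ x0 _] : [/\ - y = 0, x = 0 & 0 = 0 :> K'].
    apply: (lfree3_coef dK' f3); transitivity (x *: shift d0 - y *: F o).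
      by lmod.
    by rewrite Exy subrr.
  by rewrite x0 scale0r.
apply: (same_line_trans (b := F o)).
  by split=> //; exact: lspan1_sym bh.
by apply: same_line_sym; exact: same_lineZ.
Qed.

Lemma image_shift h : H h -> same_line (img h) (F o + shift h).
Proof.
move=> Hh; have [bh|nh] := pselect (lspan [:: F o] (img h)).
  exact: image_bad.
exact: image_good.
Qed.

Variable g : V -> K.
Hypotheses (gP : forall v, H (v - g v *: o))
  (gD : forall u v, g (u + v) = g u + g v) (gZ : forall s v, g (s *: v) = s * g v)
  (g_eq : forall v s, H (v - s *: o) -> g v = s).

Definition extension v : V' := sigma (g v) *: F o + shift (v - g v *: o).

Lemma extension_semilinear : Defs.semilinear extension.
Proof.
split=> [u v|]; last exists sigma => k v.
  rewrite /extension gD rmorphD.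
  have -> : u + v - (g u + g v) *: o = (u - g u *: o) + (v - g v *: o) by lmod.
  by rewrite shiftD // scalerDl addrACA.
rewrite /extension gZ rmorphM.
have -> : k *: v - (k * g v) *: o = k *: (v - g v *: o) by lmod.
by rewrite shiftZ // scalerDr scalerA.
Qed.

Lemma extension_affine t h : H h -> extension (t *: o + h) = sigma t *: F o + shift h.
Proof.
move=> Hh; have gt : g (t *: o + h) = t by apply: g_eq; rewrite addrC addKr.
by rewrite /extension gt [t *: o + h]addrC addrK.
Qed.

Lemma extension_off v : ~ H v -> same_line (F v) (extension v).
Proof.
move=> nHv; have g0 : g v != 0.
  by apply/eqP => g0; apply: nHv; have := gP v; rewrite g0 scale0r subr0.
pose h := (g v)^-1 *: (v - g v *: o); have Hh : H h by exact: vsubZ.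
have vE : v = g v *: (o + h) by rewrite scalerDr scalexK // addrC subrK.
have Yv : Y v by exact: YH.
have [_ [sig sigP]] := extension_semilinear.
apply: (same_line_trans (b := img h)).
  split; [apply: (F_lspan (l := [:: v])) => //|apply: (F_lspan (l := [:: o + h])) => //].
  - exact: Yo.
  - by rewrite vE; apply/lspan1P; exists (g v)^-1; rewrite scaleKx.
  - by split=> //; exact: Yo.
  - by rewrite [X in lspan _ X]vE; exact: lspan1Z.
apply: (same_line_trans (image_shift Hh)); apply: same_line_sym.
have -> : extension v = sigma (g v) *: (F o + shift h).
  rewrite {1}vE scalerDr extension_affine; last exact: vsubZ.
  by rewrite scalerDr shiftZ.
by apply: (same_lineZ dK'); exact: sigma_neq0.
Qed.

(** If one of the two vectors were not a multiple of the other, exchange would put the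
    values [F o + shift h], for all [h], in the span of the two; but three of these
    values are independent. *)
Lemma extension_on v : Y v -> H v -> same_line (F v) (extension v).
Proof.
move=> Yv Hv; have [e He f] := exists_indep nd0.
have ne := indep_n0 (indep_sym f).
have f3 : lfree [:: F o; shift d0; shift e].
  by rewrite !shift_good //; apply: displacement_free f; exact: DP.
have [extD _] := extension_semilinear.
have key x y : (~ lspan [:: y] x -> forall h, H h -> lspan [:: x; y] (F o + shift h)) ->
    lspan [:: y] x.
  move=> xy; apply: contrapT => nxy.
  have L := xy nxy.
  have Lo : lspan [:: x; y] (F o).
    by have := L 0 (vsub0 sH); rewrite shift0 addr0.
  have c : contains (lspan [:: x; y]) [:: F o; shift d0; shift e].
    split=> //; split; last split=> //.
      by apply: (vsubDr (vsubspace_lspan _) Lo); exact: L.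
    by apply: (vsubDr (vsubspace_lspan _) Lo); exact: L.
  by have := lfree_size dK' f3 c.
have image h : H h -> same_line (img (h + v)) (F o + shift h + extension v).
  move=> Hh; have -> : F o + shift h + extension v = extension (o + (h + v)).
    have E : extension (o + h) = F o + shift h.
      by have := extension_affine 1 Hh; rewrite scale1r rmorph1 scale1r.
    by rewrite -E -extD addrA.
  by apply: extension_off; apply: notHo; exact: vsubD.
have YP h : H h -> Y (o + (h + v)) by move=> Hh; apply: Yo; exact: vsubD.
split; apply: key => nL h Hh; apply: lspan_exchange nL => //.
  have [L _] := image h Hh; have [_ L'] := image_shift Hh.
  apply: (vsubDr (v := F o + shift h) (vsubspace_lspan _)); first by in_span.
  apply: (lspan_min _ _ L) => //; split=> //.
  have : lspan [:: img h; F v] (img (h + v)).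
    apply: (F_lspan (l := [:: o + h; v])); first exact: YP.
      by split; [exact: Yo|].
    by apply: (lspan2I (s := 1) (t := 1)); lmod.
  apply: lspan_min => //; split; last by split=> //; in_span.
  by apply: (lspan_min _ _ L') => //; split=> //; in_span.
have [_ L] := image h Hh; have [_ L'] := image_shift Hh.
have : lspan [:: img (h + v); img h] (F v).
  apply: (F_lspan (l := [:: o + (h + v); o + h])) => //.
    by split; [exact: YP|split=> //; exact: Yo].
  by apply: (lspan2I (s := 1) (t := - 1)); lmod.
apply: lspan_min => //; split.
  apply: (lspan_min _ _ L) => //; split=> //.
  by apply: (vsubD (vsubspace_lspan _)); in_span.
by split=> //; apply: (lspan_min _ _ L') => //; split=> //; in_span.
Qed.

End Extension.

Lemma origin_extension : exists Phi : V -> V', Defs.semilinear Phi /\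
  forall v, Y v -> same_line (F v) (Phi v).
Proof.
have /choice[D DP] : forall d, exists D : V', H d -> ~ lspan [:: F o] (img d) ->
    displacement d D.
  move=> d; have [[Hd nd]|n] := pselect (H d /\ ~ lspan [:: F o] (img d)).
    by have [D DD] := exists_displacement Hd nd; exists D.
  by exists 0 => Hd nd; case: n.
have [d0 Hd0 nd0'] := exists_outside (F o).
have nd0 : ~ lspan [:: F o] (img d0) by move=> L; apply: nd0'; exact: lspan_tl.
have [sigma shiftZ] := exists_morphism DP Hd0 nd0.
have [g [gP gD gZ g_eq]] := hyperplane_functional dK sH Ho (Hmax Ho).
exists (extension D d0 sigma g); split; first exact: extension_semilinear.
move=> v Yv; have [Hv|nHv] := pselect (H v).
  exact: (extension_on DP Hd0 nd0 shiftZ gP gD gZ g_eq).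
exact: (extension_off DP Hd0 nd0 shiftZ gP gD gZ g_eq).
Qed.

End Origin.

(** [Y] is the set of vectors of an affino-projective geometry, and the condition on
    scalars is that there are at least four of them, or that both division rings have
    characteristic three. *)
Theorem affino_projective_extension :
  (exists o, ~ H o) ->
  (forall a b, exists2 v, Y v & ~ lspan [:: a; b] (F v)) ->
  (exists z0 z1 z2 : K, [/\ z0 != 0, z1 != 0 & z2 != 0] /\
     [/\ z0 != z1, z0 != z2 & z1 != z2]) \/
  (1 + 1 + 1 = 0 :> K /\ 1 + 1 + 1 = 0 :> K') ->
  exists Phi : V -> V', Defs.semilinear Phi /\ forall v, Y v -> same_line (F v) (Phi v).
Proof.
move=> [o1 Ho1] rankF scalars.
suff [o Ho Fo] : exists2 o, ~ H o & F o != 0.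
  exact: (origin_extension Ho Fo rankF scalars).
have [v Yv nv] := rankF 0 0.
have Fv : F v != 0 by apply/eqP => E; apply: nv; rewrite E; exact: vsub0.
have [Hv|] := pselect (H v); last by move=> nHv; exists v.
have [F1|F1] := eqVneq (F o1) 0; last by exists o1.
exists (o1 + v); first by move=> /(vsubDl sH Hv).
apply: contra_neq Fv => F2.
have : lspan [:: F (o1 + v); F o1] (F v).
  apply: (F_lspan (l := [:: o1 + v; o1])) => //.
    split; first by apply: YH => /(vsubDl sH Hv).
    by split=> //; exact: YH.
  by apply: (lspan2I (s := 1) (t := - 1)); lmod.
by rewrite F1 F2 => /lspan2P[s [t ->]]; rewrite !scaler0 addr0.
Qed.

End AffinoProjective.

(** * Projection from a point *)

Section Complement.
Variables (K : unitRingType) (dK : division_ring K) (V : lmodType K).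

(** A maximal subspace avoiding [x] is a complement of the line through [x]. *)
Lemma exists_complement (x : V) : x != 0 -> exists W : set V,
  [/\ vsubspace W, ~ W x & forall v, exists s, W (v - s *: x)].
Proof.
move=> x0; pose lin (W : set V) := forall (s : K) u v, W u -> W v -> W (s *: u + v).
have [C CP tot|W [[linW nWx] maxW]] := Zorn_bigcup (P := fun W : set V => lin W /\ ~ W x).
  split=> [s u v [A CA Au] [B CB Bv]|[A /CP[_ nAx] Ax]//].
  have [AB|BA] := tot A B CA CB.
    by exists B => //; have [lB _] := CP B CB; apply: lB => //; exact: AB.
  by exists A => //; have [lA _] := CP A CA; apply: lA => //; exact: BA.
have nz : exists u, W u.
  apply: contrapT => nW; apply: (maxW [set 0]).
    by split=> [u Wu|]; [case: nW; exists u|move=> /(_ 0 erefl) W0; apply: nW; exists 0].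
  split=> [s u v -> ->|]; first by rewrite /= scaler0 addr0.
  by move=> /= E; rewrite E eqxx in x0.
have W0 : W 0 by have [u Wu] := nz; rewrite -(addNr u) -scaleN1r; exact: linW.
have sW : vsubspace W by apply/vsubspaceP; split.
exists W; split=> // v; have [Wv|nWv] := pselect (W v).
  by exists 0; rewrite scale0r subr0.
apply: contrapT => ns; apply: (maxW [set u | exists s, W (u - s *: v)]).
  split=> [u Wu|sub]; first by exists 0; rewrite scale0r subr0.
  by apply: nWv; apply: sub; exists 1; rewrite scale1r subrr.
split=> [s a b [t Wa] [r Wb]|[s Ws]].
  exists (s * t + r); have -> : s *: a + b - (s * t + r) *: v =
    s *: (a - t *: v) + (b - r *: v) by lmod.
  exact: linW.
have s0 : s != 0.
  by apply/eqP => s0; apply: nWx; rewrite s0 scale0r subr0 in Ws.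
apply: ns; exists s^-1; have -> : v - s^-1 *: x = - s^-1 *: (x - s *: v).
  by rewrite scalerBr !scaleNr scaleKx // opprK addrC.
exact: vsubZ.
Qed.

End Complement.

(** * Proportional semilinear maps *)

Section ModuloUniqueness.
Variables (K K' : unitRingType) (dK : division_ring K) (dK' : division_ring K').
Variables (V : lmodType K) (V' : lmodType K').

Lemma lspan_pair_coef (M : seq V') a b s t : ~ lspan M a -> ~ lspan (a :: M) b ->
  lspan M (s *: a + t *: b) -> s = 0 /\ t = 0.
Proof.
move=> na nb L; have t0 : t = 0.
  apply/eqP; apply: contraT => t0; case: nb; exists (- (t^-1 * s)).
  have -> : b - - (t^-1 * s) *: a = t^-1 *: (s *: a + t *: b).
    by rewrite scalerDr scaleKx // scaleNr opprK scalerA addrC.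
  exact: vsubZ.
split=> //; apply/eqP; apply: contraT => s0; case: na.
by apply: (vsubZV dK' _ s0) => //; rewrite t0 scale0r addr0 in L.
Qed.

Variables (Phi1 Phi2 : V -> V') (H : set V) (M : seq V').
Hypotheses (sl1 : Defs.semilinear Phi1) (sl2 : Defs.semilinear Phi2).
Hypothesis sH : vsubspace H.
Hypothesis properH : exists o, ~ H o.
Hypothesis agree : forall v, ~ H v -> exists2 c, c != 0 & lspan M (Phi1 v - c *: Phi2 v).
Hypothesis rank2 : forall a, exists v, ~ lspan (a :: M) (Phi2 v).
Hypothesis third : exists2 k : K, k != 0 & k != 1.

Let sigma := projT1 (cid sl2.2).
Let sigmaP k v : Phi2 (k *: v) = sigma k *: Phi2 v.
Proof. exact: (projT2 (cid sl2.2)). Qed.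

Lemma semilinear_B (Phi : V -> V') u v : Defs.semilinear Phi ->
  Phi (u - v) = Phi u - Phi v.
Proof. by move=> [PD [s sP]]; rewrite -scaleN1r PD sP rmorphN1 scaleN1r. Qed.

Lemma exists_outside_mod a : exists2 v, ~ H v & ~ lspan (a :: M) (Phi2 v).
Proof.
apply: contrapT => nv; have [v nL] := rank2 a; apply: nL.
have L u : ~ H u -> lspan (a :: M) (Phi2 u).
  by move=> nHu; apply: contrapT => nL; apply: nv; exists u.
have [Hv|/L //] := pselect (H v); have [o Ho] := properH.
have -> : v = (o + v) - o by rewrite addrC addKr.
rewrite (semilinear_B _ _ sl2); apply: (vsubB (vsubspace_lspan _)); apply: L => //.
by move=> /(vsubDl sH Hv).
Qed.

Section Base.
Variable c : K'.

Let E v := lspan M (Phi1 v - c *: Phi2 v).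

Lemma agreeB u v : E u -> E v -> E (u - v).
Proof.
move=> Eu Ev; rewrite /E !semilinear_B //.
have -> : Phi1 u - Phi1 v - c *: (Phi2 u - Phi2 v) =
  (Phi1 u - c *: Phi2 u) - (Phi1 v - c *: Phi2 v) by lmod.
exact: vsubB.
Qed.

(** The factors at [v] and [u + v] are compared through the coefficients of [Phi2 u]
    and [Phi2 v], which are independent. *)
Lemma agree_transfer u v : E u -> ~ H v -> ~ H (u + v) ->
  ~ lspan M (Phi2 u) -> ~ lspan (Phi2 u :: M) (Phi2 v) -> E v.
Proof.
move=> Eu nHv nHuv nu nv.
have [r r0 Lr] := agree nHv; have [t t0 Lt] := agree nHuv.
have L : lspan M ((t - c) *: Phi2 u + (t - r) *: Phi2 v).
  have -> : (t - c) *: Phi2 u + (t - r) *: Phi2 v = (Phi1 u - c *: Phi2 u)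
    + (Phi1 v - r *: Phi2 v) - (Phi1 (u + v) - t *: Phi2 (u + v)).
    by rewrite sl1.1 sl2.1; lmod.
  by apply: vsubB => //; exact: vsubD.
have [tc tr] := lspan_pair_coef nu nv L.
by rewrite /E -(subr0_eq tc) (subr0_eq tr).
Qed.

Lemma agree_independent b v : E b -> ~ H b -> ~ H v -> ~ lspan M (Phi2 b) ->
  ~ lspan (Phi2 b :: M) (Phi2 v) -> E v.
Proof.
move=> Eb nHb nHv nb nv; have [Hbv|nHbv] := pselect (H (b + v)); last first.
  exact: (agree_transfer Eb).
(* [b + v] may be in [H]; then pass through [v + m b] and back. *)
have [m m0 m1] := third.
have shifted s : s != 0 -> ~ H (s *: b + (b + v)).
  by move=> s0 /(vsubDl sH Hbv) /(vsubZV dK sH s0).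
have sm0 : sigma m != 0.
  apply/eqP => s0; have := rmorph1 sigma.
  by rewrite -(mulxV dK m0) rmorphM s0 mul0r => /esym/eqP; rewrite oner_eq0.
have vE : v + m *: b = (m - 1) *: b + (b + v) by lmod.
have P' : Phi2 (v + m *: b) = Phi2 v + sigma m *: Phi2 b by rewrite sl2.1 sigmaP.
have nv' : ~ lspan (Phi2 b :: M) (Phi2 (v + m *: b)).
  rewrite P' => L; apply: nv; apply: (vsubDl (vsubspace_lspan _) _ L).
  by apply: (vsubZ _ (vsubspace_lspan _)); exact: lspan_hd.
have Ev' : E (v + m *: b).
  apply: (agree_transfer Eb) => //.
    by rewrite vE; apply: shifted; rewrite subr_eq0.
  have -> : b + (v + m *: b) = m *: b + (b + v) by lmod.
  exact: shifted.
have E0 : E 0 by rewrite -(subrr b); exact: agreeB.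
apply: (agree_transfer (u := - (v + m *: b))) => //.
- by rewrite -[- _]sub0r; exact: agreeB.
- have -> : - (v + m *: b) + v = - m *: b by lmod.
  by move=> /(vsubZV dK sH) Hb; apply: nHb; apply: Hb; rewrite oppr_eq0.
- rewrite -[- _]sub0r semilinear_B // -{1}(subrr b) semilinear_B // subrr sub0r.
  move=> /(vsubN (vsubspace_lspan _)); rewrite opprK => L.
  by apply: nv'; exact: lspan_tl.
move=> [s]; rewrite -[- (v + _)]sub0r semilinear_B // -{1}(subrr b) semilinear_B //.
rewrite subrr sub0r P' => L.
have L' : lspan M ((s * sigma m) *: Phi2 b + (1 + s) *: Phi2 v).
  have -> // : (s * sigma m) *: Phi2 b + (1 + s) *: Phi2 v =
     Phi2 v - s *: - (Phi2 v + sigma m *: Phi2 b) by lmod.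
have [sm s1] := lspan_pair_coef nb nv L'.
have : s != 0.
  by apply/eqP => s0; move/eqP: s1; rewrite s0 addr0 oner_eq0.
by move=> s0; have := mulx_neq0 dK' s0 sm0; rewrite sm eqxx.
Qed.

End Base.

(** The factor at a vector [o] outside [H] is also the factor at every vector whose
    image is independent of that of [o]; through one of these it is the factor at
    the remaining vectors outside [H], and these generate [V]. *)
Lemma proportional_mod : exists2 c, c != 0 & forall v, lspan M (Phi1 v - c *: Phi2 v).
Proof.
have [o nHo nLo] := exists_outside_mod 0.
have {}nLo : ~ lspan M (Phi2 o) by move=> L; apply: nLo; exact: lspan_tl.
have [c c0 Eo] := agree nHo; exists c => //.
have E_off v : ~ H v -> lspan M (Phi1 v - c *: Phi2 v).
  move=> nHv; have [Lv|nLv] := pselect (lspan M (Phi2 v)).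
    have [r r0 Lr] := agree nHv.
    apply: (vsubB (vsubspace_lspan _)); last exact: vsubZ.
    rewrite -(subrK (r *: Phi2 v) (Phi1 v)); apply: vsubD => //; exact: vsubZ.
  have [Lov|] := pselect (lspan (Phi2 o :: M) (Phi2 v)); last first.
    exact: (agree_independent Eo).
  have [w nHw nLw] := exists_outside_mod (Phi2 o).
  have Ew := agree_independent Eo nHo nHw nLo nLw.
  have nw : ~ lspan M (Phi2 w) by move=> L; apply: nLw; exact: lspan_tl.
  apply: (agree_independent Ew nHw nHv nw) => L; apply: nLw.
  have wv := lspan_exchange dK' L nLv.
  apply: (lspan_min _ _ wv) => //; split=> //.
  by apply: contains_sub (lspan_contains M) => u; exact: lspan_tl.
move=> v; have [Hv|/E_off //] := pselect (H v).
have -> : v = (o + v) - o by rewrite addrC addKr.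
by apply: agreeB => //; apply: E_off => /(vsubDl sH Hv).
Qed.

End ModuloUniqueness.

(** * Gluing the local extensions *)

Section Gluing.
Variables (K K' : unitRingType) (dK : division_ring K) (dK' : division_ring K').
Variables (V : lmodType K) (V' : lmodType K') (X : set V) (f : V -> V').
Hypothesis f0 : forall v, X v -> f v != 0.
Hypothesis mor : forall W' : set V', vsubspace W' ->
  exists2 W : set V, vsubspace W & forall v, X v -> (W' (f v) <-> W v).
Hypothesis locX : forall x, X x -> exists H : set V,
  [/\ vsubspace H, exists o, ~ H o,
      forall o, ~ H o -> forall v, exists t, H (v - t *: o) &
      forall v, ~ H v -> exists a, X (v + a *: x)].
Hypothesis rankf : forall a b c, exists2 v, X v & ~ lspan [:: a; b; c] (f v).
Hypothesis scalars :
  (exists z0 z1 z2 : K, [/\ z0 != 0, z1 != 0 & z2 != 0] /\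
     [/\ z0 != z1, z0 != z2 & z1 != z2]) \/
  (1 + 1 + 1 = 0 :> K /\ 1 + 1 + 1 = 0 :> K').

(** After division by [f x] the map [Phi] induces the same partial map as [f]; since
    [c] is not zero, the two are undefined at the same points. *)
Definition adapted (x : V) (Phi : V -> V') :=
  forall z, X z -> exists2 c, c != 0 & lspan [:: f x] (f z - c *: Phi z).

(** The projection [pr] along a complement of [f x] replaces the quotient by [f x].
    The induced map depends only on classes modulo [x], so it is defined on [Y],
    which contains the complement of a hyperplane. *)
Lemma local_extension x : X x -> exists2 Phi, Defs.semilinear Phi & adapted x Phi.
Proof.
move=> Xx; have [H [sH properH Hmax XH]] := locX Xx.
have [C [sC nCx Cmax]] := exists_complement dK' (f0 Xx).
have [g [gP gD gZ g_eq]] := hyperplane_functional dK' sC nCx Cmax.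
pose pr u := u - g u *: f x.
have prD u v : pr (u + v) = pr u + pr v by rewrite /pr gD; lmod.
have prZ s v : pr (s *: v) = s *: pr v by rewrite /pr gZ; lmod.
have gx : g (f x) = 1 by apply: g_eq; rewrite scale1r subrr; exact: vsub0.
have prx : pr (f x) = 0 by rewrite /pr gx scale1r subrr.
pose Y : set V := [set v | exists a, X (v + a *: x)].
have XY v : X v -> Y v by move=> Xv; exists 0; rewrite scale0r addr0.
have /choice[F FP] : forall v, exists w, (X v -> w = pr (f v)) /\
    (Y v -> exists2 a, X (v + a *: x) & w = pr (f (v + a *: x))).
  move=> v; have [Xv|nXv] := pselect (X v).
    by exists (pr (f v)); split=> // _; exists 0; rewrite scale0r addr0.
  have [[a Xa]|nYv] := pselect (Y v).
    by exists (pr (f (v + a *: x))); split=> // _; exists a.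
  by exists 0.
have morF (W' : set V') : vsubspace W' ->
    exists2 W : set V, vsubspace W & forall v, Y v -> (W' (F v) <-> W v).
  move=> sW'; have sW'' : vsubspace [set u | W' (pr u)].
    apply/vsubspaceP; split; first by rewrite /= -(scale0r (f x)) prZ scale0r; exact: vsub0.
    by move=> s u v Wu Wv; rewrite /= prD prZ; exact: vsubL.
  have [W sW WP] := mor sW''; exists W => // v Yv.
  have Wx : W x by apply/WP => //; rewrite /= prx; exact: vsub0.
  have [a Xa ->] := (FP v).2 Yv.
  have Wax : W (a *: x) by exact: vsubZ.
  rewrite -[W' _]/([set u | W' (pr u)] (f (v + a *: x))) WP //.
  by split=> [/(vsubDl sW Wax)|Wv]; last exact: vsubD.
have rankF a b : exists2 v, Y v & ~ lspan [:: a; b] (F v).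
  have [v Xv nv] := rankf a b (f x); exists v; first exact: XY.
  rewrite ((FP v).1 Xv) => L; apply: nv; rewrite -(subrK (g (f v) *: f x) (f v)).
  apply: (vsubD (vsubspace_lspan _)).
    by apply: (lspan_min _ _ L) => //; split; [in_span|split=> //; in_span].
  by apply: (vsubZ _ (vsubspace_lspan _)); in_span.
have [Phi [slPhi PhiP]] := affino_projective_extension dK dK' sH Hmax XH morF properH rankF scalars.
exists Phi => // z Xz; have := PhiP z (XY z Xz); rewrite ((FP z).1 Xz) => sl.
have fz : f z = pr (f z) + g (f z) *: f x by rewrite subrK.
have [E|n0] := eqVneq (pr (f z)) 0.
  exists 1; first exact: oner_neq0.
  have := sl; rewrite E => -[/lspan1P[s ->] _].
  by rewrite fz E scaler0 scaler0 subr0 add0r; exact: lspan1Z.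
have [s s0 Es] := same_lineP n0 sl; exists s => //.
by rewrite -Es /pr opprB addrC subrK; exact: lspan1Z.
Qed.

Let third := third_scalar scalars.

(** Modulo [M] both maps vanish at [x], so they take at [v] the value that they take at
    a vector of [X] congruent to [v] modulo [x]; there they are proportional to [f]. *)
Lemma adapted_proportional (M : seq V') x (Phi1 Phi2 : V -> V') :
  X x -> lspan M (f x) -> (size M <= 2)%N ->
  Defs.semilinear Phi1 -> Defs.semilinear Phi2 ->
  (forall z, X z -> exists2 c, c != 0 & lspan M (f z - c *: Phi1 z)) ->
  (forall z, X z -> exists2 c, c != 0 & lspan M (f z - c *: Phi2 z)) ->
  exists2 c, c != 0 & forall v, lspan M (Phi1 v - c *: Phi2 v).
Proof.
move=> Xx Mx sM sl1 sl2 ad1 ad2; have [H [sH properH Hmax XH]] := locX Xx.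
have at_x Phi : (forall z, X z -> exists2 c, c != 0 & lspan M (f z - c *: Phi z)) ->
    lspan M (Phi x).
  move=> ad; have [c c0 L] := ad x Xx; apply: (vsubZV dK' _ c0) => //.
  rewrite -[_ *: _](subKr (f x)); exact: vsubB.
have rank2 a : exists v, ~ lspan (a :: M) (Phi2 v).
  have [b [c sub]] : exists b c, lspan M `<=` lspan [:: b; c].
    case: (M) sM => [|b [|c [|//]]] _.
    - by exists 0, 0 => v ->; exact: vsub0.
    - by exists b, 0; apply: lspan_min => //; split=> //; in_span.
    - by exists b, c.
  have [z Xz nz] := rankf a b c; exists z => L; apply: nz.
  have [r r0 Lr] := ad2 z Xz; rewrite -(subrK (r *: Phi2 z) (f z)).
  apply: (vsubD (vsubspace_lspan _)); first exact: lspan_tl (sub _ Lr).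
  apply: (vsubZ _ (vsubspace_lspan _)); apply: (lspan_min _ _ L) => //.
  split; first by in_span.
  by apply: contains_sub (lspan_contains M) => u /sub; exact: lspan_tl.
apply: (proportional_mod dK dK' sl1 sl2 sH properH _ rank2 third) => v nHv.
have [a Xa] := XH v nHv.
have [c1 c10 L1] := ad1 _ Xa; have [c2 c20 L2] := ad2 _ Xa.
have [s1 s1P] := sl1.2; have [s2 s2P] := sl2.2.
exists (c1^-1 * c2).
  by apply: (mulx_neq0 dK') => //; exact: (invx_neq0 dK').
have L : lspan M (Phi1 (v + a *: x) - (c1^-1 * c2) *: Phi2 (v + a *: x)).
  apply: (vsubZV dK' (s := c1)) => //.
  rewrite scalerBr !scalerA mulrA mulxV // mul1r.
  have -> : c1 *: Phi1 (v + a *: x) - c2 *: Phi2 (v + a *: x) =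
    (f (v + a *: x) - c2 *: Phi2 (v + a *: x)) -
    (f (v + a *: x) - c1 *: Phi1 (v + a *: x)) by lmod.
  exact: vsubB.
have -> : Phi1 v - (c1^-1 * c2) *: Phi2 v =
   (Phi1 (v + a *: x) - (c1^-1 * c2) *: Phi2 (v + a *: x)) -
   (s1 a *: Phi1 x - (c1^-1 * c2) *: (s2 a *: Phi2 x)).
  by rewrite sl1.1 sl2.1 s1P s2P; lmod.
apply: vsubB => //; apply: vsubB => //; apply: vsubZ => //; first exact: at_x.
by apply: vsubZ => //; exact: at_x.
Qed.

Lemma adapted_sub (M : seq V') x Phi : adapted x Phi -> lspan M (f x) ->
  forall z, X z -> exists2 c, c != 0 & lspan M (f z - c *: Phi z).
Proof.
move=> ad Mx z /ad[c c0 L]; exists c => //.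
by apply: (lspan_min _ _ L) => //; split.
Qed.

(** The ring morphism is conjugated by [c]. *)
Lemma semilinearZ (Phi : V -> V') c : c != 0 -> Defs.semilinear Phi ->
  Defs.semilinear (fun v => c *: Phi v).
Proof.
move=> c0 [PD [s sP]]; split=> [u v|]; first by rewrite PD scalerDr.
pose t k := c * s k * c^-1.
have tB a b : t (a - b) = t a - t b by rewrite /t rmorphB mulrBr mulrBl.
have t1 : t 1 = 1 by rewrite /t rmorph1 mulr1 mulxV.
have tM a b : t (a * b) = t a * t b.
  by rewrite /t rmorphM !mulrA mulrVK //; exact: dK'.
pose m1 := GRing.isZmodMorphism.Build _ _ t tB.
pose m2 := GRing.isMonoidMorphism.Build _ _ t (t1, tM).
pose tm : {rmorphism K -> K'} := HB.pack t m1 m2.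
exists tm => a v; rewrite sP !scalerA; congr (_ *: _).
by rewrite /tm /= /t mulrVK //; exact: dK'.
Qed.

Lemma lspan_meet1 (a b u : V') : ~ lspan [:: a] b -> a != 0 ->
  lspan [:: a] u -> lspan [:: b] u -> u = 0.
Proof.
move=> nb a0 /lspan1P[s ->] /lspan1P[t E].
have fr : lfree [:: b; a] by split=> //; apply/lfree1P.
have [t0 _] : - t = 0 /\ s = 0.
  apply: (lfree2_coef dK' fr); transitivity (s *: a - t *: b); first by lmod.
  by rewrite E subrr.
by rewrite E -[t]opprK t0 oppr0 scale0r.
Qed.

Lemma exists_outside2 (M : seq V') : (size M <= 3)%N -> exists2 v, X v & ~ lspan M (f v).
Proof.
move=> sM; have [a [b [c sub]]] : exists a b c, lspan M `<=` lspan [:: a; b; c].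
  case: M sM => [|a [|b [|c [|//]]]] _.
  - by exists 0, 0, 0 => v ->; exact: vsub0.
  - by exists a, 0, 0; apply: lspan_min => //; split=> //; in_span.
  - by exists a, b, 0; apply: lspan_min => //; split; [in_span|split=> //; in_span].
  - by exists a, b, c.
by have [v Xv nv] := rankf a b c; exists v => // /sub.
Qed.

(** [V'] is the fibre product of its quotients by two distinct points over the
    quotient by the line joining them. *)
Lemma glue x y : X x -> X y -> ~ lspan [:: f x] (f y) ->
  exists Phi, [/\ Defs.semilinear Phi, adapted x Phi & adapted y Phi].
Proof.
move=> Xx Xy nxy; pose M := [:: f x; f y].
have [Mx My] : lspan M (f x) /\ lspan M (f y) by split; in_span.
have [Phix slx adx] := local_extension Xx; have [Phiy0 sly0 ady0] := local_extension Xy.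
have [c c0 cP] := adapted_proportional Xx Mx isT slx sly0 (adapted_sub adx Mx) (adapted_sub ady0 My).
pose Phiy v := c *: Phiy0 v; have sly : Defs.semilinear Phiy by exact: semilinearZ.
have ady : adapted y Phiy.
  move=> z /ady0[r r0 L]; exists (r * c^-1).
    by apply: (mulx_neq0 dK') => //; exact: (invx_neq0 dK').
  by rewrite /Phiy scalerA mulrVK //; exact: dK'.
have /choice[Phi PhiP] : forall v, exists w,
    lspan [:: f x] (w - Phix v) /\ lspan [:: f y] (w - Phiy v).
  move=> v; have /lspan2P[a [b E]] := cP v; exists (Phix v - a *: f x).
  split; apply/lspan1P; [exists (- a)|exists b]; first by lmod.
  by apply: (lincomb (z := Phix v - c *: Phiy0 v - (a *: f x + b *: f y)));
    [rewrite E subrr|rewrite /Phiy; lmod].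
have uniq v w w' : lspan [:: f x] (w - Phix v) -> lspan [:: f y] (w - Phiy v) ->
    lspan [:: f x] (w' - Phix v) -> lspan [:: f y] (w' - Phiy v) -> w = w'.
  move=> Lx Ly Lx' Ly'; apply: subr0_eq; apply: (lspan_meet1 nxy (f0 Xx)).
    have -> : w - w' = (w - Phix v) - (w' - Phix v) by rewrite opprB addrA subrK.
    exact: vsubB.
  have -> : w - w' = (w - Phiy v) - (w' - Phiy v) by rewrite opprB addrA subrK.
  exact: vsubB.
have [sx sxP] := slx.2; have [sy syP] := sly.2.
have sxy k : sx k = sy k.
  have [z Xz nz] := exists_outside2 (M := M) isT; have [r r0 L] := adx z Xz.
  have nPz : ~ lspan M (Phix z).
    move=> LP; apply: nz; rewrite -(subrK (r *: Phix z) (f z)).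
    apply: vsubD => //; last exact: vsubZ.
    by apply: (lspan_min _ _ L) => //; split.
  apply: subr0_eq; apply/eqP; apply: contraT => s0; case: nPz.
  apply: (vsubZV dK' _ s0) => //.
  have -> : (sx k - sy k) *: Phix z = (Phix (k *: z) - Phiy (k *: z)) -
      sy k *: (Phix z - Phiy z) by rewrite sxP syP; lmod.
  by apply: vsubB; [exact: vsubspace_lspan|exact: cP|apply: vsubZ => //; exact: cP].
exists Phi; split.
- split=> [u v|]; last exists sx => k v.
    have [ux uy] := PhiP u; have [vx vy] := PhiP v; have [wx wy] := PhiP (u + v).
    apply: (uniq _ _ _ wx wy).
      by rewrite slx.1 opprD addrACA; exact: vsubD.
    by rewrite sly.1 opprD addrACA; exact: vsubD.
  have [vx vy] := PhiP v; have [wx wy] := PhiP (k *: v).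
  apply: (uniq _ _ _ wx wy).
    by rewrite sxP -scalerBr; exact: vsubZ.
  by rewrite syP -sxy -scalerBr; exact: vsubZ.
- move=> z Xz; have [r r0 L] := adx z Xz; exists r => //.
  have -> : f z - r *: Phi z = (f z - r *: Phix z) - r *: (Phi z - Phix z) by lmod.
  by apply: vsubB => //; apply: vsubZ => //; have [] := PhiP z.
- move=> z Xz; have [r r0 L] := ady z Xz; exists r => //.
  have -> : f z - r *: Phi z = (f z - r *: Phiy z) - r *: (Phi z - Phiy z) by lmod.
  by apply: vsubB => //; apply: vsubZ => //; have [] := PhiP z.
Qed.

Lemma combine_scales (M1 M2 : seq V') u v a c1 c2 (Phi1 Phi2 : V -> V') z :
  ~ lspan [:: a; u; v] (Phi2 z) ->
  lspan M1 (Phi1 z - c1 *: Phi2 z) -> lspan M2 (Phi1 z - c2 *: Phi2 z) ->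
  lspan M1 `<=` lspan [:: a; u; v] -> lspan M2 `<=` lspan [:: a; u; v] -> c1 = c2.
Proof.
move=> nz L1 L2 /(_ _ L1) S1 /(_ _ L2) S2.
apply: subr0_eq; apply/eqP; apply: contraT => c0; case: nz.
apply: (vsubZV dK' _ c0) => //.
have -> : (c1 - c2) *: Phi2 z = (Phi1 z - c2 *: Phi2 z) - (Phi1 z - c1 *: Phi2 z).
  by lmod.
exact: vsubB.
Qed.

Lemma adapted_outside (M : seq V') x Phi : adapted x Phi -> lspan M (f x) ->
  (size M <= 3)%N -> exists z, ~ lspan M (Phi z).
Proof.
move=> ad Mx /exists_outside2[z Xz nz]; exists z => L; apply: nz.
have [c c0 Lc] := adapted_sub ad Mx Xz; rewrite -(subrK (c *: Phi z) (f z)).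
by apply: vsubD => //; exact: vsubZ.
Qed.

(** The map glued from [x] and [y] is compared with the local map at a third point [w]
    modulo the lines joining [f w] to [f x] and to [f y]; the two factors coincide,
    because they do so modulo a plane, so the glued map is adapted to [w] too.  Then
    [f z] is on the three lines joining [Phi z] to [f x], [f y], [f w], which are not
    collinear. *)
Theorem global_extension : exists2 Phi, Defs.semilinear Phi &
  forall z, X z -> exists2 c, c != 0 & f z = c *: Phi z.
Proof.
have [x Xx _] := exists_outside2 (M := [::]) isT.
have [y Xy nxy] := exists_outside2 (M := [:: f x]) isT.
have [w Xw nw] := exists_outside2 (M := [:: f y; f x]) isT.
have fr : lfree [:: f w; f y; f x] by split=> //; split=> //; apply/lfree1P; exact: f0.
have [Phi [sl adx ady]] := glue Xx Xy nxy.
have [Phiw slw adw] := local_extension Xw.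
have [M1x M1w] : lspan [:: f w; f x] (f x) /\ lspan [:: f w; f x] (f w) by split; in_span.
have [M2y M2w] : lspan [:: f w; f y] (f y) /\ lspan [:: f w; f y] (f w) by split; in_span.
have [c1 c10 L1] := adapted_proportional Xx M1x isT sl slw (adapted_sub adx M1x) (adapted_sub adw M1w).
have [c2 c20 L2] := adapted_proportional Xy M2y isT sl slw (adapted_sub ady M2y) (adapted_sub adw M2w).
have [z0 nz0] : exists z, ~ lspan [:: f w; f y; f x] (Phiw z).
  by apply: (adapted_outside adw) => //; in_span.
have c12 : c1 = c2.
  apply: (combine_scales nz0 (L1 z0) (L2 z0)); apply: lspan_min => //.
    by split; [in_span|split=> //; in_span].
  by split; [in_span|split=> //; in_span].
have meet u : lspan [:: f w; f x] u -> lspan [:: f w; f y] u -> lspan [:: f w] u.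
  move=> /lspan2P[a [b E]] /lspan2P[a' [b' E']].
  have [_ _ b0] : [/\ a - a' = 0, - b' = 0 & b = 0].
    apply: (lfree3_coef dK' fr); transitivity (u - u); last by rewrite subrr.
    by rewrite {1}E E'; lmod.
  by rewrite E b0 scale0r addr0; exact: lspan1Z.
have adw' : adapted w Phi.
  move=> z Xz; have [r r0 L] := adw z Xz; exists (r * c1^-1).
    by apply: (mulx_neq0 dK') => //; exact: (invx_neq0 dK').
  have -> : f z - (r * c1^-1) *: Phi z =
      (f z - r *: Phiw z) - (r * c1^-1) *: (Phi z - c1 *: Phiw z).
    have E : (r * c1^-1 * c1) = r by rewrite mulrVK //; exact: dK'.
    by rewrite -{2}E; lmod.
  apply: vsubB => //; apply: vsubZ => //; apply: meet => //.
  by rewrite c12; exact: L2.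
exists Phi => // z Xz.
have [r r0 /lspan1P[a Ea]] := adx z Xz; have [s s0 /lspan1P[b Eb]] := ady z Xz.
have [t t0 /lspan1P[d Ed]] := adw' z Xz.
have fzE (k k' : K') (p q : V') (i j : K') : f z - k *: Phi z = i *: p ->
    f z - k' *: Phi z = j *: q -> (k - k') *: Phi z = j *: q - i *: p.
  by move=> <- <-; lmod.
have rs := fzE _ _ _ _ _ _ Ea Eb; have rt := fzE _ _ _ _ _ _ Ea Ed.
have st := fzE _ _ _ _ _ _ Eb Ed.
have finish k i p : k != 0 -> f z - k *: Phi z = i *: p -> i = 0 ->
    exists2 c, c != 0 & f z = c *: Phi z.
  by move=> k0 E i0; exists k => //; apply: subr0_eq; rewrite E i0 scale0r.
have [rs0|rsn] := eqVneq (r - s) 0.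
  have [_ _ a0] : [/\ 0 = 0 :> K', b = 0 & - a = 0].
    by apply: (lfree3_coef dK' fr); transitivity ((r - s) *: Phi z);
      [rewrite rs; lmod|rewrite rs0 scale0r].
  by apply: (finish r a (f x)) => //; rewrite -[a]opprK a0 oppr0.
have [rt0|rtn] := eqVneq (r - t) 0.
  have [_ _ a0] : [/\ d = 0, 0 = 0 :> K' & - a = 0].
    by apply: (lfree3_coef dK' fr); transitivity ((r - t) *: Phi z);
      [rewrite rt; lmod|rewrite rt0 scale0r].
  by apply: (finish r a (f x)) => //; rewrite -[a]opprK a0 oppr0.
have [st0|stn] := eqVneq (s - t) 0.
  have [_ b0 _] : [/\ d = 0, - b = 0 & 0 = 0 :> K'].
    by apply: (lfree3_coef dK' fr); transitivity ((s - t) *: Phi z);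
      [rewrite st; lmod|rewrite st0 scale0r].
  by apply: (finish s b (f y)) => //; rewrite -[b]opprK b0 oppr0.
(* The three scalars are distinct: [Phi z] is on the three sides of a triangle. *)
have Lrs : lspan [:: f y; f x] (Phi z).
  by apply: (vsubZV dK' _ rsn) => //; rewrite rs; apply: (lspan2I (s := b) (t := - a)); lmod.
have Lrt : lspan [:: f w; f x] (Phi z).
  by apply: (vsubZV dK' _ rtn) => //; rewrite rt; apply: (lspan2I (s := d) (t := - a)); lmod.
have Lst : lspan [:: f w; f y] (Phi z).
  by apply: (vsubZV dK' _ stn) => //; rewrite st; apply: (lspan2I (s := d) (t := - b)); lmod.
have Phi0 : Phi z = 0.
  apply/eqP; apply: contraT => n0; case: nw.
  have := lspan1_sym dK' n0 (meet _ Lrt Lst).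
  by apply: lspan_min => //; split.
apply: (finish r a (f x)) => //.
have [_ _ a0] : [/\ 0 = 0 :> K', b = 0 & - a = 0].
  by apply: (lfree3_coef dK' fr); transitivity ((r - s) *: Phi z);
    [rewrite rs; lmod|rewrite Phi0 scaler0].
by rewrite -[a]opprK a0 oppr0.
Qed.

(** The two maps are proportional modulo [f x] and modulo [f y]; the factors coincide,
    because they do so modulo a line, so the maps are proportional modulo zero. *)
Theorem global_uniqueness (Phi1 Phi2 : V -> V') :
  Defs.semilinear Phi1 -> Defs.semilinear Phi2 ->
  (forall z, X z -> exists2 c, c != 0 & f z = c *: Phi1 z) ->
  (forall z, X z -> exists2 c, c != 0 & f z = c *: Phi2 z) ->
  exists2 c, c != 0 & forall v, Phi1 v = c *: Phi2 v.
Proof.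
move=> sl1 sl2 ex1 ex2.
have ad (M : seq V') Phi : (forall z, X z -> exists2 c, c != 0 & f z = c *: Phi z) ->
    forall z, X z -> exists2 c, c != 0 & lspan M (f z - c *: Phi z).
  by move=> ex z /ex[c c0 E]; exists c => //; rewrite E subrr; exact: vsub0.
have [x Xx _] := exists_outside2 (M := [::]) isT.
have [y Xy nxy] := exists_outside2 (M := [:: f x]) isT.
have [c1 c10 L1] := adapted_proportional Xx (lspan_hd (f x) [::]) isT sl1 sl2 (ad _ _ ex1) (ad _ _ ex2).
have [c2 c20 L2] := adapted_proportional Xy (lspan_hd (f y) [::]) isT sl1 sl2 (ad _ _ ex1) (ad _ _ ex2).
have [z0 nz0] : exists z, ~ lspan [:: f x; f x; f y] (Phi2 z).
  by apply: (adapted_outside (x := x) (ad _ _ ex2)) => //; in_span.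
have c12 : c1 = c2.
  by apply: (combine_scales nz0 (L1 z0) (L2 z0)); apply: lspan_min => //; split=> //; in_span.
exists c1 => // v; apply: subr0_eq; apply: (lspan_meet1 nxy (f0 Xx)) => //.
by rewrite c12.
Qed.

End Gluing.

(** * Cardinality of the division ring *)

Section Cardinality.

Lemma card_ge_inj (T : Type) n (B : set T) : `I_n #<= B ->
  exists2 s : 'I_n -> T, injective s & forall i, B (s i).
Proof.
case/card_leP => g.
have gP (i : 'I_n) : (i : nat) \in `I_n by rewrite inE /= ltn_ord.
pose x (i : 'I_n) : `I_n := exist _ (i : nat) (gP i).
exists (fun i => val (g (x i))) => [i j /val_inj E|i]; last exact: set_valP.
have /(congr1 val) /= : x i = x j by apply: (inj _ _ E); rewrite inE.
exact: val_inj.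
Qed.

Lemma card_le_inj (T : Type) n : [set: T] #<= `I_n ->
  exists2 h : T -> nat, injective h & forall x, (h x < n)%N.
Proof.
case/card_leP => g.
have gP (y : T) : y \in [set: T] by rewrite inE.
pose x y : [set: T] := exist _ y (gP y).
exists (fun y => val (g (x y))) => [y z /val_inj E|y].
  have /(congr1 val) // : x y = x z by apply: (inj _ _ E); rewrite inE.
exact: (set_valP (g (x y))).
Qed.

(** The differences of one scalar with three others are distinct and not zero; a
    division ring with three elements has characteristic three. *)
Lemma scalars_of_card (K K' : unitRingType) :
  `I_4 #<= [set: K] \/ [set: K] #= `I_3 /\ 3%N \in [pchar K'] ->
  (exists z0 z1 z2 : K, [/\ z0 != 0, z1 != 0 & z2 != 0] /\
     [/\ z0 != z1, z0 != z2 & z1 != z2]) \/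
  (1 + 1 + 1 = 0 :> K /\ 1 + 1 + 1 = 0 :> K').
Proof.
move=> [/card_ge_inj[s s_inj _]|[]].
  left; have neq (i j : 'I_4) : i != j -> s i - s ord0 != s j - s ord0.
    by apply: contra_neq => /addIr /s_inj.
  have neq0 (i : 'I_4) : i != ord0 -> s i - s ord0 != 0.
    by rewrite subr_eq0; apply: contra_neq => /s_inj.
  exists (s (inord 1) - s ord0), (s (inord 2) - s ord0), (s (inord 3) - s ord0).
  by split; split; first [apply: neq0|apply: neq]; rewrite -val_eqE /= ?inordK.
rewrite card_eq_le => /andP[/card_le_inj[h h_inj h3] /card_ge_inj[s s_inj _]] ch3.
right; split; last first.
  by have := pcharf0 ch3; rewrite !mulrS mulr0n addr0 addrA.
have no4 (a b c d : K) : a != b -> a != c -> a != d -> b != c -> b != d -> c != d ->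
    False.
  move=> ab ac ad bc bd cd; have u : uniq (map h [:: a; b; c; d]).
    by rewrite map_inj_uniq //= !inE !negb_or ab ac ad bc bd cd.
  have sub : {subset map h [:: a; b; c; d] <= iota 0 3}.
    by move=> _ /mapP[y _ ->]; rewrite mem_iota h3.
  by have := uniq_leq_size u sub.
have ne10 : (1 : K) != 0 by exact: oner_neq0.
have [e2|n2] := eqVneq (1 + 1 : K) 0.
  have [x x0 x1] : exists2 x : K, x != 0 & x != 1.
    apply: contrapT => nx.
    have sub : {subset map s (enum 'I_3) <= [:: 0; 1]}.
      move=> _ /mapP[i _ ->]; rewrite !inE; apply: contrapT => /negP.
      by rewrite negb_or => /andP[? ?]; apply: nx; exists (s i).
    have := uniq_leq_size _ sub; rewrite map_inj_uniq // enum_uniq size_map size_enum_ord.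
    by move=> /(_ isT).
  have shift1 (a b : K) : a != b -> 1 + a != 1 + b by rewrite (inj_eq (addrI 1)).
  case: (no4 0 1 x (1 + x)); rewrite 1?eq_sym //.
  - by rewrite -e2; exact: shift1.
  - by have := shift1 _ _ x0; rewrite addr0.
  - by rewrite -subr_eq0 addrK.
apply/eqP; apply: contraT => n3.
have shift1 (a b : K) : a != b -> 1 + a != 1 + b by rewrite (inj_eq (addrI 1)).
case: (no4 0 1 (1 + 1) (1 + 1 + 1)); rewrite 1?eq_sym //.
- by have := shift1 _ _ ne10; rewrite addr0.
- by have := shift1 _ _ n2; rewrite addr0 addrA.
- by have := shift1 _ _ (shift1 _ _ ne10); rewrite addr0 addrA.
Qed.

End Cardinality.

(** * From geometries to vectors *)

Section ProjectiveSpan.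
Variables (K : unitRingType) (dK : division_ring K) (V : lmodType K).

Lemma proj_pt_eq (u w : V) (u0 : u != 0) (w0 : w != 0) :
  proj_pt u0 = proj_pt w0 <-> exists2 c, c != 0 & u = c *: w.
Proof.
split=> [/(congr1 val) /= E|[c c0 E]].
  have : Defs.vline u u by exact: vline_id.
  rewrite E => -[c _ cE]; exists c => //.
  by apply: contra_neq u0 => c0; rewrite -cE c0 scale0r.
apply: val_inj; apply/seteqP; split=> _ [s _ <-] /=.
  by exists (s * c) => //; rewrite E scalerA.
by exists (s * c^-1) => //; rewrite E scalerA mulrVK //; exact: dK.
Qed.

Lemma subspace_proj_sub (W : set V) : vsubspace W ->
  @subspace (projective_space V dK) (proj_sub W).
Proof. by move=> sW; exists W. Qed.

Lemma closure_lspan (A : set (projective_space V dK)) (l : seq V) (u : V) (u0 : u != 0) :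
  (forall W, vsubspace W -> A `<=` proj_sub W -> contains W l) ->
  lspan l u -> Defs.closure A (proj_pt u0).
Proof.
move=> Al lu _ [[W sW <-] AW]; apply/(proj_subP u0 sW).
by apply: (lspan_min sW _ lu); exact: Al.
Qed.

Lemma closure_sub_lspan (A : set (projective_space V dK)) (W : set V) (u : V) (u0 : u != 0) :
  vsubspace W -> A `<=` proj_sub W -> Defs.closure A (proj_pt u0) -> W u.
Proof. by move=> sW AW cu; apply/(proj_subP u0 sW); exact: (closure_sub (subspace_proj_sub sW) AW cu). Qed.

(** A basis with four points gives three independent vectors, too many for the span
    of two. *)
Lemma dim_ge3_outside : dim_ge [set: projective_space V dK] 3 ->
  forall a b : V, exists c, ~ lspan [:: a; b] c.
Proof.
move=> [B [iB _ _] /card_ge_inj[s s_inj sB]] a b; apply: contrapT => nc.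
have all c : lspan [:: a; b] c by apply: contrapT => nl; apply: nc; exists c.
have /choice[v vP] : forall i : 'I_4, exists v : V, exists v0 : v != 0, s i = proj_pt v0.
  by move=> i; have [v [v0 E]] := proj_surj (s i); exists v, v0.
have ind (i : 'I_4) (l : seq 'I_4) : i \notin l -> ~ lspan (map v l) (v i).
  move=> il L; have [v0 E] := vP i; apply: (iB (s i) (sB i)); rewrite E.
  apply: closure_lspan L => W sW BW.
  elim: l il => //= j l IH; rewrite inE negb_or => /andP[ij /IH Wl]; split=> //.
  have [w0 Ej] := vP j; apply/(proj_subP w0 sW); rewrite -Ej; apply: BW.
  split; first exact: sB.
  by rewrite /= -E => /s_inj ji; rewrite ji eqxx in ij.
have fr : lfree [:: v ord0; v (inord 1); v (inord 2)].
  split; first by apply: (ind _ [:: inord 1; inord 2]); rewrite !inE -!val_eqE /= !inordK.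
  split; first by apply: (ind _ [:: inord 2]); rewrite !inE -!val_eqE /= !inordK.
  by split=> //; exact: (ind _ [::]).
have c : contains (lspan [:: a; b]) [:: v ord0; v (inord 1); v (inord 2)] by split.
by have := lfree_size dK fr c.
Qed.

Lemma lfree_spanning (l : seq V) :
  exists m, [/\ lfree m, (size m <= size l)%N & lspan l `<=` lspan m].
Proof.
elim: l => [|a l [m [fm sm lm]]]; first by exists [::]; split=> // v.
have [La|nLa] := pselect (lspan m a).
  exists m; split=> //; first exact: leqW.
  by apply: (lspan_min (vsubspace_lspan m)); split=> //; apply: (contains_sub (W := lspan l)) => //; exact: lspan_contains.
exists (a :: m); split=> //; apply: lspan_min => //; split; first exact: lspan_hd.
by apply: contains_sub (lspan_contains l) => u /lm; exact: lspan_tl.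
Qed.

(** The listed vectors may be dependent, but a plane is the span of exactly three
    independent ones. *)
Lemma lfree_extend (l : seq V) : (forall a b : V, exists c, ~ lspan [:: a; b] c) ->
  (size l <= 3)%N -> exists p q r, lfree [:: p; q; r] /\ lspan l `<=` lspan [:: p; q; r].
Proof.
move=> out sl; have [m [fm sm lm]] := lfree_spanning l.
have {sl sm} sm : (size m <= 3)%N := leq_trans sm sl.
suff [m' [fm' sm' mm']] : exists m', [/\ lfree m', size m' = 3%N & lspan m `<=` lspan m'].
  case: m' fm' sm' mm' => [|p [|q [|r [|//]]]] // fm' _ mm'.
  by exists p, q, r; split=> // u /lm /mm'.
have [k] : exists k, (size m + k = 3)%N by exists (3 - size m)%N; rewrite subnKC.
elim: k m fm {sm lm} => [|k IH] m fm sm; first by exists m; rewrite -sm addn0; split=> // v.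
have [a [b sub]] : exists a b, lspan m `<=` lspan [:: a; b].
  case: m sm {fm} => [|a [|b [|c m]]] sm.
  - by exists 0, 0 => u ->; exact: vsub0.
  - by exists a, 0; apply: lspan_min => //; split=> //; in_span.
  - by exists a, b.
  - by move: sm; rewrite /= !addSn addnS => -[].
have [c nc] := out a b.
have [||m' [fm' sm' cm']] := IH (c :: m); first by split=> // /sub.
  by rewrite /= addSnnS.
by exists m'; split=> // u Lu; apply: cm'; exact: lspan_tl.
Qed.

Lemma plane_lspan p q r : lfree [:: p; q; r] ->
  plane (proj_sub (lspan [:: p; q; r]) : set (projective_space V dK)).
Proof.
move=> fr; split; first exact: subspace_proj_sub.
have neq0 (l : seq V) (x : V) : lfree (x :: l) -> x != 0.
  by move=> /lfree_hd nx; apply/eqP => x0; apply: nx; rewrite x0; exact: vsub0.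
have perm a b c : contains (lspan [:: a; b; c]) [:: p; q; r] -> lfree [:: a; b; c].
  by move=> ct; exact: (lfree_gen dK fr ct).
have p0 := neq0 _ _ fr; have q0 := neq0 _ _ (lfree_tl fr).
have r0 := neq0 _ _ (lfree_tl (lfree_tl fr)).
pose v (i : nat) := if i == 0%N then p else if i == 1%N then q else r.
have v0 i : v i != 0 by rewrite /v; do 2 case: ifP => // _.
pose B : set (projective_space V dK) := [set proj_pt (v0 i) | i in `I_3].
have vin i : lspan [:: p; q; r] (v i).
  by rewrite /v; do 2 (case: ifP => _; first by in_span); in_span.
pose others i := if i == 0%N then [:: q; r] else if i == 1%N then [:: p; r] else [:: p; q].
have others_free i : (i < 3)%N -> ~ lspan (others i) (v i).
  case: i => [|[|[|//]]] _ /=; apply: lfree_hd; apply: perm;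
    by split; [in_span|split; [in_span|split=> //; in_span]].
have others_in i j : (i < 3)%N -> (j < 3)%N -> i <> j -> lspan (others i) (v j).
  by case: i => [|[|[|//]]] _; case: j => [|[|[|//]]] _ ij //=; rewrite /v /others /=; in_span.
exists B; last first.
  apply: inj_card_eq => i j; rewrite !inE /= => i3 j3 /proj_pt_eq[c c0 E].
  apply: contrapT => ij; apply: (others_free i i3); rewrite E.
  by apply: vsubZ => //; exact: others_in.
split.
- move=> _ [i i3 <-]; move=> /(closure_sub_lspan (vsubspace_lspan (others i))) L.
  apply: (others_free i i3); apply: L => _ [[j j3 <-] ne].
  apply/proj_subP => //; apply: others_in => // ij.
  by apply: ne; rewrite /= ij.
- by move=> _ [i _ <-]; apply/proj_subP.
- apply/seteqP; split.
    by apply: closure_sub; [exact: subspace_proj_sub|move=> _ [i _ <-]; apply/proj_subP].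
  move=> x; have [u [u0 ->]] := proj_surj x => /(proj_subP u0 (vsubspace_lspan _)).
  apply: closure_lspan => W sW BW.
  have Wv i : (i < 3)%N -> W (v i) by move=> i3; apply/(proj_subP (v0 i) sW); apply: BW; exists i.
  by split; [exact: (Wv 0)|split; [exact: (Wv 1)|split=> //; exact: (Wv 2)]].
Qed.

End ProjectiveSpan.

Section LocalHyperplanes.
Variables (K : unitRingType) (dK : division_ring K) (V : lmodType K).
Variable X : set (projective_space V dK).

Definition vectors_of : set V := [set v | exists v0 : v != 0, X (proj_pt v0)].

(** The hyperplane of the quotient comes from a subspace [W] containing [x], whose
    maximality says that [W] and any vector outside it generate [V].  The class of a
    vector [v] outside [W] is that of a point of [X], which is on the line joining
    [x] to [v]. *)
Lemma local_hyperplane x : locally_affino_projective X -> vectors_of x ->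
  exists H : set V, [/\ vsubspace H, exists o, ~ H o,
      forall o, ~ H o -> forall v, exists t, H (v - t *: o) &
      forall v, ~ H v -> exists a, vectors_of (v + a *: x)].
Proof.
move=> locX [x0 Xx]; pose p : projective_space V dK := proj_pt x0.
have sp := geometry_set1 (geometryP (projective_space V dK)) p.
have [Hq [sHq HqT Hqmax] XHq] := locX p Xx.
have [S [sS pS] SHq] := sHq; have [W sW WS] := sS.
have Sp : S p by exact: pS.
have memS (v : V) (v0 : v != 0) : S (proj_pt v0) <-> W v by rewrite -WS; exact: proj_subP.
have Wx : W x by apply/memS.
have off (v : V) (v0 : v != 0) : ~ W v -> ~ [set p] (proj_pt v0).
  by move=> nWv E; apply: nWv; apply/(memS v v0); rewrite E.
exists W; split=> //.
- apply: contrapT => nW; apply: HqT; apply/seteqP; split=> // c _; rewrite -SHq.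
  have [q nq qc] := quotient_surj c; exists q; split=> //.
  have [v [v0 ->]] := proj_surj q; apply/memS.
  by apply: contrapT => nWv; apply: nW; exists v.
- move=> o nWo v; pose W2 : set V := [set u | exists t, W (u - t *: o)].
  have sW2 : vsubspace W2.
    apply/vsubspaceP; split; first by exists 0; rewrite scale0r subr0; exact: vsub0.
    move=> s u w [t Wu] [r Ww]; exists (s * t + r).
    have -> : s *: u + w - (s * t + r) *: o = s *: (u - t *: o) + (w - r *: o) by lmod.
    exact: vsubL.
  have sub u : W u -> W2 u by move=> Wu; exists 0; rewrite scale0r subr0.
  have o0 : o != 0 by apply/eqP => o0; apply: nWo; rewrite o0; exact: vsub0.
  pose S2 : set (projective_space V dK) := proj_sub W2.
  have sS2 : subspace S2 by exact: subspace_proj_sub.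
  have pS2 : [set p] `<=` S2 by move=> _ ->; apply/proj_subP => //; exact: sub.
  have S2T : quotient_image S2 = setT :> set (point_quotient p).
    apply: contrapT => nT.
    have E : quotient_image S2 = Hq.
      apply: Hqmax => //; first by exists S2.
      rewrite -SHq => c [q [Sq nq qc]]; exists q; split=> //.
      have [u [u0 qE]] := proj_surj q; rewrite qE; apply/proj_subP => //.
      by apply: sub; apply/(memS u u0); rewrite -qE.
    have offo := off o o0 nWo; have [c cE] := quotient_mk (E := [set p]) offo.
    apply: nWo; apply/(memS o o0).
    have Sc : (quotient_image S : set (point_quotient p)) c.
      rewrite SHq -E; exists (proj_pt o0); split=> //.
      by apply/proj_subP => //; exists 1; rewrite scale1r subrr; exact: vsub0.
    exact: (quotient_imageP sS pS offo cE).1 Sc.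
  have [Wv|nWv] := pselect (W v); first exact: sub.
  have v0 : v != 0 by apply/eqP => v0; apply: nWv; rewrite v0; exact: vsub0.
  have [c cE] := quotient_mk (E := [set p]) (off v v0 nWv).
  have : quotient_image S2 c by rewrite S2T.
  by move=> /(quotient_imageP sS2 pS2 (off v v0 nWv) cE) /proj_subP; apply.
- move=> v nWv; have v0 : v != 0.
    by apply/eqP => v0; apply: nWv; rewrite v0; exact: vsub0.
  have [c cE] := quotient_mk (E := [set p]) (off v v0 nWv).
  have : (quotient_image X `|` Hq) c by rewrite XHq.
  case=> [[q [Xq nq cq]]|]; last first.
    by rewrite -SHq => /(quotient_imageP sS pS (off v v0 nWv) cE) /memS.
  have [u [u0 qE]] := proj_surj q.
  pose pv : projective_space V dK := proj_pt v0.
  have /lspan2P[s [t E]] : lspan [:: v; x] u.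
    have J : Defs.join [set q] [set p] = Defs.join [set pv] [set p].
      by apply: quotient_classE; [exact: off|rewrite -cq].
    have : Defs.join [set pv] [set p] (proj_pt u0).
      by rewrite -J qE; apply: sub_closure; left.
    apply: closure_sub_lspan => // y [->|->]; apply/proj_subP => //; in_span.
  have s0 : s != 0.
    apply/eqP => s0; apply: nq; rewrite qE; apply/proj_pt_eq => //.
    exists t; last by rewrite E s0 scale0r add0r.
    by apply: contra_neq (u0) => t0; rewrite E s0 t0 !scale0r addr0.
  exists (s^-1 * t); have uE : s^-1 *: u = v + (s^-1 * t) *: x.
    by rewrite E scalerDr scaleKx // scalerA.
  have u0' : s^-1 *: u != 0.
    by apply: contra_neq (u0) => E0; rewrite -(scalexK dK u s0) E0 scaler0.
  rewrite -uE; exists u0'; suff -> : proj_pt u0' = q by [].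
  by rewrite qE; apply/proj_pt_eq => //; exists s^-1 => //; exact: invx_neq0.
Qed.

End LocalHyperplanes.

(** * The theorem *)

Theorem mainTheorem3
  (K K' : unitRingType) (dK : division_ring K) (dK' : division_ring K')
  (V : lmodType K) (V' : lmodType K')
  (dimP : dim_ge [set: projective_space V dK] 3)
  (dimP' : dim_ge [set: projective_space V' dK'] 3)
  (cardK : `I_4 #<= [set: K] \/
           [set: K] #= `I_3 /\ 3%N \in [pchar K'])
  (X : set (projective_space V dK))
  (locX : locally_affino_projective X)
  (enoughX : enough_points (subgeometry X))
  (varphi : subgeometry X -> projective_space V' dK')
  (morph : geometry_morphism varphi)
  (not_in_plane : forall S : set (projective_space V' dK'),
     plane S -> ~ (range varphi `<=` S)) :
  exists! phi : projective_space V dK -> option (projective_space V' dK'),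
    partial_projective_morphism phi /\
    forall x : subgeometry X, phi (sval x) = Some (varphi x).
Proof.
have scalars := scalars_of_card cardK.
have /choice[f fP] : forall v : V, exists w : V', forall (x : subgeometry X) (v0 : v != 0),
    sval x = proj_pt v0 -> exists w0 : w != 0, varphi x = proj_pt w0.
  move=> v; have [[x [v0 xE]]|n] :=
    pselect (exists (x : subgeometry X) (v0 : v != 0), sval x = proj_pt v0).
    have [w [w0 E]] := proj_surj (varphi x); exists w => y v0' yE; exists w0.
    rewrite -E; congr varphi; apply: val_inj; rewrite /= yE xE; exact: val_inj.
  by exists 0 => x v0 xE; case: n; exists x, v0.
pose Xv := vectors_of X.
have point v : Xv v -> exists (x : subgeometry X) (v0 : v != 0) (w0 : f v != 0),
    sval x = proj_pt v0 /\ varphi x = proj_pt w0.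
  move=> [v0 Xv0]; have XX : proj_pt v0 \in X by rewrite inE.
  pose x : subgeometry X := exist _ (proj_pt v0) XX.
  by have [w0 E] := fP v x v0 erefl; exists x, v0, w0.
have f0 v : Xv v -> f v != 0 by move=> /point[x [v0 [w0 _]]].
have mor (W' : set V') : vsubspace W' -> exists2 W : set V, vsubspace W &
    forall v, Xv v -> (W' (f v) <-> W v).
  move=> sW'; have [S [W sW <-] SE] := morph _ (subspace_proj_sub dK' sW').
  exists W => // v /point[x [v0 [w0 [xE fxE]]]].
  rewrite -(proj_subP w0 sW') -(proj_subP v0 sW) -xE -fxE.
  by rewrite -[proj_sub W' _]/((varphi @^-1` proj_sub W') x) -SE.
have rankf a b c : exists2 v, Xv v & ~ lspan [:: a; b; c] (f v).
  have [p [q [r [fr sub]]]] :=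
    lfree_extend (l := [:: a; b; c]) (dim_ge3_outside dimP') isT.
  apply: contrapT => nv; apply: (not_in_plane _ (plane_lspan dK' fr)) => _ [x _ <-].
  have [v [v0 xE]] := proj_surj (sval x); have [w0 ->] := fP v x v0 xE.
  apply/proj_subP => //; apply: sub; apply: contrapT => nL; apply: nv.
  by exists v => //; exists v0; rewrite -xE; exact: set_mem (svalP x).
have locv x : Xv x -> _ := local_hyperplane locX.
have [Phi sl PhiP] := global_extension dK dK' f0 mor locv rankf scalars.
have [_ [sigma sigmaP]] := sl.
have /choice[phi phiP] : forall p : projective_space V dK,
    exists r : option (projective_space V' dK'), forall (v : V) (v0 : v != 0),
    p = proj_pt v0 ->
    (forall Phiv0 : Phi v != 0, r = Some (proj_pt Phiv0)) /\ (Phi v = 0 -> r = None).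
  move=> p; have [u [u0 pE]] := proj_surj p.
  have scale v (v0 : v != 0) : p = proj_pt v0 -> exists2 c, c != 0 & Phi v = c *: Phi u.
    rewrite pE => /esym /(proj_pt_eq dK v0 u0)[c c0 E]; exists (sigma c).
      exact: (sigma_neq0 dK).
    by rewrite E sigmaP.
  have [Pu0|Pu0] := eqVneq (Phi u) 0.
    exists None => v v0 /scale[c c0 E]; split=> // Pv0.
    by case/eqP: (Pv0); rewrite E Pu0 scaler0.
  exists (Some (proj_pt Pu0)) => v v0 /scale[c c0 E]; split=> [Pv0|Pv0].
    congr Some; apply/proj_pt_eq => //; exists c^-1; first exact: invx_neq0.
    by rewrite E scaleKx.
  have := c0; rewrite (scalex_eq0 dK' (s := c) _ Pu0) ?eqxx //.
  by rewrite -E.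
have phi_pm : partial_projective_morphism phi.
  by exists Phi => // v v0; exact: phiP.
exists phi; split.
  split=> // x; have [v [v0 xE]] := proj_surj (sval x).
  have Xvv : Xv v by exists v0; rewrite -xE; exact: set_mem (svalP x).
  have [w0 ->] := fP v x v0 xE; have [c c0 E] := PhiP v Xvv.
  have P0 : Phi v != 0 by apply: contra_neq (w0) => P0; rewrite E P0 scaler0.
  have [-> _] := phiP _ v v0 xE; congr Some; apply/proj_pt_eq => //.
  by exists c^-1; [exact: invx_neq0|rewrite E scaleKx].
move=> phi' [[Phi' sl' Phi'P] ext'].
have PhiP' v : Xv v -> exists2 c, c != 0 & f v = c *: Phi' v.
  move=> /point[x [v0 [w0 [xE fxE]]]]; have := ext' x; rewrite xE fxE.
  have [some none] := Phi'P v v0.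
  have [P0|P0] := eqVneq (Phi' v) 0; first by rewrite none.
  by rewrite some => /Some_inj /esym /(proj_pt_eq dK' w0 P0).
have [c c0 E] := global_uniqueness dK dK' f0 locv rankf scalars sl sl' PhiP PhiP'.
apply/funext => p; have [v [v0 pE]] := proj_surj p; rewrite pE.
have [some none] := phiP _ v v0 erefl; have [some' none'] := Phi'P v v0.
have [P0|P0] := eqVneq (Phi' v) 0; first by rewrite none' // none // E P0 scaler0.
have P1 : Phi v != 0 by apply: contra_neq (P0) => P1; rewrite -(scaleKx dK' (Phi' v) c0) -E P1 scaler0.
by rewrite (some P1) (some' P0); congr Some; apply/proj_pt_eq => //; exists c.
Qed.
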